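(* The Clifford torus is the only minimal surface in $S^3$ with constant contact angle. That is, the Clifford torus is a minimal surface in $S^3$ with constant contact angle, and if $S$ is an (immersed, orientable) minimal surface in $S^3$ whose contact angle $\beta$ is constant, then $S$ is the Clifford torus.
   Context: Equip $\mathbb{C}^2$ with the Hermitian product $(z,w)=z^1\bar w^1+z^2\bar w^2$ and the inner product $\langle z,w\rangle=\mathrm{Re}\,(z,w)$, and let $S^3=\{z\in\mathbb{C}^2 : (z,z)=1\}$ be the unit sphere. The Reeb vector field on $S^3$ is $\xi(z)=iz$, and the contact distribution is $\delta_z=\{v\in T_zS^3 : \langle \xi(z),v\rangle=0\}$, which is invariant under multiplication by $i$. Let $S$ be an immersed orientable surface in $S^3$, with the induced metric. The contact angle $\beta$ of $S$ is the complementary angle between the contact distribution $\delta$ and the tangent space $TS$. Concretely, let $(e_1,e_2)$ be a local orthonormal frame of $TS$ with $e_1\in TS\cap\delta$ a unit vector field ($e_1$ is called the characteristic vector field). Then $e_2=\sin(\beta)\,i e_1+\cos(\beta)\,\xi$; in particular $\cos\beta=\langle \xi,e_2\rangle$. The Clifford torus is $T^2=\{(z_1,z_2)\in\mathbb{C}^2 : z_1\bar z_1=\tfrac12,\ z_2\bar z_2=\tfrac12\}\subset S^3$.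
   Formalization: Literally false: open pieces and unitary images of the torus also qualify. The formal theorem takes S connected and shows its image lies in a unitary image of the Clifford torus, and equals it when S is complete (in particular compact). *)

(* Defs.v *)
From HB Require Import structures.
From mathcomp Require Import all_boot all_order all_algebra.
From mathcomp Require Import all_classical all_reals all_analysis.
From mathcomp Require Import complex.
Set Implicit Arguments.
Unset Strict Implicit.
Unset Printing Implicit Defensive.
Import Order.TTheory GRing.Theory Num.Theory.
Import numFieldNormedType.Exports.
Local Open Scope classical_set_scope.
Local Open Scope ring_scope.
Local Open Scope complex_scope.

Notation C2 R := 'rV[complex R]_2.
Local Notation Re := complex.Re.
Local Notation Im := complex.Im.

Section Ambient.
Variable R : realType.

Definition hprod (z w : C2 R) : R[i] := \sum_(k < 2) z 0 k * (w 0 k)^*.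

Definition inner (z w : C2 R) : R := Re (hprod z w).

Definition norm2 (v : C2 R) : R := Num.sqrt (inner v v).

Definition sphere3 : set (C2 R) := [set z | hprod z z = 1].

Definition tangent_sphere3 (z v : C2 R) : Prop := inner z v = 0.

Definition reeb (z : C2 R) : C2 R := 'i%C *: z.

Definition contact_distribution (z v : C2 R) : Prop :=
  tangent_sphere3 z v /\ inner (reeb z) v = 0.

Definition clifford_torus : set (C2 R) :=
  [set z : C2 R | z 0 0 * (z 0 0)^* = 2^-1 /\ z 0 1 * (z 0 1)^* = 2^-1].

End Ambient.
Arguments clifford_torus : clear implicits.

Section Calculus.
Variable R : realType.

(* C^k on an open set A, by recursion: F is C^(k+1) iff it is differentiable
   and its two partial derivatives are C^k. *)
Fixpoint Ck (V : normedModType R) (k : nat) (A : set 'rV[R]_2)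
    (F : 'rV[R]_2 -> V) : Prop :=
  match k with
  | 0%N => forall x, A x -> {for x, continuous F}
  | k'.+1 => (forall x, A x -> differentiable F x) /\
             forall j : 'I_2, Ck k' A (fun x => 'D_(delta_mx 0 j) F x)
  end.

Definition smooth (V : normedModType R) (A : set 'rV[R]_2)
    (F : 'rV[R]_2 -> V) : Prop := forall k, Ck k A F.

(* R[i] carries no normed R-module structure in the libraries: derivatives of
   C^2-valued maps are taken on real and imaginary parts of the coordinates. *)
Definition smoothC2 (A : set 'rV[R]_2) (F : 'rV[R]_2 -> C2 R) : Prop :=
  forall k : 'I_2, smooth A (fun x => Re (F x 0 k) : R^o) /\
                   smooth A (fun x => Im (F x 0 k) : R^o).

Definition partial (j : 'I_2) (F : 'rV[R]_2 -> C2 R) (x : 'rV[R]_2) : C2 R :=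
  \row_k ('D_(delta_mx 0 j) (fun y => Re (F y 0 k) : R^o) x
          +i* 'D_(delta_mx 0 j) (fun y => Im (F y 0 k) : R^o) x).

Definition differentialC2 (F : 'rV[R]_2 -> C2 R) (x v : 'rV[R]_2) : C2 R :=
  \sum_(j < 2) (v 0 j)%:C *: partial j F x.

Definition velocity (c : R -> C2 R) (t : R) : C2 R :=
  \row_k (derive1 (fun s => Re (c s 0 k) : R^o) t
          +i* derive1 (fun s => Im (c s 0 k) : R^o) t).

Definition C1_on_unit_interval (c : R -> R) : Prop :=
  forall t, t \in `[0, 1] ->
    derivable (c : R -> R^o) t 1 /\
    {for t, continuous (derive1 (c : R -> R^o))}.

End Calculus.

Section Surfaces.
Variable R : realType.

Record chart (M : topologicalType) := Chart {
  dom : set M;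
  codom : set 'rV[R]_2;
  coord : M -> 'rV[R]_2;
  param : 'rV[R]_2 -> M;
  dom_open : open dom;
  codom_open : open codom;
  coord_codom : forall p, dom p -> codom (coord p);
  param_dom : forall x, codom x -> dom (param x);
  coordK : forall p, dom p -> param (coord p) = p;
  paramK : forall x, codom x -> coord (param x) = x;
  coord_continuous : forall p, dom p -> {for p, continuous coord};
  param_continuous : forall x, codom x -> {for x, continuous param} }.

Definition transition (M : topologicalType) (c d : chart M) :
  'rV[R]_2 -> 'rV[R]_2 := coord d \o param c.

Definition overlap (M : topologicalType) (c d : chart M) : set 'rV[R]_2 :=
  codom c `&` param c @^-1` dom d.

Definition compatible (M : topologicalType) (c d : chart M) : Prop :=
  smooth (overlap c d) (transition c d) /\
  smooth (overlap d c) (transition d c).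

Definition is_atlas (M : topologicalType) (A : set (chart M)) : Prop :=
  (forall p, exists2 c, A c & dom c p) /\
  (forall c d, A c -> A d -> compatible c d).

(* Surfaces are connected and nonempty; the metric is the one induced by the
   immersion, and no completeness is built in. *)
Record immersed_surface (M : topologicalType) := ImmersedSurface {
  atlas : set (chart M);
  immersion :> M -> C2 R;
  surface_hausdorff : hausdorff_space M;
  surface_second_countable : @second_countable M;
  surface_connected : connected [set: M];
  surface_nonempty : [set: M] !=set0;
  surface_atlas : is_atlas atlas;
  immersion_sphere3 : forall p, sphere3 (immersion p);
  immersion_smooth : forall c, atlas c ->
    smoothC2 (codom c) (immersion \o param c);
  immersion_injective_differential : forall c x, atlas c -> codom c x ->
    injective (differentialC2 (immersion \o param c) x) }.

Section SurfaceNotions.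
Variables (M : topologicalType) (S : immersed_surface M).

Definition orientable : Prop :=
  exists A : set (chart M),
    [/\ is_atlas A,
        forall c d, A c -> atlas S d -> compatible c d &
        forall c d x, A c -> A d -> overlap c d x ->
          0 < \det ('J (transition c d) x)].

Definition local_param (c : chart M) : 'rV[R]_2 -> C2 R := S \o param c.

Definition tangent_plane (c : chart M) (x : 'rV[R]_2) : set (C2 R) :=
  range (differentialC2 (local_param c) x).

Definition first_fundamental_form (c : chart M) (x : 'rV[R]_2) : 'M[R]_2 :=
  \matrix_(i, j) inner (partial i (local_param c) x)
                       (partial j (local_param c) x).

Definition second_fundamental_form (c : chart M) (n : C2 R) (x : 'rV[R]_2) :
    'M[R]_2 :=
  \matrix_(i, j) inner (partial i (partial j (local_param c)) x) n.

Definition unit_normal (c : chart M) (x : 'rV[R]_2) (n : C2 R) : Prop :=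
  [/\ inner n n = 1, tangent_sphere3 (local_param c x) n &
      forall v, tangent_plane c x v -> inner v n = 0].

Definition mean_curvature (c : chart M) (n : C2 R) (x : 'rV[R]_2) : R :=
  2^-1 * \tr (invmx (first_fundamental_form c x)
              *m second_fundamental_form c n x).

Definition minimal : Prop :=
  forall c x n, atlas S c -> codom c x -> unit_normal c x n ->
    mean_curvature c n x = 0.

(* (e1, e2) is an orthonormal frame of TS over V, with e1 characteristic and
   e2 = sin(beta) i e1 + cos(beta) xi. *)
Definition contact_frame (beta : M -> R) (c : chart M) (V : set 'rV[R]_2)
    (e1 e2 : 'rV[R]_2 -> C2 R) : Prop :=
  [/\ smoothC2 V e1, smoothC2 V e2 &
   forall x, V x ->
     [/\ tangent_plane c x (e1 x) /\ tangent_plane c x (e2 x),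
         [/\ inner (e1 x) (e1 x) = 1, inner (e2 x) (e2 x) = 1 &
             inner (e1 x) (e2 x) = 0],
         contact_distribution (local_param c x) (e1 x) &
         e2 x = (sin (beta (param c x)))%:C *: ('i%C *: e1 x)
                + (cos (beta (param c x)))%:C
                  *: reeb (local_param c x)]].

(* The frame is determined only up to signs, so the contact angle is defined
   through the existence of adapted local frames. *)
Definition contact_angle (beta : M -> R) : Prop :=
  forall c x, atlas S c -> codom c x ->
    exists V : set 'rV[R]_2,
      [/\ open V, V x, V `<=` codom c &
          exists e1 e2, contact_frame beta c V e1 e2].

Definition constant_contact_angle : Prop :=
  exists b : R, contact_angle (fun=> b).

(* For an immersion, a continuous curve g in M is C^1 iff S \o g is. *)
Definition C1_curve (g : R -> M) : Prop :=
  (forall t, t \in `[0, 1] -> {for t, continuous g}) /\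
  forall k : 'I_2,
    C1_on_unit_interval (fun t => Re (S (g t) 0 k)) /\
    C1_on_unit_interval (fun t => Im (S (g t) 0 k)).

Definition curve_length (g : R -> M) : R :=
  \int[lebesgue_measure]_(t in `[0, 1]) norm2 (velocity (S \o g) t).

(* The Riemannian distance, an infimum of lengths, is < e iff some curve has
   length < e. *)
Definition dist_lt (p q : M) (e : R) : Prop :=
  exists g, [/\ C1_curve g, g 0 = p, g 1 = q & curve_length g < e].

Definition complete_surface : Prop :=
  forall u : nat -> M,
    (forall e : R, 0 < e -> exists N : nat,
       forall m n, (N <= m)%N -> (N <= n)%N -> dist_lt (u m) (u n) e) ->
    exists p : M, u @ \oo --> p.

End SurfaceNotions.
End Surfaces.

Definition unitary_image (R : realType) (U : 'M[R[i]]_2) (A : set (C2 R)) :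
  set (C2 R) := (fun z : C2 R => z *m U) @` A.

(* Main.v *)
Require Import Defs.
From HB Require Import structures.
From mathcomp Require Import all_boot all_order all_algebra.
From mathcomp Require Import all_classical all_reals all_analysis.
From mathcomp Require Import complex.
From mathcomp Require Import ring lra.
Import Order.TTheory GRing.Theory Num.Theory.
Import numFieldNormedType.Exports.
Local Open Scope classical_set_scope.
Local Open Scope ring_scope.

(* Let F be the immersion and (e1, e2) a contact frame, so that (F, e1) is a
   unitary frame of C^2. When the contact angle is constant, the derivatives of
   this frame involve only the angle, the coframe and one connection form.
   Minimality and the symmetry of the second fundamental form determine the
   connection form up to the factor cos beta, and the symmetry of the second
   derivatives of F and e1 then forces sin beta = 0. After that the matrix e1^* F - F^* e1 has derivative zero. As e1
   is determined up to sign, this matrix is constant up to sign on the connected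
   surface, and it puts every point on one unitary image of the Clifford torus.

   If the surface is complete, its image is the whole torus: a geodesic
   u |-> (w1 exp (i a u), w2 exp (i b u)) of the torus lifts locally to the
   surface because the immersion is a local diffeomorphism onto the torus, and a
   sequence of lifts that are nearly as long as possible is Cauchy, so that the
   lift cannot stop before the end of the geodesic.

   The Clifford torus itself is charted by pairs of angles. The transition maps
   are locally translations, and the Reeb field is tangent to the torus, which
   gives contact angle 0. *)

(** Write s = sin beta and c = cos beta, with E = e1. The vanishing of s comes from one exterior
    derivative. The connection form satisfies c^2 (dE, iE) = (1 + s^2) (dF, iF) for the real inner
    product, and the exterior derivatives of the two 1-forms are opposite multiples of s times the
    area form. Hence s (c^2 + 1 + s^2) = 0. The factor c is carried along because c = 0 is not
    excluded at that stage. Once s = 0, each of F - iE and F + iE is differentiated into an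
    imaginary multiple of itself. So F is half the sum of two orthogonal vectors that only turn
    inside fixed complex lines, which is the motion of a point on a torus. The constant matrix D of
    the overview records these two lines without choosing phases. The sesquilinear form of D
    vanishes at z = F because (F, E) = 0. Since D is constant up to sign, every point of the surface
    satisfies this equation for one and the same D, and on the sphere the equation defines a unitary
    image of the Clifford torus. *)

Set Implicit Arguments.
Unset Strict Implicit.
Unset Printing Implicit Defensive.

Local Notation Re := complex.Re.
Local Notation Im := complex.Im.
Local Notation codom := Defs.codom.
Local Notation coord := Defs.coord.

HB.instance Definition _ (R : realType) (m n : nat) := Complete.on 'M[R]_(m.+1, n.+1).

Lemma ord2P (P : 'I_2 -> Prop) : P 0 -> P 1 -> forall i, P i.
Proof.
move=> h0 h1 [[|[|//]] i].
  by rewrite (_ : Ordinal i = 0) //; exact/val_inj.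
by rewrite (_ : Ordinal i = 1) //; exact/val_inj.
Qed.

(** * Calculus in the plane *)

Section Calculus.
Variable R : realType.
Implicit Types (A B : set 'rV[R]_2) (f : 'rV[R]_2 -> R^o).

Lemma is_derive_line (V W : normedModType R) (f : V -> W) (x u : V) (t : R) :
  derivable f (x + t *: u) u ->
  is_derive t 1 (fun s : R => f (x + s *: u)) ('D_u f (x + t *: u)).
Proof.
have E : (fun h : R => h^-1 *: (((fun s : R => f (x + s *: u)) \o shift t) (h *: (1 : R))
     - f (x + t *: u))) =
   (fun h => h^-1 *: ((f \o shift (x + t *: u)) (h *: u) - f (x + t *: u))).
  apply/funext => h /=; congr (_ *: (f _ - _)).
  by rewrite [h%:A]mulr1 scalerDl addrCA.
move=> d; split; first by rewrite /derivable E.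
by rewrite /derive E.
Qed.

Lemma mean_value (f df : R -> R^o) (h : R) : 0 < h ->
  (forall s : R, 0 <= s <= h -> is_derive s 1 f (df s)) ->
  exists2 s, 0 <= s <= h & f h - f 0 = df s * h.
Proof.
move=> h0 H.
have [s||s sI] := @MVT R f df 0 h h0.
- by rewrite in_itv /= => /andP[/ltW s0 /ltW sh]; apply: H; rewrite s0 sh.
- apply: derivable_within_continuous => s; rewrite in_itv /= => sI.
  by have [] := H s sI.
rewrite subr0 => Es; exists s => //.
by move: sI; rewrite in_itv /= => /andP[/ltW -> /ltW ->].
Qed.

Lemma Ck_sub (V : normedModType R) k A B (F : 'rV[R]_2 -> V) :
  A `<=` B -> Ck k B F -> Ck k A F.
Proof.
move=> AB; elim: k F => [|k IH] F /=; first by move=> h x /AB /h.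
by case=> h1 h2; split=> [x /AB /h1//|j]; exact: IH.
Qed.

Lemma smooth_sub (V : normedModType R) A B (F : 'rV[R]_2 -> V) :
  A `<=` B -> smooth B F -> smooth A F.
Proof. by move=> AB h k; exact: Ck_sub (h k). Qed.

Lemma smooth_differentiable (V : normedModType R) A (F : 'rV[R]_2 -> V) x :
  smooth A F -> A x -> differentiable F x.
Proof. by move=> /(_ 1%N)[/= h _] /h. Qed.

Lemma smooth_continuous (V : normedModType R) A (F : 'rV[R]_2 -> V) x :
  smooth A F -> A x -> {for x, continuous F}.
Proof. by move=> /(_ 0%N) h /h. Qed.

Lemma smooth_derive (V : normedModType R) A (F : 'rV[R]_2 -> V) j :
  smooth A F -> smooth A (fun x => 'D_(delta_mx 0 j) F x).
Proof. by move=> h k; have [_] := h k.+1; exact. Qed.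

(** The mean value theorem is used twice: along [u] for the increment of [g] in direction [v], then
    along [v] for the resulting increment of ['D_u g]. *)
Lemma second_difference (V : normedModType R) (g : V -> R^o) (x u v : V) (h : R) :
  0 < h ->
  (forall s t : R, 0 <= s <= h -> 0 <= t <= h ->
     derivable g (x + s *: u + t *: v) u /\
     derivable ('D_u g) (x + s *: u + t *: v) v) ->
  exists s t : R, [/\ 0 <= s <= h, 0 <= t <= h &
    g (x + h *: u + h *: v) - g (x + h *: u) - g (x + h *: v) + g x =
    h ^+ 2 * 'D_v ('D_u g) (x + s *: u + t *: v)].
Proof.
move=> h0 H.
have hh : 0 <= h <= h by rewrite lexx ltW.
have h00 : (0 : R) <= (0 : R) <= h by rewrite (lexx (0 : R)) (ltW h0).
have D1 (s : R) : 0 <= s <= h ->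
  is_derive s 1 (fun s : R => g ((x + h *: v) + s *: u) - g (x + s *: u))
    ('D_u g (x + s *: u + h *: v) - 'D_u g (x + s *: u)).
  move=> sh; have [d1 _] := H s h sh hh; have [d2 _] := H s 0 sh h00.
  have E : x + s *: u + h *: v = (x + h *: v) + s *: u by rewrite addrAC.
  rewrite E in d1 *; rewrite scale0r addr0 in d2.
  by apply: is_deriveB; exact: is_derive_line.
have [s sh Es] := mean_value h0 D1.
have D2 (t : R) : 0 <= t <= h ->
  is_derive t 1 (fun t : R => 'D_u g ((x + s *: u) + t *: v))
    ('D_v ('D_u g) (x + s *: u + t *: v)).
  by move=> th; have [_ d1] := H s t sh th; exact: is_derive_line.
have [t th Et] := mean_value h0 D2.
exists s, t; split=> //.
move: Es Et; rewrite !scale0r !addr0 => Es Et.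
rewrite [LHS](_ : _ = g (x + h *: u + h *: v) - g (x + h *: u) -
  (g (x + h *: v) - g x)); last by ring.
by rewrite [x + h *: u + h *: v]addrAC Es Et expr2 -mulrA [RHS]mulrC.
Qed.

(** The two functions may be sampled at different points of the parallelogram. Both points tend to
    [x] with [h], so continuity is enough to compare the values at [x]. *)
Lemma equal_at_common_limit (V : normedModType R) (A : set V) (g1 g2 : V -> R^o)
    (x u v : V) : open A -> A x ->
  {for x, continuous g1} -> {for x, continuous g2} ->
  (forall h : R, 0 < h ->
     (forall s t : R, 0 <= s <= h -> 0 <= t <= h -> A (x + s *: u + t *: v)) ->
     exists s t s' t' : R, [/\ 0 <= s <= h /\ 0 <= t <= h, 0 <= s' <= h /\ 0 <= t' <= h &
       g1 (x + s *: u + t *: v) = g2 (x + s' *: u + t' *: v)]) ->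
  g1 x = g2 x.
Proof.
move=> oA Ax c1 c2 H.
apply/eqP; rewrite -subr_eq0 -normr_le0; apply/ler_addgt0Pl => e e0; rewrite addr0.
have e20 : 0 < e / 2 by rewrite divr_gt0.
have nA : \forall y \near x, A y by exact: open_nbhs_nbhs.
move/cvgrPdist_lt : c1 => /(_ _ e20) c1; move/cvgrPdist_lt : c2 => /(_ _ e20) c2.
have : \forall y \near x, [/\ A y, `|g1 x - g1 y| < e / 2 & `|g2 x - g2 y| < e / 2].
  by move: nA c1 c2; apply: filterS3 => y; split.
move=> /nbhs_ballP[r /= r0 Hr].
(* This size keeps the whole parallelogram inside the ball of radius [r]; the summand 1 keeps the
   denominator positive when [u] and [v] vanish. *)
pose h := r / (`|u| + `|v| + 1).
have N0 : 0 < `|u| + `|v| + 1 by rewrite ltr_wpDl// addr_ge0.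
have h0 : 0 < h by rewrite divr_gt0.
have inb (s t : R) : 0 <= s <= h -> 0 <= t <= h -> ball x r (x + s *: u + t *: v).
  move=> /andP[s0 sh] /andP[t0 th]; rewrite -ball_normE /= -addrA opprD addNKr normrN.
  apply: (le_lt_trans (ler_normD _ _)); rewrite !normrZ (ger0_norm s0) (ger0_norm t0).
  apply: (@le_lt_trans _ _ (h * `|u| + h * `|v|)).
    by apply: lerD; apply: ler_wpM2r.
  by rewrite -mulrDr /h mulrAC ltr_pdivrMr// ltr_pM2l// ltrDl.
have [s t sh th|s [t [s' [t' [[sh th] [sh' th'] E]]]]] := H h h0.
  by have [] := Hr _ (inb s t sh th).
have [_ H1 _] := Hr _ (inb s t sh th); have [_ _ H2] := Hr _ (inb s' t' sh' th').
rewrite (_ : _ - _ = (g1 x - g1 (x + s *: u + t *: v)) -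
   (g2 x - g2 (x + s' *: u + t' *: v))); last by rewrite E; ring.
by rewrite [leRHS]splitr (le_trans (ler_normB _ _))// lerD// ltW.
Qed.

(** The second difference over a square is symmetric in the two directions, so both mixed
    derivatives, each at some point of the square, equal it divided by [h ^+ 2]. *)
Lemma schwarz A f (i j : 'I_2) (x : 'rV[R]_2) : open A -> A x -> smooth A f ->
  'D_(delta_mx 0 j) ('D_(delta_mx 0 i) f) x =
  'D_(delta_mx 0 i) ('D_(delta_mx 0 j) f) x.
Proof.
move=> oA Ax sf.
have cancel (h a b c d X Y : R) : 0 < h -> a - b - c + d = h ^+ 2 * X ->
    a - c - b + d = h ^+ 2 * Y -> X = Y.
  move=> h0; rewrite (addrAC a) => -> /mulfI; apply.
  by rewrite expf_neq0// gt_eqF.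
have cont k l : {for x, continuous
    ('D_(delta_mx 0 k) ('D_(delta_mx 0 l) f) : 'rV[R]_2 -> R^o)}.
  by apply: (smooth_continuous _ Ax); do 2! apply: smooth_derive.
have dv w w' y : A y -> derivable f y (delta_mx 0 w) /\
    derivable ('D_(delta_mx 0 w) f) y (delta_mx 0 w').
  move=> Ay; split; apply: diff_derivable; apply: (smooth_differentiable _ Ay) => //.
  exact: smooth_derive.
apply: (equal_at_common_limit oA Ax (cont j i) (cont i j)
  (u := delta_mx 0 i) (v := delta_mx 0 j)) => h h0 hA.
have [s [t [sh th]]] := second_difference (g := f) h0
  (fun s t sh th => dv i j _ (hA s t sh th)).
have [|t' [s' [th' sh']]] := second_difference (g := f) (x := x)
  (u := delta_mx 0 j) (v := delta_mx 0 i) h0.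
  by move=> t' s' th' sh'; rewrite addrAC; exact: dv (hA s' t' sh' th').
rewrite [X in f X]addrAC [x + t' *: _ + _]addrAC => E2 E1.
exists s, t, s', t'; split; [exact: conj sh th|exact: conj sh' th'|].
exact (cancel _ _ _ _ _ _ _ h0 E1 E2).
Qed.

Lemma derive_rV f (y w : 'rV[R]_2) : differentiable f y ->
  'D_w f y = w 0 0 * 'D_(delta_mx 0 0) f y + w 0 1 * 'D_(delta_mx 0 1) f y.
Proof.
move=> df; rewrite !deriveE// {1}(row_sum_delta w) big_ord_recl big_ord1.
rewrite linearD !linearZ /=; congr (w 0 _ * 'd f y (delta_mx 0 _) +
  w 0 _ * 'd f y (delta_mx 0 _)); exact/val_inj.
Qed.

Lemma mean_value_rV f (x w : 'rV[R]_2) :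
  (forall t : R, 0 <= t <= 1 -> differentiable f (x + t *: w)) ->
  exists2 t : R, 0 <= t <= 1 & f (x + w) - f x =
    w 0 0 * 'D_(delta_mx 0 0) f (x + t *: w) + w 0 1 * 'D_(delta_mx 0 1) f (x + t *: w).
Proof.
move=> df.
have D (t : R) : 0 <= t <= 1 ->
    is_derive t 1 (fun t => f (x + t *: w) : R^o) ('D_w f (x + t *: w)).
  by move=> t01; apply: is_derive_line; apply: diff_derivable; exact: df.
have [t t01] := mean_value ltr01 D.
by rewrite scale1r scale0r addr0 mulr1 => ->; exists t; rewrite // derive_rV//; exact: df.
Qed.

Lemma ball_segment (x w : 'rV[R]_2) (r t : R) : `|w| < r -> 0 <= t <= 1 ->
  ball x r (x + t *: w).
Proof.
move=> wr /andP[t0 t1]; rewrite -ball_normE /= opprD addNKr normrN normrZ ger0_norm//.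
by apply: le_lt_trans wr; rewrite ler_piMl.
Qed.

Lemma locally_constant A f x : open A -> A x ->
  (forall y, A y -> differentiable f y) ->
  (forall y j, A y -> 'D_(delta_mx 0 j) f y = 0) ->
  \forall y \near x, f y = f x.
Proof.
move=> oA Ax df f0; have /nbhs_ballP[r /= r0 rA] : \forall y \near x, A y.
  exact: open_nbhs_nbhs.
near=> y.
have yr : `|y - x| < r.
  by rewrite distrC; near: y; apply/nbhs_ballP; exists r => //= y; rewrite -ball_normE.
have [|t t01] := @mean_value_rV f x (y - x).
  by move=> t t01; apply/df/rA/ball_segment.
have Ay : A (x + t *: (y - x)) by apply/rA/ball_segment.
by rewrite !f0// !mulr0 addr0 [x + _]addrC subrK => /eqP; rewrite subr_eq0 => /eqP.
Unshelve. all: by end_near. Qed.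

(** Solving [f x = y] means finding a fixed point of [x - f x + y], which contracts distances by
    1/2. Near [x0] the contraction uses up half of the radius [r], and the remaining [r / 2] is the
    freedom left for [y]. *)
Lemma near_identity_inverse (V : completeNormedModType R) (f : V -> V) (x0 : V) (r : R) :
  0 < r ->
  (forall x y, `|x - x0| <= r -> `|y - x0| <= r ->
     `|(x - f x) - (y - f y)| <= 2^-1 * `|x - y|) ->
  exists H : V -> V, [/\
    forall y, `|y - f x0| <= r / 2 -> `|H y - x0| <= r /\ f (H y) = y,
    forall y, `|y - f x0| < r / 2 -> {for y, continuous H} &
    forall x, `|x - x0| <= r -> `|f x - f x0| <= r / 2 -> H (f x) = x].
Proof.
move=> r0 hf.
have r2 : 0 < r / 2 by rewrite divr_gt0.
have subrACA (a b a1 b1 : V) : a - b - (a1 - b1) = a - a1 - (b - b1).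
  by rewrite opprD addrACA -opprD.
(* This expansion estimate gives at once the uniqueness of the preimage and the continuity of the
   inverse. *)
have lip x y : `|x - x0| <= r -> `|y - x0| <= r -> `|x - y| <= 2 * `|f x - f y|.
  move=> hx hy; have := hf x y hx hy.
  have : `|x - y| <= `|(x - f x) - (y - f y)| + `|f x - f y|.
    rewrite (le_trans _ (ler_normD _ _))// (_ : _ + (f x - f y) = x - y)//.
    by rewrite subrACA subrK.
  lra.
have ex y : `|y - f x0| <= r / 2 -> exists2 x, `|x - x0| <= r & f x = y.
  move=> hy; pose U := [set x | `|x - x0| <= r].
  have KU : set_fun U U (fun x => x - f x + y).
    move=> x /= hx; rewrite /U /=.
    rewrite (_ : _ - x0 = ((x - f x) - (x0 - f x0)) + (y - f x0)); last first.
      by rewrite opprB -[RHS]addrA [f x0 - x0 + _]addrC subrKA addrA.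
    rewrite (le_trans (ler_normD _ _))// [leRHS]splitr lerD//.
    apply: (le_trans (hf x x0 hx _)); first by rewrite subrr normr0 ltW.
    by rewrite mulrC ler_wpM2r// invr_ge0.
  pose K : {fun U >-> U} := HB.pack (fun x => x - f x + y) (isFun.Build _ _ _ _ _ KU).
  have cK : is_contraction K.
    exists (2^-1%:nng); split => /=; first by rewrite invf_lt1 ?ltr1n.
    move=> [a b] [/= Ua Ub].
    by rewrite /K /= opprD addrACA subrr addr0; exact: hf.
  have cU : closed U.
    rewrite (_ : U = closed_ball_ Num.norm x0 r); first exact: closed_closed_ball_.
    by apply/seteqP; split=> x; rewrite /U /closed_ball_ /= distrC.
  have [|p Up Kp] := banach_fixed_point cK cU.
    by exists x0; rewrite /U /= subrr normr0 ltW.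
  exists p => //; move: Kp; rewrite /K /= -addrA -{1}[p]addr0 => /addrI /esym /eqP.
  by rewrite addrC subr_eq0 => /eqP.
(* The default [x0] is returned only where no preimage exists, hence never on the ball of radius
   [r / 2] around [f x0]. *)
pose H y := xget x0 [set x | `|x - x0| <= r /\ f x = y].
have HP y : `|y - f x0| <= r / 2 -> `|H y - x0| <= r /\ f (H y) = y.
  by move=> /ex[x hx fx]; rewrite /H; case: xgetP => [z -> []//|/(_ x)]; case.
exists H; split=> // [y hy|x hx hfx].
  apply/cvgrPdist_lt => e e0.
  have e2 : 0 < e / 2 by rewrite divr_gt0.
  near=> z.
  have hz : `|z - f x0| <= r / 2.
    have : `|z - y| < r / 2 - `|y - f x0|.
      rewrite distrC; near: z; apply/nbhs_ballP; exists (r / 2 - `|y - f x0|).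
        by rewrite /= subr_gt0.
      by move=> z; rewrite -ball_normE.
    have : `|z - f x0| <= `|z - y| + `|y - f x0| by rewrite -(subrKA y z) ler_normD.
    lra.
  have [h1 h2] := HP _ hz; have [h3 h4] := HP _ (ltW hy).
  have := lip _ _ h3 h1; rewrite h2 h4.
  have : `|y - z| < e / 2.
    by near: z; apply/nbhs_ballP; exists (e / 2) => // z; rewrite -ball_normE.
  lra.
have [h1 h2] := HP _ hfx; have := lip _ _ h1 hx.
by rewrite h2 subrr normr0 mulr0 normr_le0 subr_eq0 => /eqP.
Unshelve. all: by end_near. Qed.

Lemma row_norm_le (v : 'rV[R]_2) (M : R) : (forall i, `|v 0 i| <= M) -> `|v| <= M.
Proof.
move=> h; have M0 : 0 <= M := le_trans (normr_ge0 _) (h 0).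
rewrite /Num.Def.normr/= mx_normrE (bigmax_le _ M0)//= => -[i j] _ /=.
by rewrite (ord1 i).
Qed.

Lemma row_norm_ge (v : 'rV[R]_2) i : `|v 0 i| <= `|v|.
Proof.
rewrite [leRHS]/Num.Def.normr/= mx_normrE.
by apply: (le_bigmax _ (fun ij : 'I_1 * 'I_2 => `|v ij.1 ij.2|) (0, i)).
Qed.

Lemma C1_near_identity A (f : 'I_2 -> 'rV[R]_2 -> R^o) (x0 : 'rV[R]_2) :
  open A -> A x0 -> (forall i, smooth A (f i)) ->
  (forall i j, 'D_(delta_mx 0 j) (f i) x0 = (i == j)%:R) ->
  exists2 r : R, 0 < r & forall x y, `|x - x0| <= r -> `|y - x0| <= r ->
    A x /\
    `|(x - \row_i f i x) - (y - \row_i f i y)| <= 2^-1 * `|x - y|.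
Proof.
move=> oA Ax0 sf f1.
(* An entry of the difference is a sum over two partial derivatives; an error of 1/4 in each gives
   the Lipschitz constant 1/2 for the sup norm. *)
have e0 : 0 < 4^-1 :> R by rewrite invr_gt0.
have near1 (i j : 'I_2) : \forall x \near x0, `|(i == j)%:R - 'D_(delta_mx 0 j) (f i) x| < 4^-1.
  have cf := smooth_continuous (smooth_derive j (sf i)) Ax0.
  by move/cvgrPdist_lt : cf => /(_ _ e0); rewrite f1.
have : \forall x \near x0, A x /\
    forall i j : 'I_2, `|(i == j)%:R - 'D_(delta_mx 0 j) (f i) x| < 4^-1.
  apply: filterI; first exact: open_nbhs_nbhs.
  apply: (@filter_forall 'rV[R]_2 'I_2 (fun i x => forall j : 'I_2,
    `|(i == j)%:R - 'D_(delta_mx 0 j) (f i) x| < 4^-1) (nbhs x0) _) => i.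
  apply: (@filter_forall 'rV[R]_2 'I_2 (fun j x =>
    `|(i == j)%:R - 'D_(delta_mx 0 j) (f i) x| < 4^-1) (nbhs x0) _) => j.
  exact: near1.
move=> /nbhs_ballP[r /= r0 Hr]; exists (r / 2); first by rewrite divr_gt0.
have rr : r / 2 < r by rewrite ltr_pdivrMr// ltr_pMr// ltr1n.
have inB x : `|x - x0| <= r / 2 -> ball x0 r x.
  by move=> h; rewrite -ball_normE /= distrC (le_lt_trans h).
move=> x y hx hy; split; first by have [] := Hr _ (inB x hx).
have seg t : 0 <= t <= 1 -> ball x0 r (y + t *: (x - y)).
  move=> /andP[t0 t1]; apply: inB.
  (* Convexity of the ball: the segment from [y] to [x] does not leave it, so the derivative bounds
     hold at the mean value point. *)
  rewrite (_ : _ - x0 = (1 - t) *: (y - x0) + t *: (x - x0)); last first.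
    by apply/rowP => k; rewrite !mxE; ring.
  rewrite (le_trans (ler_normD _ _))// !normrZ (ger0_norm t0) ger0_norm ?subr_ge0//.
  rewrite (le_trans (y := (1 - t) * (r / 2) + t * (r / 2)))//; last first.
    by rewrite -mulrDl subrK mul1r.
  by rewrite lerD// ler_wpM2l// subr_ge0.
apply: row_norm_le => i.
have [t t01|t t01] := @mean_value_rV (f i) y (x - y).
  by have [At _] := Hr _ (seg t t01); exact: smooth_differentiable (sf i) At.
rewrite [y + (x - y)]addrC subrK => E.
have [_ /(_ i) H] := Hr _ (seg t t01); have H0 := H 0; have H1 := H 1.
move: (row_norm_ge (x - y) 0) (row_norm_ge (x - y) 1) E H0 H1.
set w := x - y; set z := y + _.
move: ('D_(delta_mx 0 0) (f i) z) ('D_(delta_mx 0 1) (f i) z) => a b w0 w1 E H0 H1.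
have -> : (x - \row_i f i x - (y - \row_i f i y)) 0 i =
    w 0 0 * ((i == 0)%:R - a) + w 0 1 * ((i == 1)%:R - b).
  have -> : (x - \row_i f i x - (y - \row_i f i y)) 0 i = w 0 i - (f i x - f i y).
    by rewrite !mxE; ring.
  by rewrite E; move: E => _; elim/ord2P: i {H H0 H1} => /=; ring.
rewrite (le_trans (ler_normD _ _))// !normrM.
have := ler_pM (normr_ge0 _) (normr_ge0 _) w0 (ltW H0).
have := ler_pM (normr_ge0 _) (normr_ge0 _) w1 (ltW H1).
lra.
Qed.

Lemma is_derive_diff (f : 'rV[R]_2 -> R^o) x w :
  differentiable f x -> is_derive x w f ('D_w f x).
Proof. by move=> df; exact/derivableP/diff_derivable. Qed.

(** The differential of [F] also gives the first-order expansion of [G] at [x], because the germs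
    agree; uniqueness of the differential then identifies it with that of [G]. *)
Lemma near_eq_differentiable (V W : normedModType R) (F G : V -> W) (x : V) :
  (\forall y \near x, F y = G y) -> differentiable F x -> differentiable G x.
Proof.
move=> FG dF; have Fx : F x = G x := nbhs_singleton FG.
have H : G \o shift x = cst (G x) + 'd F x +o_ 0 id.
  apply/eqaddoP => e e0; have /eqaddoP/(_ e e0) := diff_locally dF.
  have : \forall y \near (0 : V), (F \o shift x) y = (G \o shift x) y.
    move: FG => /nbhs_ballP[r /= r0 H]; apply/nbhs_ballP; exists r => //= y.
    rewrite -ball_normE /= sub0r normrN => yr; apply: H.
    by rewrite -ball_normE /= opprD addrC subrK normrN.
  move=> h1 h2; near=> y.
  have E : (G \o shift x - (cst (G x) + 'd F x)) y = (F \o shift x - (cst (F x) + 'd F x)) y.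
    transitivity ((G \o shift x) y - (G x + 'd F x y)) => //.
    by rewrite -(near h1 y)// -Fx.
  by rewrite E; near: y.
have cF : continuous ('d F x) by exact: diff_continuous.
apply/diff_locallyP; have E := diff_unique cF H.
by rewrite E.
Unshelve. all: by end_near. Qed.

Lemma Ck_eq_on (V : normedModType R) k A (F G : 'rV[R]_2 -> V) : open A ->
  (forall x, A x -> F x = G x) -> Ck k A F -> Ck k A G.
Proof.
move=> oA; elim: k F G => [|k IH] F G FG /=;
  have nFG x : A x -> \forall y \near x, F y = G y.
- by move=> Ax; have := open_nbhs_nbhs (conj oA Ax); apply: filterS => y /FG.
- move=> cF x Ax; rewrite /prop_for /continuous_at -FG//.
  exact: cvg_trans (near_eq_cvg (nFG x Ax)) (cF x Ax).
- by move=> Ax; have := open_nbhs_nbhs (conj oA Ax); apply: filterS => y /FG.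
case=> dF cF; split=> [x Ax|j].
  exact: near_eq_differentiable (nFG x Ax) (dF x Ax).
by apply: IH (cF j) => x Ax; apply: near_eq_derive; exact: nFG.
Qed.

Lemma differentiable_comb (f g : 'rV[R]_2 -> R^o) (a b : R) x :
  differentiable f x -> differentiable g x ->
  differentiable (fun y => a * f y + b * g y : R^o) x.
Proof.
move=> df dg; rewrite (_ : (fun y => _) = (a \*: f + b \*: g)); last by apply/funext.
by apply: differentiableD; exact: differentiableZ.
Qed.

Lemma is_derive_comb (f g : 'rV[R]_2 -> R^o) (a b f' g' : R) x w :
  is_derive x w f f' -> is_derive x w g g' ->
  is_derive x w (fun y => a * f y + b * g y : R^o) (a * f' + b * g').
Proof.
move=> df dg; rewrite (_ : (fun y => _) = (a \*: f + b \*: g)); last by apply/funext.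
by apply: is_deriveD; exact: is_deriveZ.
Qed.

Lemma Ck_comb k A (f g : 'rV[R]_2 -> R^o) (a b : R) : open A ->
  Ck k A f -> Ck k A g -> Ck k A (fun y => a * f y + b * g y : R^o).
Proof.
move=> oA; elim: k f g => [|k IH] f g.
  move=> cf cg x Ax; apply: continuousD.
    exact: continuousZl_tmp (cf x Ax).
  exact: continuousZl_tmp (cg x Ax).
move=> [df cf] [dg cg]; split=> [x Ax|j].
  by apply: differentiable_comb; [exact: df|exact: dg].
apply: Ck_eq_on (IH _ _ (cf j) (cg j)) => // x Ax.
have Df := is_derive_diff (delta_mx 0 j) (df x Ax).
have Dg := is_derive_diff (delta_mx 0 j) (dg x Ax).
by have [_ ->] := is_derive_comb a b Df Dg.
Qed.

Lemma smooth_comb A (f g : 'rV[R]_2 -> R^o) (a b : R) : open A ->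
  smooth A f -> smooth A g -> smooth A (fun y => a * f y + b * g y : R^o).
Proof. by move=> oA sf sg k; apply: Ck_comb. Qed.

Lemma continuous_row (T : topologicalType) (u : 'I_2 -> T -> R) (x : T) :
  (forall i, {for x, continuous (u i)}) ->
  {for x, continuous (fun y => \row_i u i y : 'rV[R]_2)}.
Proof.
move=> cu; apply/cvgrPdist_le => e e0.
have : \forall y \near x, forall i : 'I_2, `|u i x - u i y| <= e.
  apply: (@filter_forall T 'I_2 (fun i y => `|u i x - u i y| <= e) (nbhs x) _) => i.
  by have /cvgrPdist_le/(_ _ e0) := cu i.
by apply: filterS => y Hy; apply: row_norm_le => i; rewrite !mxE.
Qed.

(** Composing with the inverse of the Jacobian matrix at [x0] reduces to a map whose derivative
    there is the identity, to which the contraction argument applies. *)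
Lemma inverse_function A (g0 g1 : 'rV[R]_2 -> R^o) (x0 : 'rV[R]_2)
    (G := fun x => \row_(i < 2) (if i == 0 then g0 x else g1 x)) :
  open A -> A x0 -> smooth A g0 -> smooth A g1 ->
  'D_(delta_mx 0 0) g0 x0 * 'D_(delta_mx 0 1) g1 x0 -
  'D_(delta_mx 0 1) g0 x0 * 'D_(delta_mx 0 0) g1 x0 != 0 ->
  exists H : 'rV[R]_2 -> 'rV[R]_2,
    (\forall y \near G x0, [/\ A (H y), G (H y) = y & {for y, continuous H}]) /\
    (\forall x \near x0, H (G x) = x).
Proof.
move=> oA Ax0 s0 s1.
have D0 j := is_derive_diff (delta_mx 0 j) (smooth_differentiable s0 Ax0).
have D1 j := is_derive_diff (delta_mx 0 j) (smooth_differentiable s1 Ax0).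
move: (D0 0) (D0 1) (D1 0) (D1 1).
set a := 'D_(delta_mx 0 0) g0 x0; set b := 'D_(delta_mx 0 1) g0 x0.
set c := 'D_(delta_mx 0 0) g1 x0; set e := 'D_(delta_mx 0 1) g1 x0.
move=> Da Db Dc De d0; set d := a * e - b * c in d0.
(* The coefficients are the rows of the inverse Jacobian matrix: its adjugate divided by [d]. *)
pose f (i : 'I_2) : 'rV[R]_2 -> R^o := if i == 0 then (fun x => (e / d) * g0 x + (- b / d) * g1 x)
  else (fun x => (- c / d) * g0 x + (a / d) * g1 x).
have sf i : smooth A (f i) by rewrite /f; case: ifP => _; exact: smooth_comb.
have f1 i j : 'D_(delta_mx 0 j) (f i) x0 = (i == j)%:R.
  elim/ord2P: i; elim/ord2P: j; rewrite /f /=.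
  - have [_ ->] := is_derive_comb (e / d) (- b / d) Da Dc.
    by rewrite -(mulfV d0) /d; ring.
  - by have [_ ->] := is_derive_comb (e / d) (- b / d) Db De; ring.
  - by have [_ ->] := is_derive_comb (- c / d) (a / d) Da Dc; ring.
  - have [_ ->] := is_derive_comb (- c / d) (a / d) Db De.
    by rewrite -(mulfV d0) /d; ring.
have [r r0 Hr] := C1_near_identity oA Ax0 sf f1.
pose F x := \row_(i < 2) f i x : 'rV[R]_2.
have [H [H1 H2 H3]] := near_identity_inverse (f := F) r0 (fun x y hx hy => proj2 (Hr x y hx hy)).
(* The same normalisation as a map of the values, so that an inverse of [F = L \o G] yields the
   inverse [H \o L] of [G]. *)
pose L (y : 'rV[R]_2) : 'rV[R]_2 := \row_(i < 2) (if i == 0 then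
  (e / d) * y 0 0 + (- b / d) * y 0 1 else (- c / d) * y 0 0 + (a / d) * y 0 1).
have FL x : F x = L (G x).
  by apply/rowP => i; rewrite !mxE /f /=; case: ifP.
have Linj : injective L.
  move=> y z /rowP Lyz; have := Lyz 0; have := Lyz 1; rewrite !mxE /= => E1 E0.
  have y0 (w : 'rV[R]_2) : w 0 0 = a * ((e / d) * w 0 0 + (- b / d) * w 0 1) +
      b * ((- c / d) * w 0 0 + (a / d) * w 0 1).
    by rewrite -[LHS]mul1r -(mulfV d0) {1}/d; ring.
  have y1 (w : 'rV[R]_2) : w 0 1 = c * ((e / d) * w 0 0 + (- b / d) * w 0 1) +
      e * ((- c / d) * w 0 0 + (a / d) * w 0 1).
    by rewrite -[LHS]mul1r -(mulfV d0) {1}/d; ring.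
  by apply/rowP; elim/ord2P; [rewrite (y0 y) (y0 z)|rewrite (y1 y) (y1 z)]; rewrite E0 E1.
have cL y : {for y, continuous L}.
  have cl (p q : R) : {for y, continuous (fun w : 'rV[R]_2 => p * w 0 0 + q * w 0 1 : R^o)}.
    by apply: differentiable_continuous; apply: differentiable_comb; exact: differentiable_coord.
  by apply: continuous_row => i; case: (i == 0); exact: cl.
have r2 : 0 < r / 2 by rewrite divr_gt0.
have nG : \forall y \near G x0, `|L y - F x0| < r / 2.
  have /cvgrPdist_lt/(_ _ r2) := cL (G x0).
  by apply: filterS => y; rewrite FL distrC.
exists (H \o L); split.
  apply: filterS nG => y hy; have [h1 h2] := H1 _ (ltW hy); split.
  - exact: proj1 (Hr _ _ h1 h1).
  - by apply: Linj; rewrite -FL.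
  - by apply: continuous_comp; [exact: cL|exact: H2].
have cG : {for x0, continuous G}.
  by apply: continuous_row => i; case: (i == 0); exact: smooth_continuous Ax0.
have n1 : \forall x \near x0, `|x - x0| < r.
  by apply/nbhs_ballP; exists r => //= x; rewrite -ball_normE /= distrC.
by apply: filterS2 n1 (cG _ nG) => x h1 h2; rewrite /= -FL; apply: H3; rewrite ?ltW// FL.
Qed.

End Calculus.

(** * Maps into the complex plane C^2 *)

Section ComplexPlane.
Variable R : realType.
Implicit Types (z w : C2 R) (u v : R[i]).

Lemma ReD u v : Re (u + v) = Re u + Re v. Proof. by case: u; case: v. Qed.
Lemma ImD u v : Im (u + v) = Im u + Im v. Proof. by case: u; case: v. Qed.
Lemma ReM u v : Re (u * v) = Re u * Re v - Im u * Im v.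
Proof. by case: u; case: v. Qed.
Lemma ImM u v : Im (u * v) = Re u * Im v + Im u * Re v.
Proof. by case: u; case: v. Qed.
Lemma ReJ u : Re (u^*%C) = Re u. Proof. by case: u. Qed.
Lemma ImJ u : Im (u^*%C) = - Im u. Proof. by case: u. Qed.
Lemma ReN u : Re (- u) = - Re u. Proof. by case: u. Qed.
Lemma ImN u : Im (- u) = - Im u. Proof. by case: u. Qed.
Definition ReImE := (ReD, ImD, ReM, ImM, ReJ, ImJ, ReN, ImN).

Lemma complex_eq u v : Re u = Re v -> Im u = Im v -> u = v.
Proof. by case: u; case: v => a b c d /= -> ->. Qed.

Lemma hprodE z w : hprod z w = z 0 0 * (w 0 0)^*%C + z 0 1 * (w 0 1)^*%C.
Proof. by rewrite /hprod big_ord_recl big_ord1; congr (_ + z 0 _ * (w 0 _)^*%C); exact/val_inj. Qed.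

Lemma innerE z w : inner z w = Re (z 0 0) * Re (w 0 0) + Im (z 0 0) * Im (w 0 0) +
   (Re (z 0 1) * Re (w 0 1) + Im (z 0 1) * Im (w 0 1)).
Proof. by rewrite /inner hprodE !ReImE; ring. Qed.

Lemma C2_eq z w : z 0 0 = w 0 0 -> z 0 1 = w 0 1 -> z = w.
Proof.
move=> h0 h1; apply/rowP => k; case: k => -[|[|//]] i.
  by rewrite (_ : Ordinal i = 0) //; exact/val_inj.
by rewrite (_ : Ordinal i = 1) //; exact/val_inj.
Qed.

Lemma sum_ord2 (V : nmodType) (f : 'I_2 -> V) : \sum_(i < 2) f i = f 0 + f 1.
Proof. by rewrite big_ord_recl big_ord1; congr (_ + f _); exact/val_inj. Qed.

Lemma innerC z w : inner z w = inner w z.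
Proof. by rewrite !innerE; ring. Qed.

Lemma hprodDl z w x u v : hprod (u *: z + v *: w) x = u * hprod z x + v * hprod w x.
Proof. by rewrite !hprodE !mxE; ring. Qed.

Lemma hprodJ z w : (hprod z w)^*%C = hprod w z.
Proof. by rewrite !hprodE; apply: complex_eq; rewrite !ReImE; ring. Qed.

Lemma hprodDr z w x u v :
  hprod x (u *: z + v *: w) = u^*%C * hprod x z + v^*%C * hprod x w.
Proof. by rewrite -hprodJ hprodDl rmorphD !rmorphM /= !hprodJ. Qed.

End ComplexPlane.

(* A sealed copy of [partial]: unification would otherwise unfold it down to
   limits of filters when comparing partial derivatives of different maps. *)
HB.lock Definition pdiff (R : realType) (j : 'I_2) (F : 'rV[R]_2 -> C2 R)
  (x : 'rV[R]_2) : C2 R := partial j F x.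

Section Derivatives.
Variable R : realType.
Implicit Types (A B : set 'rV[R]_2) (F X Y : 'rV[R]_2 -> C2 R) (x : 'rV[R]_2).

Definition diffC2 F x := forall k : 'I_2,
  differentiable (fun y => Re (F y 0 k) : R^o) x /\
  differentiable (fun y => Im (F y 0 k) : R^o) x.

Lemma smoothC2_sub A B F : A `<=` B -> smoothC2 B F -> smoothC2 A F.
Proof. by move=> AB h k; have [h1 h2] := h k; split; apply: smooth_sub; eauto. Qed.

Lemma smoothC2_diff A F x : smoothC2 A F -> A x -> diffC2 F x.
Proof. by move=> h Ax k; have [h1 h2] := h k; split; apply: smooth_differentiable; eauto. Qed.

Lemma partial_pdiff j F : partial j F = pdiff j F.
Proof. by apply/funext => x; rewrite pdiff.unlock. Qed.

Lemma pdiffE j F x k : pdiff j F x 0 k =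
  Complex ('D_(delta_mx 0 j) (fun y => Re (F y 0 k) : R^o) x)
          ('D_(delta_mx 0 j) (fun y => Im (F y 0 k) : R^o) x).
Proof. by rewrite pdiff.unlock mxE. Qed.

#[local] Opaque derive.

Lemma smoothC2_pdiff A F j : smoothC2 A F -> smoothC2 A (pdiff j F).
Proof.
move=> h k; have [h1 h2] := h k.
under [X in smooth A X /\ _]funext do rewrite pdiffE.
under [X in _ /\ smooth A X]funext do rewrite pdiffE.
by split; apply: smooth_derive.
Qed.

Lemma pdiff_comm A F x i j : open A -> A x -> smoothC2 A F ->
  pdiff i (pdiff j F) x = pdiff j (pdiff i F) x.
Proof.
move=> oA Ax h; apply/rowP => k; have [h1 h2] := h k.
have E1 := pdiffE i (pdiff j F) x k.
have E2 := pdiffE j (pdiff i F) x k.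
apply: etrans E1 _; apply: etrans (esym E2).
apply: complex_eq; rewrite [LHS]/= [RHS]/=.
  have E m : (fun y => Re (pdiff m F y 0 k) : R^o) =
      'D_(delta_mx 0 m) (fun y => Re (F y 0 k) : R^o).
    by apply/funext => y; rewrite pdiffE.
  by move: (schwarz j i oA Ax h1); rewrite -!E.
have E m : (fun y => Im (pdiff m F y 0 k) : R^o) =
    'D_(delta_mx 0 m) (fun y => Im (F y 0 k) : R^o).
  by apply/funext => y; rewrite pdiffE.
by move: (schwarz j i oA Ax h2); rewrite -!E.
Qed.

Lemma is_derive_Re F x k j : diffC2 F x ->
  is_derive x (delta_mx 0 j) (fun y => Re (F y 0 k) : R^o) (Re (pdiff j F x 0 k)).
Proof. by move=> h; rewrite pdiffE; apply/derivableP/diff_derivable; case: (h k). Qed.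

Lemma is_derive_Im F x k j : diffC2 F x ->
  is_derive x (delta_mx 0 j) (fun y => Im (F y 0 k) : R^o) (Im (pdiff j F x 0 k)).
Proof. by move=> h; rewrite pdiffE; apply/derivableP/diff_derivable; case: (h k). Qed.

Lemma is_derive_prod (f g : 'rV[R]_2 -> R^o) (f' g' : R) x w :
  is_derive x w f f' -> is_derive x w g g' ->
  is_derive x w (fun y => f y * g y : R^o) (f' * g x + f x * g').
Proof.
move=> df dg; rewrite (_ : (fun y => _) = (f * g : _ -> R)); last by apply/funext.
by apply: (is_derive_eq (is_deriveM df dg)); rewrite /GRing.scale /= addrC mulrC.
Qed.

Lemma is_derive_add (f g : 'rV[R]_2 -> R^o) (f' g' : R) x w :
  is_derive x w f f' -> is_derive x w g g' ->
  is_derive x w (fun y => f y + g y : R^o) (f' + g').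
Proof. exact: is_deriveD. Qed.

(** The factors 1 give the expression the nested shape a * f + b * g that [differentiable_comb] and
    [is_derive_comb] expect. *)
Lemma comb_Re X Y (u v : R[i]) k : (fun y => Re ((u *: X y + v *: Y y) 0 k) : R^o) =
  (fun y => 1 * (Re u * Re (X y 0 k) + - Im u * Im (X y 0 k)) +
            1 * (Re v * Re (Y y 0 k) + - Im v * Im (Y y 0 k))).
Proof. by apply/funext => y; rewrite !mxE !ReImE; ring. Qed.

Lemma comb_Im X Y (u v : R[i]) k : (fun y => Im ((u *: X y + v *: Y y) 0 k) : R^o) =
  (fun y => 1 * (Re u * Im (X y 0 k) + Im u * Re (X y 0 k)) +
            1 * (Re v * Im (Y y 0 k) + Im v * Re (Y y 0 k))).
Proof. by apply/funext => y; rewrite !mxE !ReImE; ring. Qed.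

Lemma diffC2_comb X Y x (u v : R[i]) : diffC2 X x -> diffC2 Y x ->
  diffC2 (fun y => u *: X y + v *: Y y) x.
Proof.
move=> hX hY k; have [X1 X2] := hX k; have [Y1 Y2] := hY k.
rewrite comb_Re comb_Im; split; apply: differentiable_comb;
  exact: differentiable_comb.
Qed.

Lemma pdiff_val F x j k (z : R[i]) :
  is_derive x (delta_mx 0 j) (fun y => Re (F y 0 k) : R^o) (Re z) ->
  is_derive x (delta_mx 0 j) (fun y => Im (F y 0 k) : R^o) (Im z) ->
  pdiff j F x 0 k = z.
Proof. by move=> [_ h1] [_ h2]; rewrite pdiffE h1 h2; apply: complex_eq. Qed.

Lemma pdiff_comb X Y x (u v : R[i]) j : diffC2 X x -> diffC2 Y x ->
  pdiff j (fun y => u *: X y + v *: Y y) x = u *: pdiff j X x + v *: pdiff j Y x.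
Proof.
move=> hX hY; apply/rowP => k.
have X1 := is_derive_Re k j hX; have X2 := is_derive_Im k j hX.
have Y1 := is_derive_Re k j hY; have Y2 := is_derive_Im k j hY.
apply: pdiff_val.
  rewrite comb_Re; apply: (is_derive_eq (is_derive_comb _ _
    (is_derive_comb _ _ X1 X2) (is_derive_comb _ _ Y1 Y2))).
  by rewrite !mxE !ReImE; ring.
rewrite comb_Im; apply: (is_derive_eq (is_derive_comb _ _
  (is_derive_comb _ _ X2 X1) (is_derive_comb _ _ Y2 Y1))).
by rewrite !mxE !ReImE; ring.
Qed.

Lemma is_derive_inner X Y x j : diffC2 X x -> diffC2 Y x ->
  is_derive x (delta_mx 0 j) (fun y => inner (X y) (Y y) : R^o)
    (inner (pdiff j X x) (Y x) + inner (X x) (pdiff j Y x)).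
Proof.
move=> hX hY; under eq_fun do rewrite innerE.
have DR Z k := is_derive_Re (F := Z) (x := x) k j.
have DI Z k := is_derive_Im (F := Z) (x := x) k j.
have DP k := is_derive_add (is_derive_prod (DR _ k hX) (DR _ k hY))
  (is_derive_prod (DI _ k hX) (DI _ k hY)).
apply: (is_derive_eq (is_derive_add (DP 0) (DP 1))).
by rewrite !innerE; ring.
Qed.

Lemma scale_comb X (u : R[i]) : (fun y => u *: X y) = (fun y => u *: X y + 0 *: X y).
Proof. by apply/funext => y; rewrite scale0r addr0. Qed.

Lemma diffC2_scale X x (u : R[i]) : diffC2 X x -> diffC2 (fun y => u *: X y) x.
Proof. by move=> h; rewrite scale_comb; exact: diffC2_comb. Qed.

Lemma pdiff_scale X x (u : R[i]) j : diffC2 X x ->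
  pdiff j (fun y => u *: X y) x = u *: pdiff j X x.
Proof. by move=> h; rewrite scale_comb pdiff_comb// scale0r addr0. Qed.

End Derivatives.

(** * Unitary frames and local rigidity *)

Section Frames.
Variable R : realType.
Implicit Types (F E X : C2 R).
Local Open Scope complex_scope.

Definition unitary_frame F E := [/\ hprod F F = 1, hprod E E = 1 & hprod F E = 0].

(* The entries of [E^* F - F^* E]; for a frame of a rigid surface this matrix is
   [- i (2 f^* f - 1)], where the complex line of [f = (F - i E) / sqrt 2] is fixed. *)
Definition twist F E (k l : 'I_2) : R[i] := (E 0 k)^* * F 0 l - (F 0 k)^* * E 0 l.

Lemma inner_frame F E (a b c d a' b' c' d' : R) : unitary_frame F E ->
  inner ((a +i* b) *: F + (c +i* d) *: E) ((a' +i* b') *: F + (c' +i* d') *: E) =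
  a * a' + b * b' + (c * c' + d * d').
Proof.
case=> FF EE FE; have EF : hprod E F = 0 by rewrite -hprodJ FE conjc0.
by rewrite /inner hprodDl !hprodDr FF EE FE EF !mulr0 addr0 add0r !mulr1 /=; ring.
Qed.

Lemma hprod_inner F E : hprod F E = inner F E +i* inner F ('i *: E).
Proof.
by apply: complex_eq; rewrite /= ?innerE ?hprodE ?mxE !ReImE /=; ring.
Qed.

(** A square matrix with orthonormal rows has orthonormal columns, a right inverse being also a left
    inverse. *)
Lemma frame_columns F E k l : unitary_frame F E ->
  F 0 k * (F 0 l)^* + E 0 k * (E 0 l)^* = (k == l)%:R.
Proof.
case=> FF EE FE; have EF : hprod E F = 0 by rewrite -hprodJ FE conjc0.
pose M : 'M[R[i]]_2 := \matrix_(i, j) if i == 0 then F 0 j else E 0 j.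
pose N : 'M[R[i]]_2 := \matrix_(i, j) if j == 0 then (F 0 i)^* else (E 0 i)^*.
have MN : M *m N = 1%:M.
  apply/matrixP => i j; rewrite !mxE sum_ord2 !mxE.
  by elim/ord2P: i; elim/ord2P: j => /=; rewrite -hprodE.
have /matrixP/(_ l k) := mulmx1C MN.
by rewrite !mxE sum_ord2 !mxE /= eq_sym => <-; ring.
Qed.

Lemma frame_expand F E X : unitary_frame F E -> X = hprod X F *: F + hprod X E *: E.
Proof.
move=> fr; have H k l := frame_columns k l fr.
apply/rowP => l; rewrite !mxE !hprodE.
transitivity (X 0 0 * (l == 0)%:R + X 0 1 * (l == 1)%:R).
  by elim/ord2P: l; rewrite /= ?mulr1 ?mulr0 ?addr0 ?add0r.
by rewrite -!H; ring.
Qed.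

Lemma inner_scalel (u : R[i]) F E :
  inner (u *: F) E = Re u * inner F E + Im u * inner ('i *: F) E.
Proof. by rewrite !innerE !mxE !ReImE /=; ring. Qed.

Lemma inner_scaler (u : R[i]) F E :
  inner F (u *: E) = Re u * inner F E + Im u * inner F ('i *: E).
Proof. by rewrite !innerE !mxE !ReImE /=; ring. Qed.

Lemma innerDl F E X : inner (F + E) X = inner F X + inner E X.
Proof. by rewrite !innerE !mxE !ReImE /=; ring. Qed.

Lemma inner_iC F E : inner ('i *: F) E = - inner F ('i *: E).
Proof. by rewrite !innerE !mxE !ReImE /=; ring. Qed.

Lemma inner_i_self F : inner ('i *: F) F = 0.
Proof. by rewrite !innerE !mxE !ReImE /=; ring. Qed.

Lemma scalei_comb F E (a b c d : R) : 'i *: ((a +i* b) *: F + (c +i* d) *: E) =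
  (- b +i* a) *: F + (- d +i* c) *: E.
Proof.
by rewrite scalerDr !scalerA; congr (_ *: _ + _ *: _);
  apply: complex_eq; rewrite !ReImE /=; ring.
Qed.

Lemma inner_frame_basis F E (a b c d : R) : unitary_frame F E ->
  [/\ inner ((a +i* b) *: F + (c +i* d) *: E) ('i *: F) = b,
      inner ((a +i* b) *: F + (c +i* d) *: E) E = c &
      inner ((a +i* b) *: F + (c +i* d) *: E) ('i *: E) = d].
Proof.
move=> fr; have H a' b' c' d' := inner_frame a b c d a' b' c' d' fr.
split; [have := H 0 1 0 0|have := H 0 0 1 0|have := H 0 0 0 1];
  by rewrite ?scale0r ?scale1r ?addr0 ?add0r !mulr0 ?mulr1 ?addr0 ?add0r.
Qed.

End Frames.

Section FrameAlgebra.
Variable R : realType.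

(* In a coframe (a, b) with connection form m, [h] is the second fundamental form;
   the two hypotheses are its symmetry and the vanishing of its trace. *)
Lemma connection_algebra (a0 a1 b0 b1 m0 m1 s c : R) :
  s ^+ 2 + c ^+ 2 = 1 -> a0 * b1 - a1 * b0 != 0 ->
  let h (ai bi mi aj bj : R) := ai * bj - aj * (s ^+ 2 * bi - c * mi) in
  h a1 b1 m1 a0 b0 = h a0 b0 m0 a1 b1 ->
  (a1 * a1 + b1 * b1) * h a0 b0 m0 a0 b0 - (a0 * a1 + b0 * b1) * h a1 b1 m1 a0 b0
  - (a1 * a0 + b1 * b0) * h a0 b0 m0 a1 b1 + (a0 * a0 + b0 * b0) * h a1 b1 m1 a1 b1 = 0 ->
  c * m0 = (1 + s ^+ 2) * b0 /\ c * m1 = (1 + s ^+ 2) * b1.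
Proof.
move=> sc1 W0 h Hsym Hmean; set W := a0 * b1 - a1 * b0 in W0.
have Hs : (1 + s ^+ 2) * W = c * (a0 * m1 - a1 * m0).
  move/eqP: Hsym; rewrite -subr_eq0 /h => /eqP Hsym.
  by apply/eqP; rewrite -subr_eq0 -oppr_eq0; apply/eqP; rewrite -[RHS]Hsym /W; ring.
(* Modulo [sc1] the trace expression is [W] times this quantity, which is [W] times the component of
   c m along (a0, a1). *)
have Hm : c * (m0 * b1 - m1 * b0) = 0.
  by apply: (mulIf W0); rewrite mul0r -[RHS]Hmean /W /h; ring: sc1.
split; apply: (mulfI W0).
  (* Cramer's rule expands c m in the coframe: minimality removes the first component and symmetry
     fixes the second. *)
  transitivity (a0 * (c * (m0 * b1 - m1 * b0)) + b0 * (c * (a0 * m1 - a1 * m0))).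
    by rewrite /W; ring.
  by rewrite Hm -Hs; ring.
transitivity (a1 * (c * (m0 * b1 - m1 * b0)) + b1 * (c * (a0 * m1 - a1 * m0))).
  by rewrite /W; ring.
by rewrite Hm -Hs; ring.
Qed.

End FrameAlgebra.

(** * Structure equations of a minimal surface with constant contact angle *)

Section LocalRigidity.
Variable R : realType.
Local Open Scope complex_scope.
Variables (V : set 'rV[R]_2) (F E : 'rV[R]_2 -> C2 R) (s c : R).
Hypotheses (oV : open V) (sF : smoothC2 V F) (sE : smoothC2 V E).
Hypothesis sc1 : s ^+ 2 + c ^+ 2 = 1.
Hypothesis fr : forall x, V x -> unitary_frame (F x) (E x).

(* [al] and [be] are the components of the coframe dual to (e1, e2). *)
Definition coframe (x : 'rV[R]_2) (al be : 'I_2 -> R) : Prop :=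
  (forall j, pdiff j F x = (0 +i* (c * be j)) *: F x + (al j +i* (s * be j)) *: E x) /\
  al 0 * be 1 - al 1 * be 0 != 0.

Hypothesis cofr : forall x, V x -> exists al be, coframe x al be.

(** The unit normal of the surface inside the sphere: it is real-orthogonal to F, to e1 = E and to
    e2 = i (s E + c F). *)
Definition adapted_normal x := (0 +i* - s) *: F x + (0 +i* c) *: E x.
Local Notation n := adapted_normal.

Let dF x : V x -> diffC2 F x. Proof. exact: smoothC2_diff. Qed.
Let dE x : V x -> diffC2 E x. Proof. exact: smoothC2_diff. Qed.
Let ddF j x : V x -> diffC2 (pdiff j F) x.
Proof. by apply: smoothC2_diff; exact: smoothC2_pdiff. Qed.
Let ddE j x : V x -> diffC2 (pdiff j E) x.
Proof. by apply: smoothC2_diff; exact: smoothC2_pdiff. Qed.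

Lemma is_derive_eq_on (f g : 'rV[R]_2 -> R^o) x w f' g' :
  V x -> (forall y, V y -> f y = g y) ->
  is_derive x w f f' -> is_derive x w g g' -> f' = g'.
Proof.
move=> Vx fg [_ <-] [_ <-]; apply: near_eq_derive.
have : \forall y \near x, V y by exact: open_nbhs_nbhs.
by apply: filterS => y /fg.
Qed.

Lemma is_derive_cst_on (f : 'rV[R]_2 -> R^o) a x w f' :
  V x -> (forall y, V y -> f y = a) -> is_derive x w f f' -> f' = 0.
Proof.
by move=> Vx fa df; apply: (is_derive_eq_on Vx fa df); exact: is_derive_cst.
Qed.

(** Differentiating (E, E) = 1 and both parts of the Hermitian equation (F, E) = 0 determines three
    of the four real components of the derivative of E. The fourth is the connection form. *)
Lemma pdiff_frame x al be : V x -> coframe x al be -> forall j,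
  pdiff j E x = (- al j +i* (s * be j)) *: F x +
                  (0 +i* inner (pdiff j E x) ('i *: E x)) *: E x.
Proof.
move=> Vx [HF _] j; have frx := fr Vx.
have [_ HFE HFiE] := inner_frame_basis 0 (c * be j) (al j) (s * be j) frx.
have H1 : inner (pdiff j E x) (E x) + inner (E x) (pdiff j E x) = 0.
  apply: (is_derive_cst_on (a := 1) Vx _ (is_derive_inner j (dE Vx) (dE Vx))) => y Vy.
  by have [_ h _] := fr Vy; rewrite /inner h.
have H2 : inner (pdiff j F x) (E x) + inner (F x) (pdiff j E x) = 0.
  apply: (is_derive_cst_on (a := 0) Vx _ (is_derive_inner j (dF Vx) (dE Vx))) => y Vy.
  by have [_ _ h] := fr Vy; rewrite /inner h.
have H3 : inner (pdiff j F x) ('i *: E x) + inner (F x) ('i *: pdiff j E x) = 0.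
  rewrite -(pdiff_scale _ _ (dE Vx)).
  apply: (is_derive_cst_on (a := 0) Vx _
    (is_derive_inner j (dF Vx) (diffC2_scale _ (dE Vx)))) => y Vy.
  by have [_ _ h] := fr Vy; rewrite -[LHS]/(inner _ _); have := hprod_inner (F y) (E y);
    rewrite h => -[].
rewrite {1}(frame_expand (pdiff j E x) frx) !hprod_inner; congr (Complex _ _ *: _ + Complex _ _ *: _).
- by move: H2; rewrite HF HFE innerC; lra.
- move: H3; rewrite HF HFiE -[inner (F x) _]opprK -inner_iC innerC; lra.
- by move: H1; rewrite innerC; lra.
Qed.

(** Weingarten's equation: differentiating the orthogonality of [pdiff j F] and the normal moves the
    second derivative of F onto a first derivative of the normal. *)
Lemma second_form x al be : V x -> coframe x al be -> forall i j,
  inner (pdiff i (pdiff j F) x) (n x) =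
  al i * be j - al j * (s ^+ 2 * be i - c * inner (pdiff i E x) ('i *: E x)).
Proof.
move=> Vx cx i j; have HE := pdiff_frame Vx cx i; have [HF _] := cx.
move: HE; set mu := inner _ ('i *: E x) => HE.
have dn : diffC2 n x by apply: diffC2_comb; [exact: dF|exact: dE].
have H : inner (pdiff i (pdiff j F) x) (n x) + inner (pdiff j F x) (pdiff i n x) = 0.
  apply: (is_derive_cst_on (a := 0) Vx _ (is_derive_inner i (ddF j Vx) dn)) => y Vy.
  by have [aly [bey [HFy _]]] := cofr Vy; rewrite HFy inner_frame; [ring|exact: fr].
move: H; rewrite pdiff_comb; [|exact: dF|exact: dE].
rewrite !HF HE.
rewrite (_ : _ + _ *: (_ + (0 +i* mu) *: E x) = ((s * c * be i - c * s * be i) +i* - (c * al i)) *: F x +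
  ((s ^+ 2 * be i - c * mu) +i* - (s * al i)) *: E x); last first.
  rewrite !scalerDr !scalerA addrACA -!scalerDl; congr (_ *: _ + _ *: _);
  by apply: complex_eq; rewrite !ReImE /=; ring.
rewrite inner_frame; last exact: fr.
move=> H; apply/eqP; rewrite -subr_eq0; apply/eqP.
have -> : al i * be j = (s ^+ 2 + c ^+ 2) * (al i * be j) by rewrite sc1 mul1r.
by rewrite -[RHS]H; ring.
Qed.

Lemma gram x al be : V x -> coframe x al be -> forall i j,
  inner (pdiff i F x) (pdiff j F x) = al i * al j + be i * be j.
Proof.
move=> Vx [HF _] i j; rewrite !HF inner_frame; last exact: fr.
transitivity (al i * al j + (s ^+ 2 + c ^+ 2) * (be i * be j)); first by ring.
by rewrite sc1 mul1r.
Qed.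

(** Vanishing mean curvature after clearing the determinant of the first fundamental form. The
    entries [h] are abstract so that the formula of [second_form] can be put in their place. *)
Hypothesis mean0 : forall x (h : 'I_2 -> 'I_2 -> R), V x ->
  (forall i j, inner (pdiff i (pdiff j F) x) (n x) = h i j) ->
  inner (pdiff 1 F x) (pdiff 1 F x) * h 0 0
  - inner (pdiff 0 F x) (pdiff 1 F x) * h 1 0
  - inner (pdiff 1 F x) (pdiff 0 F x) * h 0 1
  + inner (pdiff 0 F x) (pdiff 0 F x) * h 1 1 = 0.

Lemma connection_form x al be : V x -> coframe x al be -> forall j,
  c * inner (pdiff j E x) ('i *: E x) = (1 + s ^+ 2) * be j.
Proof.
move=> Vx cx; have h2 := second_form Vx cx; have [HF W0] := cx.
have G := gram Vx cx.
have := mean0 Vx h2; have := h2 0 1; rewrite (pdiff_comm 0 1 oV Vx sF) (h2 1 0) !G.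
by move=> Hs Hm; have [] := connection_algebra sc1 W0 Hs Hm => h0 h1; elim/ord2P.
Qed.

(** Differentiating the identity [onV] in both orders and subtracting cancels all second
    derivatives. What remains is the area form times s (c^2 + 1 + s^2), whose last factor is
    positive. *)
Lemma sin_contact_angle_eq0 x : V x -> s = 0.
Proof.
move=> Vx; have [al [be cx]] := cofr Vx; have [HF W0] := cx.
have frx := fr Vx.
(* [al] and [be] are chosen point by point and carry no regularity, so the relation is first
   rewritten between inner products that can be differentiated; this costs one more factor [c]. *)
have onV j y : V y -> c ^+ 2 * inner (pdiff j E y) ('i *: E y) =
    (1 + s ^+ 2) * inner (pdiff j F y) ('i *: F y).
  move=> Vy; have [aly [bey cy]] := cofr Vy; have [HFy _] := cy.
  have [h _ _] := inner_frame_basis 0 (c * bey j) (aly j) (s * bey j) (fr Vy).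
  by rewrite HFy h expr2 -mulrA (connection_form Vy cy) mulrCA.
(* [X] and [Y] name the second derivatives, so that after [pdiff_comm] both orders of
   differentiation show literally the same terms. *)
have der j k X Y : pdiff k (pdiff j E) x = X -> pdiff k (pdiff j F) x = Y ->
    c ^+ 2 * (inner X ('i *: E x) + inner (pdiff j E x) ('i *: pdiff k E x)) =
    (1 + s ^+ 2) * (inner Y ('i *: F x) + inner (pdiff j F x) ('i *: pdiff k F x)).
  move=> <- <-; rewrite -(pdiff_scale _ _ (dE Vx)) -(pdiff_scale _ _ (dF Vx)).
  have DE := is_derive_inner k (ddE j Vx) (diffC2_scale 'i (dE Vx)).
  have DF := is_derive_inner k (ddF j Vx) (diffC2_scale 'i (dF Vx)).
  have := is_derive_eq_on Vx _ (is_derive_comb (c ^+ 2) 0 DE DE)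
    (is_derive_comb (1 + s ^+ 2) 0 DF DF).
  by rewrite !mul0r !addr0; apply => y Vy; rewrite !mul0r !addr0; exact: onV.
have E01 := der 0 1 _ _ erefl erefl.
have E10 := der 1 0 _ _ (pdiff_comm 0 1 oV Vx sE) (pdiff_comm 0 1 oV Vx sF).
have [mu HE] : exists mu : 'I_2 -> R, forall j,
    pdiff j E x = (- al j +i* (s * be j)) *: F x + (0 +i* mu j) *: E x.
  by eexists; exact: pdiff_frame Vx cx.
have IE i j : inner (pdiff i E x) ('i *: pdiff j E x) = s * (al i * be j - be i * al j).
  by rewrite (HE i) (HE j) scalei_comb (inner_frame _ _ _ _ _ _ _ _ frx); ring.
have IF i j : inner (pdiff i F x) ('i *: pdiff j F x) = s * (be i * al j - al i * be j).
  by rewrite (HF i) (HF j) scalei_comb (inner_frame _ _ _ _ _ _ _ _ frx); ring.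
move: E01 E10; rewrite !IE !IF.
move: (inner _ ('i *: E x)) (inner _ ('i *: F x)) => P Q E01 E10.
have : (c ^+ 2 + 1 + s ^+ 2) * (s * (al 0 * be 1 - al 1 * be 0)) = 0 by lra.
move/eqP; rewrite !mulf_eq0 (negbTE W0) orbF => /orP[/eqP|/eqP//]; nra.
Qed.

(** With s = 0 one has c^2 = 1, so the connection form equals c be, which is also the Reeb component
    of dF. The equal imaginary coefficients are what keeps the complex lines of F - iE and F + iE
    fixed. *)
Lemma pdiff_rigid x : V x -> exists al be : 'I_2 -> R, forall j,
  pdiff j F x = (0 +i* be j) *: F x + (al j +i* 0) *: E x /\
  pdiff j E x = (- al j +i* 0) *: F x + (0 +i* be j) *: E x.
Proof.
move=> Vx; have [al [be cx]] := cofr Vx; have [HF W0] := cx.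
have s0 := sin_contact_angle_eq0 Vx; have cc : c * c = 1 by rewrite -sc1 s0; ring.
exists al, (fun j => c * be j) => j.
have HE := pdiff_frame Vx cx j; have := connection_form Vx cx j.
rewrite s0 expr0n addr0 mul1r => /(congr1 ( *%R c)); rewrite mulrA cc mul1r => Hm.
by split; [apply: etrans (HF j) _|apply: etrans HE _]; rewrite ?Hm s0 !mul0r.
Qed.

Lemma differentiable_prod (f g : 'rV[R]_2 -> R^o) x :
  differentiable f x -> differentiable g x ->
  differentiable (fun y => f y * g y : R^o) x.
Proof.
move=> df dg; rewrite (_ : (fun y => _) = (f * g : _ -> R)); last by apply/funext.
exact: differentiableM.
Qed.

(** In the derivative of either product the imaginary coefficients cancel against their conjugates,
    and the [al] terms of the two products are equal. Real and imaginary parts are written as real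
    polynomials so that [locally_constant] applies to each. *)
Lemma twist_locally_constant x k l : V x ->
  \forall y \near x, twist (F y) (E y) k l = twist (F x) (E x) k l.
Proof.
move=> Vx.
pose q (e : R) (a b c d : 'rV[R]_2 -> R^o) : 'rV[R]_2 -> R^o :=
  fun y => 1 * (a y * b y) + e * (c y * d y).
pose ReT : 'rV[R]_2 -> R^o := fun y => 1 * q 1 (fun y => Re (E y 0 k)) (fun y => Re (F y 0 l))
     (fun y => Im (E y 0 k)) (fun y => Im (F y 0 l)) y +
  -1 * q 1 (fun y => Re (F y 0 k)) (fun y => Re (E y 0 l))
     (fun y => Im (F y 0 k)) (fun y => Im (E y 0 l)) y.
pose ImT : 'rV[R]_2 -> R^o := fun y => 1 * q (-1) (fun y => Re (E y 0 k)) (fun y => Im (F y 0 l))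
     (fun y => Im (E y 0 k)) (fun y => Re (F y 0 l)) y +
  -1 * q (-1) (fun y => Re (F y 0 k)) (fun y => Im (E y 0 l))
     (fun y => Im (F y 0 k)) (fun y => Re (E y 0 l)) y.
have dq e a b c0 d y : differentiable a y -> differentiable b y -> differentiable c0 y ->
    differentiable d y -> differentiable (q e a b c0 d) y.
  by move=> *; apply: differentiable_comb; exact: differentiable_prod.
have Dq e a b c0 d a' b' c' d' y w : is_derive y w a a' -> is_derive y w b b' ->
    is_derive y w c0 c' -> is_derive y w d d' -> is_derive y w (q e a b c0 d)
    (1 * (a' * b y + a y * b') + e * (c' * d y + c0 y * d')).
  by move=> *; apply: is_derive_comb; exact: is_derive_prod.
have entries (G X Y : C2 R) (u v : R[i]) : G = u *: X + v *: Y ->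
    forall m, G 0 m = u * X 0 m + v * Y 0 m by move=> -> m; rewrite !mxE.
have cR : \forall y \near x, ReT y = ReT x.
  apply: (locally_constant oV Vx) => [y Vy|y j Vy].
    have hF := dF Vy; have hE := dE Vy.
    by apply: differentiable_comb; apply: dq; first [exact: (proj1 (hF _))|exact: (proj2 (hF _))|exact: (proj1 (hE _))|exact: (proj2 (hE _))].
  have [al [be /(_ j)[HF HE]]] := pdiff_rigid Vy.
  have RF m := is_derive_Re m j (dF Vy); have IF m := is_derive_Im m j (dF Vy).
  have RE m := is_derive_Re m j (dE Vy); have IE m := is_derive_Im m j (dE Vy).
  have [_ ->] := is_derive_comb 1 (-1) (Dq 1 _ _ _ _ _ _ _ _ _ _ (RE k) (RF l) (IE k) (IF l))
    (Dq 1 _ _ _ _ _ _ _ _ _ _ (RF k) (RE l) (IF k) (IE l)).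
  rewrite /=; move: (entries _ _ _ _ _ HF k) (entries _ _ _ _ _ HF l).
  move: (entries _ _ _ _ _ HE k) (entries _ _ _ _ _ HE l).
  move: (pdiff j F y 0 k) (pdiff j F y 0 l) (pdiff j E y 0 k) (pdiff j E y 0 l).
  move=> ? ? ? ? -> -> -> ->.
  case: (F y 0 k) (F y 0 l) (E y 0 k) (E y 0 l) => [? ?] [? ?] [? ?] [? ?].
  by rewrite !ReImE /=; ring.
have cI : \forall y \near x, ImT y = ImT x.
  apply: (locally_constant oV Vx) => [y Vy|y j Vy].
    have hF := dF Vy; have hE := dE Vy.
    by apply: differentiable_comb; apply: dq; first [exact: (proj1 (hF _))|exact: (proj2 (hF _))|exact: (proj1 (hE _))|exact: (proj2 (hE _))].
  have [al [be /(_ j)[HF HE]]] := pdiff_rigid Vy.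
  have RF m := is_derive_Re m j (dF Vy); have IF m := is_derive_Im m j (dF Vy).
  have RE m := is_derive_Re m j (dE Vy); have IE m := is_derive_Im m j (dE Vy).
  have [_ ->] := is_derive_comb 1 (-1) (Dq (-1) _ _ _ _ _ _ _ _ _ _ (RE k) (IF l) (IE k) (RF l))
    (Dq (-1) _ _ _ _ _ _ _ _ _ _ (RF k) (IE l) (IF k) (RE l)).
  rewrite /=; move: (entries _ _ _ _ _ HF k) (entries _ _ _ _ _ HF l).
  move: (entries _ _ _ _ _ HE k) (entries _ _ _ _ _ HE l).
  move: (pdiff j F y 0 k) (pdiff j F y 0 l) (pdiff j E y 0 k) (pdiff j E y 0 l).
  move=> ? ? ? ? -> -> -> ->.
  case: (F y 0 k) (F y 0 l) (E y 0 k) (E y 0 l) => [? ?] [? ?] [? ?] [? ?].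
  by rewrite !ReImE /=; ring.
have TE y : twist (F y) (E y) k l = ReT y +i* ImT y.
  by apply: complex_eq; rewrite !ReImE /= /ReT /ImT /q; ring.
by apply: filterS2 cR cI => y hR hI; rewrite !TE hR hI.
Qed.

End LocalRigidity.

(** * Surfaces of constant contact angle *)

Section TwoByTwo.
Variable R : fieldType.

Lemma mxtrace2 (A : 'M[R]_2) : \tr A = A 0 0 + A 1 1.
Proof. by rewrite /mxtrace sum_ord2. Qed.

Lemma mulmx2 m n (A : 'M[R]_(m, 2)) (B : 'M[R]_(2, n)) i j : (A *m B) i j = A i 0 * B 0 j + A i 1 * B 1 j.
Proof. by rewrite mxE sum_ord2. Qed.

Lemma mxtrace_invmx2 (g h : 'M[R]_2) (d := g 0 0 * g 1 1 - g 0 1 * g 1 0) : d != 0 ->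
  \tr (invmx g *m h) = d^-1 *
    (g 1 1 * h 0 0 - g 0 1 * h 1 0 - g 1 0 * h 0 1 + g 0 0 * h 1 1).
Proof.
move=> d0.
pose B : 'M[R]_2 := \matrix_(i, j) (d^-1 *
  (if i == 0 then if j == 0 then g 1 1 else - g 0 1
   else if j == 0 then - g 1 0 else g 0 0)).
have Bg : B *m g = 1%:M.
  apply/matrixP => i j; rewrite mulmx2 !mxE.
  by elim/ord2P: i; elim/ord2P: j; rewrite /= ?mulr1n ?mulr0n -?(mulVf d0) /d; ring.
have [_ gU] := mulmx1_unit Bg.
have -> : invmx g = B by rewrite -[LHS]mul1mx -Bg -mulmxA mulmxV// mulmx1.
by rewrite mxtrace2 !mulmx2 !mxE /=; ring.
Qed.

End TwoByTwo.

Lemma cramer2 (K : fieldType) (V : lmodType K) (P0 P1 e1 e2 : V) (a b c d : K) :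
  e1 = a *: P0 + b *: P1 -> e2 = c *: P0 + d *: P1 ->
  (a * d - b * c) *: P0 = d *: e1 + (- b) *: e2 /\
  (a * d - b * c) *: P1 = (- c) *: e1 + a *: e2.
Proof.
move=> -> ->; split; rewrite !scalerDr !scalerA addrACA -!scalerDl.
  rewrite (_ : d * b + _ = 0); last by ring.
  by rewrite scale0r addr0; congr (_ *: _); ring.
rewrite (_ : - c * a + _ = 0); last by ring.
by rewrite scale0r add0r; congr (_ *: _); ring.
Qed.

Section TangentCoframe.
Variable R : realType.
Local Open Scope complex_scope.

Lemma dual_coframe (P : 'I_2 -> C2 R) (e1 e2 : C2 R) (p q : 'I_2 -> R) :
  e1 = (p 0)%:C *: P 0 + (p 1)%:C *: P 1 ->
  e2 = (q 0)%:C *: P 0 + (q 1)%:C *: P 1 ->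
  inner e1 e1 = 1 -> inner e2 e2 = 1 -> inner e1 e2 = 0 ->
  exists al be : 'I_2 -> R,
    (forall j, P j = (al j)%:C *: e1 + (be j)%:C *: e2) /\ al 0 * be 1 - al 1 * be 0 != 0.
Proof.
move=> E1 E2 n1 n2 n12; pose d := p 0 * q 1 - p 1 * q 0.
have dE : d%:C = (p 0)%:C * (q 1)%:C - (p 1)%:C * (q 0)%:C by rewrite rmorphB !rmorphM.
have [EQ0 EQ1] := cramer2 E1 E2; rewrite -dE in EQ0 EQ1.
have inner_realcomb (a b : R) (v : C2 R) : inner (a%:C *: e1 + b%:C *: e2) v =
    a * inner e1 v + b * inner e2 v.
  by rewrite innerDl inner_scalel [inner (b%:C *: e2) v]inner_scalel /= !mul0r !addr0.
have z v : inner (0 : C2 R) v = 0 by rewrite innerE !mxE /= !mul0r !addr0.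
(* If the determinant vanished, Cramer's identities would be linear relations between the
   orthonormal [e1] and [e2]; their coefficients would vanish and force [e1 = 0]. *)
have d0 : d != 0.
  apply/eqP => d0; rewrite d0 !scale0r -!rmorphN in EQ0 EQ1.
  have := congr1 (fun v => inner v e1) EQ1; have := congr1 (fun v => inner v e2) EQ1.
  rewrite !inner_realcomb !z (innerC e2 e1) n1 n2 n12 => h1 h2.
  have := congr1 (fun v => inner v e2) EQ0.
  rewrite !inner_realcomb !z n2 n12 => h3.
  have p0 : p 0 = 0 by lra.
  have p1 : p 1 = 0 by lra.
  by move: n1; rewrite {1}E1 p0 p1 !scale0r addr0 z => /eqP; rewrite eq_sym oner_eq0.
have dC : d%:C != 0 by rewrite -(rmorph0 (real_complex R)) (inj_eq (@complexI R)).
have inv (a : R) : (d^-1 * a)%:C = d%:C^-1 * a%:C by rewrite rmorphM fmorphV.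
exists (fun j => if j == 0 then d^-1 * q 1 else d^-1 * - q 0),
  (fun j => if j == 0 then d^-1 * - p 1 else d^-1 * p 0); split.
  elim/ord2P; rewrite [(_ == _)]/= !inv -!scalerA -scalerDr !rmorphN.
    by rewrite -EQ0 scalerA mulVf// scale1r.
  by rewrite -EQ1 scalerA mulVf// scale1r.
by rewrite /= (_ : _ - _ = d^-1) ?invr_eq0// /d; field.
Qed.

End TangentCoframe.

Section Surface.
Variables (R : realType) (M : topologicalType) (S : immersed_surface R M).
Local Open Scope complex_scope.
Implicit Types (c d : chart R M) (p q : M) (x : 'rV[R]_2).

Lemma local_param_smooth c : atlas S c -> smoothC2 (codom c) (local_param S c).
Proof. exact: immersion_smooth. Qed.

Lemma differentialE (F : 'rV[R]_2 -> C2 R) x v :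
  differentialC2 F x v = (v 0 0)%:C *: pdiff 0 F x + (v 0 1)%:C *: pdiff 1 F x.
Proof. by rewrite /differentialC2 sum_ord2 !partial_pdiff. Qed.

(** Tangency to the sphere and orthogonality to the Reeb vector are the real and imaginary parts of
    one Hermitian orthogonality relation. *)
Lemma unitary_frame_contact p (e : C2 R) :
  inner e e = 1 -> contact_distribution (S p) e -> unitary_frame (S p) e.
Proof.
move=> ee [h1 h2]; split; first exact: immersion_sphere3.
  by rewrite hprod_inner ee -[inner e ('i *: e)]opprK -inner_iC inner_i_self oppr0.
by rewrite hprod_inner h1 -[inner (S p) _]opprK -inner_iC h2 oppr0.
Qed.

Lemma e2_comb (F E : C2 R) (s t : R) : s%:C *: ('i *: E) + t%:C *: ('i *: F) =
  (0 +i* t) *: F + (0 +i* s) *: E.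
Proof.
rewrite !scalerA addrC.
by congr (_ *: _ + _ *: _); apply: complex_eq; rewrite !ReImE /=; ring.
Qed.

Lemma frame_coframe b c V E e2 : contact_frame S (fun=> b) c V E e2 ->
  forall x, V x -> exists al be,
    coframe (local_param S c) E (sin b) (cos b) x al be.
Proof.
move=> [_ _ h] x Vx; have [[[v _ vE] [w _ wE]] [n1 n2 n12] cE E2] := h x Vx.
rewrite !differentialE in vE wE.
have [al [be [HP W0]]] := dual_coframe (P := fun j => pdiff j (local_param S c) x)
  (p := fun j => v 0 j) (q := fun j => w 0 j) (esym vE) (esym wE) n1 n2 n12.
exists al, be; split=> // j; rewrite HP E2 /reeb e2_comb scalerDr !scalerA addrCA -scalerDl.
by congr (_ *: _ + _ *: _); apply: complex_eq; rewrite !ReImE /=; ring.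
Qed.

(** This discharges [mean0]. The Gram determinant is the square of the determinant of the coframe,
    so it is nonzero and can be cleared. *)
Lemma minimal_trace b c V E e2 : minimal S -> atlas S c -> V `<=` codom c ->
  contact_frame S (fun=> b) c V E e2 -> 
  let F := local_param S c in
  forall x (h : 'I_2 -> 'I_2 -> R), V x ->
  (forall i j, inner (pdiff i (pdiff j F) x) (adapted_normal F E (sin b) (cos b) x) = h i j) ->
  inner (pdiff 1 F x) (pdiff 1 F x) * h 0 0
  - inner (pdiff 0 F x) (pdiff 1 F x) * h 1 0
  - inner (pdiff 1 F x) (pdiff 0 F x) * h 0 1
  + inner (pdiff 0 F x) (pdiff 0 F x) * h 1 1 = 0.
Proof.
move=> mS Sc Vc fr F x h Vx hh; set n := adapted_normal _ _ _ _ x in hh.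
have [al [be cx]] := frame_coframe fr Vx; have [HP W0] := cx.
have [_ _ /(_ x Vx)[_ [n1 _ _] cE _]] := fr.
have frx : unitary_frame (F x) (E x) := unitary_frame_contact n1 cE.
have sc1 : sin b ^+ 2 + cos b ^+ 2 = 1 by rewrite addrC cos2Dsin2.
have nP j : inner (pdiff j F x) n = 0.
  by rewrite HP /n /adapted_normal (inner_frame _ _ _ _ _ _ _ _ frx); ring.
have nn : unit_normal S c x n.
  split.
  - by rewrite /n /adapted_normal (inner_frame _ _ _ _ _ _ _ _ frx) -sc1; ring.
  - have := inner_frame 1 0 0 0 0 (- sin b) 0 (cos b) frx.
    rewrite scale0r scale1r addr0 /tangent_sphere3 /n /adapted_normal => ->; ring.
  - move=> v [w _ <-]; rewrite differentialE innerDl [inner (_%:C *: pdiff 0 _ _) _]inner_scalel.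
    rewrite [inner (_%:C *: pdiff 1 _ _) _]inner_scalel /=.
    by rewrite (nP 0) (nP 1) !mulr0 !mul0r !addr0.
have := mS c x n Sc (Vc _ Vx) nn.
have fE i j : first_fundamental_form S c x i j = inner (pdiff i F x) (pdiff j F x).
  by rewrite mxE !partial_pdiff.
have hE i j : second_fundamental_form S c n x i j = h i j.
  by rewrite mxE !partial_pdiff hh.
have G i j : inner (pdiff i F x) (pdiff j F x) = al i * al j + be i * be j.
  rewrite (HP i) (HP j) (inner_frame _ _ _ _ _ _ _ _ frx).
  transitivity (al i * al j + (sin b ^+ 2 + cos b ^+ 2) * (be i * be j)); first by ring.
  by rewrite sc1 mul1r.
have det0 : (al 0 * al 0 + be 0 * be 0) * (al 1 * al 1 + be 1 * be 1) -
    (al 0 * al 1 + be 0 * be 1) * (al 1 * al 0 + be 1 * be 0) != 0.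
  by rewrite (_ : _ - _ = (al 0 * be 1 - al 1 * be 0) ^+ 2) ?expf_neq0//; ring.
rewrite /mean_curvature mxtrace_invmx2; rewrite !fE !G// !hE.
by move=> /eqP; rewrite !mulf_eq0 !invr_eq0 pnatr_eq0 (negbTE det0) => /eqP.
Qed.

Lemma differential_entry (F : 'rV[R]_2 -> C2 R) x v k : differentialC2 F x v 0 k =
  (v 0 0 * Re (pdiff 0 F x 0 k) + v 0 1 * Re (pdiff 1 F x 0 k)) +i*
  (v 0 0 * Im (pdiff 0 F x 0 k) + v 0 1 * Im (pdiff 1 F x 0 k)).
Proof.
rewrite differentialE !mxE; case: (pdiff 0 F x 0 k) (pdiff 1 F x 0 k) => a b [a' b'].
by apply: complex_eq; rewrite !ReImE /= !mul0r ?subr0 ?addr0.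
Qed.

Lemma overlap_open c d x : overlap c d x -> \forall y \near x, overlap c d y.
Proof.
move=> [cx dx].
have n1 : \forall y \near x, codom c y by apply: open_nbhs_nbhs; split=> //; exact: codom_open.
have n2 : \forall y \near x, dom d (param c y).
  by apply: (param_continuous cx); apply: open_nbhs_nbhs; split=> //; exact: dom_open.
by apply: filterS2 n1 n2.
Qed.

Lemma pdiff_transition c d x j : atlas S c -> atlas S d -> overlap d c x ->
  pdiff j (local_param S d) x =
  differentialC2 (local_param S c) (transition d c x) ('D_(delta_mx 0 j) (transition d c) x).
Proof.
move=> Sc Sd ox; have [dx cpx] := ox.
have [_ /(_ c d Sc Sd)[_ sT]] := surface_atlas S.
have dT := smooth_differentiable sT ox.
have cT : codom c (transition d c x) by exact: coord_codom.
have near_eq : \forall y \near x, local_param S d y = local_param S c (transition d c y).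
  by apply: filterS (overlap_open ox) => y [_ hy]; rewrite /local_param /transition /= coordK.
have chain (g : 'rV[R]_2 -> R^o) (f : 'rV[R]_2 -> R^o) :
    differentiable g (transition d c x) ->
    (\forall y \near x, f y = g (transition d c y)) ->
    'D_(delta_mx 0 j) f x =
    ('D_(delta_mx 0 j) (transition d c) x) 0 0 * 'D_(delta_mx 0 0) g (transition d c x) +
    ('D_(delta_mx 0 j) (transition d c) x) 0 1 * 'D_(delta_mx 0 1) g (transition d c x).
  move=> dg fg; rewrite (near_eq_derive (g := g \o transition d c) _ fg).
  rewrite -derive_rV// deriveE; last exact: differentiable_comp.
  by rewrite diff_comp//= -!deriveE.
have hd := smoothC2_diff (local_param_smooth Sc) cT.
apply/rowP => k; have [dR dI] := hd k; rewrite pdiffE.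
rewrite (chain _ _ dR); last by apply: filterS near_eq => y ->.
rewrite (chain _ _ dI); last by apply: filterS near_eq => y ->.
have EE := differential_entry (local_param S c) (transition d c x)
  ('D_(delta_mx 0 j) (transition d c) x) k.
by rewrite EE !pdiffE.
Qed.

Lemma differential_lin (F : 'rV[R]_2 -> C2 R) x u v (a b : R) :
  a%:C *: differentialC2 F x u + b%:C *: differentialC2 F x v =
  differentialC2 F x (a *: u + b *: v).
Proof.
rewrite !differentialE; move: (pdiff 0 F x) (pdiff 1 F x) => P Q.
by rewrite !mxE !rmorphD !rmorphM /= !scalerDl !scalerDr !scalerA addrACA.
Qed.

Lemma tangent_chart_change c d p v : atlas S c -> atlas S d -> dom c p -> dom d p ->
  tangent_plane S d (coord d p) v -> tangent_plane S c (coord c p) v.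
Proof.
move=> Sc Sd cp dp [w _ <-].
have ox : overlap d c (coord d p) by split; [exact: coord_codom|rewrite /= coordK].
rewrite differentialE !(pdiff_transition _ Sc Sd ox) differential_lin.
by rewrite /transition /= coordK//; eexists.
Qed.

(** The chart is existentially quantified, so that the notion belongs to the point of the surface
    and can be compared across charts. *)
Definition characteristic p (e : C2 R) : Prop := exists c,
  [/\ atlas S c, dom c p, tangent_plane S c (coord c p) e, inner e e = 1 &
      contact_distribution (S p) e].

(** Since sin b = 0, the vector e2 lies on the Reeb line. A tangent vector orthogonal to the Reeb
    field is therefore a real multiple of [E], and unit length leaves only the sign. *)
Lemma local_frame b c x : minimal S -> contact_angle S (fun=> b) ->
  atlas S c -> codom c x ->
  exists E V, [/\ \forall y \near x, V y /\ codom c y,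
    forall y, V y -> characteristic (param c y) (E y),
    (forall y v, V y -> characteristic (param c y) v -> v = E y \/ v = - E y) &
    forall k l, \forall y \near x,
      twist (S (param c y)) (E y) k l = twist (S (param c x)) (E x) k l].
Proof.
move=> mS cS Sc cx; have [V [oV Vx Vc [E [e2 fr]]]] := cS c x Sc cx.
have [sE _ frV] := fr; pose F := local_param S c.
have sF : smoothC2 V F by apply: smoothC2_sub Vc _; exact: local_param_smooth.
have sc1 : sin b ^+ 2 + cos b ^+ 2 = 1 by rewrite addrC cos2Dsin2.
have uf y : V y -> unitary_frame (F y) (E y).
  by move=> /frV[_ [n1 _ _] cE _]; exact: unitary_frame_contact.
have cf y : V y -> exists al be, coframe F E (sin b) (cos b) y al be.
  exact: frame_coframe fr y.
have mt := minimal_trace mS Sc Vc fr.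
have s0 := sin_contact_angle_eq0 oV sF sE sc1 uf cf mt Vx.
have c0 : cos b != 0.
  by apply/eqP => c0; move: sc1; rewrite s0 c0 expr0n addr0 => /eqP; rewrite eq_sym oner_eq0.
exists E, V; split.
- have : \forall y \near x, V y by exact: open_nbhs_nbhs.
  by apply: filterS => y Vy; split=> //; exact: Vc.
- move=> y Vy; have [[h1 _] [n1 _ _] cE _] := frV y Vy; exists c; split=> //.
    exact/param_dom/Vc.
  by rewrite paramK//; exact: Vc.
- move=> y v Vy [d [Sd dp tv nv [_ cv]]].
  have dcp : dom c (param c y) by exact/param_dom/Vc.
  have := tangent_chart_change Sc Sd dcp dp tv; rewrite paramK; last exact: Vc.
  move=> [w _]; rewrite differentialE -/F => wv.
  have [al [be [HP W0]]] := cf y Vy; rewrite !HP s0 in wv.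
  set A := w 0 0 * al 0 + w 0 1 * al 1; set B := w 0 0 * be 0 + w 0 1 * be 1.
  have vE : v = (0 +i* (cos b * B)) *: F y + (A +i* 0) *: E y.
    rewrite -wv !scalerDr !scalerA addrACA -!scalerDl.
    by congr (_ *: _ + _ *: _); apply: complex_eq; rewrite !ReImE /= /A /B; ring.
  have [iv _ _] := inner_frame_basis 0 (cos b * B) A 0 (uf y Vy).
  have B0 : cos b * B = 0 by rewrite -iv -vE innerC.
  rewrite B0 scale0r add0r in vE.
  have AA : (A - 1) * (A + 1) = 0.
    have [_ [n1 _ _] _ _] := frV y Vy.
    have -> : (A - 1) * (A + 1) = A * A - 1 by ring.
    have -> : A * A = inner v v.
      by rewrite vE inner_scalel inner_scaler /= n1 !mul0r !addr0 mulr1.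
    by rewrite nv subrr.
  move/eqP: AA; rewrite mulf_eq0 subr_eq0 addr_eq0 => /orP[]/eqP A1.
    by left; rewrite vE A1 scale1r.
  by right; rewrite vE A1 (_ : _ +i* _ = -1) ?scaleN1r//; apply: complex_eq; rewrite /= ?oppr0.
- by move=> k l; exact: (twist_locally_constant oV sF sE sc1 uf cf mt k l Vx).
Qed.

End Surface.

(** * From local frames to one unitary image of the torus *)

Section Rigidity.
Variables (R : realType) (M : topologicalType) (S : immersed_surface R M).
Local Open Scope complex_scope.
Implicit Types (c d : chart R M) (p q : M) (x : 'rV[R]_2).

Lemma atlas_cover p : exists2 c, atlas S c & dom c p.
Proof. by have [h _] := surface_atlas S; exact: h. Qed.

Lemma connected_locally_constant (P : M -> Prop) p0 :
  (forall p, \forall q \near p, P q <-> P p) -> P p0 -> forall p, P p.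
Proof.
move=> Pc Pp0 p.
have oP : open [set q | P q].
  by rewrite openE => q Pq; apply: filterS (Pc q) => q' [_]; exact.
have cP : closed [set q | P q].
  rewrite -openC openE => q nPq; apply: filterS (Pc q) => q' [h _] Pq'.
  exact/nPq/h.
have := @surface_connected _ _ S [set q | P q].
have /[swap] /[apply] : [set q | P q] !=set0 by exists p0.
move=> /(_ (ex_intro2 _ _ _ oP (esym (setTI _)))) /(_ (ex_intro2 _ _ _ cP (esym (setTI _)))) E.
by have : [set: M] p by []; rewrite -E.
Qed.

(** A single sign serves all entries, because passing from [e] to [- e] negates the whole matrix. *)
Definition twist_eq (p : M) (e : C2 R) (D : 'I_2 -> 'I_2 -> R[i]) : Prop :=
  (forall k l, twist (S p) e k l = D k l) \/ (forall k l, twist (S p) e k l = - D k l).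

Lemma twistN (F E : C2 R) k l : twist F (- E) k l = - twist F E k l.
Proof. by rewrite /twist !mxE; apply: complex_eq; rewrite !ReImE; ring. Qed.

(** Having a characteristic vector with twist plus or minus D does not depend on a choice of sign,
    so it can be propagated over the connected surface although no global frame is available. *)
Lemma twist_global : minimal S -> constant_contact_angle S ->
  exists p0 e0, characteristic S p0 e0 /\
    forall p, exists e, characteristic S p e /\ twist_eq p e (twist (S p0) e0).
Proof.
move=> mS [b cS]; have [p0 _] := surface_nonempty S.
have [c0 Sc0 cp0] := atlas_cover p0.
have [E0 [V0 [n0 ch0 _ _]]] := local_frame mS cS Sc0 (coord_codom cp0).
have [V0x _] := nbhs_singleton n0.
have := ch0 _ V0x; rewrite coordK// => ch.
exists p0, (E0 (coord c0 p0)); split=> //; set D := twist _ _.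
apply: (@connected_locally_constant _ p0); last first.
  by exists (E0 (coord c0 p0)); split=> //; left.
move=> p; have [c Sc cp] := atlas_cover p.
have [E [V [nV chV uV tV]]] := local_frame mS cS Sc (coord_codom cp).
have nT : \forall y \near coord c p, forall k l,
    twist (S (param c y)) (E y) k l = twist (S (param c (coord c p))) (E (coord c p)) k l.
  apply: (@filter_forall 'rV[R]_2 'I_2 (fun k y => forall l,
    twist (S (param c y)) (E y) k l = twist (S (param c (coord c p))) (E (coord c p)) k l)
    (nbhs (coord c p)) _) => k.
  apply: (@filter_forall 'rV[R]_2 'I_2 (fun l y =>
    twist (S (param c y)) (E y) k l = twist (S (param c (coord c p))) (E (coord c p)) k l)
    (nbhs (coord c p)) _) => l.
  exact: tV.
have nd : \forall q \near p, dom c q by apply: open_nbhs_nbhs; split=> //; exact: dom_open.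
have /(_ _ (filterI nV nT)) nq := Defs.coord_continuous cp.
(* Uniqueness up to sign replaces the unknown vector by the local frame, whose twist is constant
   near [p]. *)
have key q : dom c q -> V (coord c q) ->
    (exists e, characteristic S q e /\ twist_eq q e D) <-> twist_eq q (E (coord c q)) D.
  move=> cq Vq; split=> [[e [che te]]|te].
    have := uV _ e Vq; rewrite coordK// => /(_ che)[eE|eE]; rewrite eE in te => //.
    case: te => te; [right|left] => k l; have := te k l; rewrite twistN => h.
      by rewrite -h opprK.
    by rewrite -[LHS]opprK h opprK.
  by exists (E (coord c q)); split=> //; have := chV _ Vq; rewrite coordK.
have [Vp _] := nbhs_singleton nV.
apply: filterS2 nd nq => q cq [[Vq _] tq].
rewrite !key//; rewrite /twist_eq.
by split=> -[h|h]; [left|right|left|right] => k l; have := tq k l; rewrite !coordK// h.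
Qed.

Lemma conjcM (x y : R[i]) : (x * y)^*%C = x^*%C * y^*%C.
Proof. exact: rmorphM. Qed.

Lemma conjcD (x y : R[i]) : (x + y)^*%C = x^*%C + y^*%C.
Proof. exact: rmorphD. Qed.

Lemma clifford_torusE (z : C2 R) : clifford_torus R z <->
  z 0 0 * (z 0 0)^*%C = 2^-1 /\ z 0 1 * (z 0 1)^*%C = 2^-1.
Proof. by []. Qed.

(** The signs of F - iE and F + iE, which span the two complex lines that stay fixed along the
    surface. *)
Definition torus_sign (i : 'I_2) : R[i] := if i == 0 then - 'i%C else 'i%C.

Definition torus_vector (F E : C2 R) (i : 'I_2) : C2 R := 1 *: F + torus_sign i *: E.

Definition torus_frame (F E : C2 R) : 'M[R[i]]_2 :=
  \matrix_(i, j) ((Num.sqrt 2)^-1%:C * torus_vector F E i 0 j).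

Lemma sqrt2V_sqr : (Num.sqrt 2)^-1%:C * (Num.sqrt 2)^-1%:C = 2^-1 :> R[i].
Proof.
rewrite -rmorphM /= -invfM -expr2 sqr_sqrtr ?ler0n// fmorphV /=; congr (_^-1).
by rewrite rmorph_nat.
Qed.

Lemma hprod_torus_vector F E z i : hprod z (torus_vector F E i) =
  hprod z F + (torus_sign i)^*%C * hprod z E.
Proof. by rewrite /torus_vector hprodDr conjc1 mul1r. Qed.

Lemma torus_sign_mul i j : 1 + (torus_sign j)^*%C * torus_sign i = (i == j)%:R * 2 :> R[i].
Proof.
by elim/ord2P: i; elim/ord2P: j; rewrite /torus_sign /=; apply: complex_eq; rewrite !ReImE /=; ring.
Qed.

Lemma torus_frame_unitary F E : unitary_frame F E -> torus_frame F E \is unitarymx.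
Proof.
case=> FF EE FE; have EF : hprod E F = 0 by rewrite -hprodJ FE conjc0.
apply/unitarymxP/matrixP => i j.
set r : R[i] := (Num.sqrt 2)^-1%:C; set u := torus_vector F E.
have tE k l : (torus_frame F E ^t*)%sesqui k l = r * (u l 0 k)^*%C.
  have cE (x : R[i]) : Num.conj x = x^*%C by [].
  have E' : torus_frame F E l k = r * u l 0 k by rewrite mxE.
  by rewrite mxE cE mxE E' conjcM; congr (_ * _); exact: conjc_real.
have E' k l : torus_frame F E k l = r * u k 0 l by rewrite mxE.
rewrite mulmx2 !tE !E' [RHS]mxE.
transitivity (r * r * hprod (u i) (u j)); first by rewrite hprodE; ring.
rewrite sqrt2V_sqr hprod_torus_vector /u /torus_vector !hprodDl FF EF FE EE.
by rewrite !mulr0 addr0 add0r !mulr1 torus_sign_mul mulrC -mulrA mulfV ?mulr1 ?pnatr_eq0.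
Qed.

Lemma mem_torus F E z : unitary_frame F E -> hprod z z = 1 ->
  Im (hprod z E * (hprod z F)^*%C) = 0 ->
  unitary_image (torus_frame F E) (clifford_torus R) z.
Proof.
move=> fr zz Imz; have zE := frame_expand z fr.
set a := hprod z F in zE Imz; set b := hprod z E in zE Imz.
have ab : a * a^*%C + b * b^*%C = 1.
  transitivity (hprod z (a *: F + b *: E)); last by rewrite -zE.
  by rewrite hprodDr -/a -/b; ring.
set r : R[i] := (Num.sqrt 2)^-1%:C.
have rr : r * r = 2^-1 by exact: sqrt2V_sqr.
have rJ : r^*%C = r by exact: conjc_real.
have ii : 'i%C * 'i%C = -1 :> R[i] by apply: complex_eq; rewrite !ReImE /=; ring.
have iJ : 'i%C^*%C = - 'i%C :> R[i] by apply: complex_eq; rewrite !ReImE /=; ring.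
have two0 : 2 != 0 :> R[i] by rewrite pnatr_eq0.
have sym : a^*%C * b = a * b^*%C.
  apply: complex_eq; first by rewrite !ReImE; ring.
  by move: Imz; rewrite !ReImE => Imz; lra.
have s0 : (torus_sign 0)^*%C = 'i%C by rewrite /torus_sign /=; apply: complex_eq; rewrite /= ?oppr0 ?opprK.
have s1 : (torus_sign 1)^*%C = - 'i%C by rewrite /torus_sign /=; apply: complex_eq; rewrite /= ?oppr0 ?opprK.
pose w : C2 R := \row_i (r * (a + (torus_sign i)^*%C * b)).
have w0 : w 0 0 = r * (a + 'i%C * b) by rewrite mxE s0.
have w1 : w 0 1 = r * (a - 'i%C * b) by rewrite mxE s1 mulNr.
have U0 k : torus_frame F E 0 k = r * (F 0 k - 'i%C * E 0 k).
  by rewrite !mxE mul1r /torus_sign /= mulNr.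
have U1 k : torus_frame F E 1 k = r * (F 0 k + 'i%C * E 0 k).
  by rewrite !mxE mul1r /torus_sign.
exists w; last first.
  apply/rowP => k; have -> : z 0 k = a * F 0 k + b * E 0 k by rewrite {1}zE !mxE.
  rewrite mulmx2 w0 w1 U0 U1.
  transitivity ((2 * (r * r)) * (a * F 0 k + - ('i%C * 'i%C) * b * E 0 k)); first by ring.
  by rewrite rr ii mulfV//; ring.
have conj_sub (u v : R[i]) : (u - v)^*%C = u^*%C - v^*%C by exact: rmorphB.
apply/clifford_torusE; split; rewrite ?w0 ?w1 !conjcM ?conj_sub ?conjcD !conjcM rJ iJ.
  transitivity (r * r * ((a * a^*%C + - ('i%C * 'i%C) * (b * b^*%C)) + 'i%C * (a^*%C * b - a * b^*%C))); first by ring.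
  by rewrite rr ii sym opprK mul1r ab subrr mulr0 addr0 mulr1.
transitivity (r * r * ((a * a^*%C + - ('i%C * 'i%C) * (b * b^*%C)) - 'i%C * (a^*%C * b - a * b^*%C))); first by ring.
by rewrite rr ii sym opprK mul1r ab subrr mulr0 subr0 mulr1.
Qed.

(** The right-hand side is 2i times the imaginary part that [mem_torus] requires to vanish, so
    membership in the torus becomes an equation in D alone. *)
Lemma hprod_twist (z F E : C2 R) (D := twist F E) :
  \sum_k \sum_l z 0 k * D k l * (z 0 l)^*%C =
  hprod z E * (hprod z F)^*%C - hprod z F * (hprod z E)^*%C.
Proof.
have tE k l : twist F E k l = (E 0 k)^*%C * F 0 l - (F 0 k)^*%C * E 0 l by [].
by rewrite !sum_ord2 /D !tE !hprodE !conjcD !conjcM !conjcK; ring.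
Qed.

Lemma image_in_torus : minimal S -> constant_contact_angle S ->
  exists2 U : 'M[R[i]]_2, U \is unitarymx &
    S @` [set: M] `<=` unitary_image U (clifford_torus R).
Proof.
move=> mS cS; have [p0 [e0 [ch0 tw]]] := twist_global mS cS.
have uf p e : characteristic S p e -> unitary_frame (S p) e.
  by case=> c [_ _ _ ee ce]; exact: unitary_frame_contact.
have fr0 := uf _ _ ch0.
exists (torus_frame (S p0) e0); first exact: torus_frame_unitary.
move=> _ [p _ <-]; apply: mem_torus => //; first exact: immersion_sphere3.
have [e [che te]] := tw p; have [FF EE FE] := uf _ _ che.
(* For the frame at [p] itself the form vanishes because (F, E) = 0. The ambiguous sign of the twist
   does not affect this equation. *)
have z1 : \sum_k \sum_l S p 0 k * twist (S p) e k l * (S p 0 l)^*%C = 0.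
  by rewrite hprod_twist FE mul0r conjc0 mulr0 subr0.
have z2 : \sum_k \sum_l S p 0 k * twist (S p0) e0 k l * (S p 0 l)^*%C = 0.
  move: z1; rewrite !sum_ord2; case: te => te; rewrite !te => // h.
  by apply: oppr_inj; rewrite oppr0 -[RHS]h; ring.
move: z2; rewrite hprod_twist => /(congr1 (@complex.Im R)); rewrite !ReImE [X in _ = X]/=; lra.
Qed.

End Rigidity.

(** * Lifts of geodesics of the torus *)

Section TorusLines.
Variable R : realType.
Implicit Types (U : 'M[R[i]]_2) (u t : R).

Definition cis (x : R) : R[i] := (cos x +i* sin x)%C.

Lemma cis_normed x : cis x * (cis x)^*%C = 1.
Proof.
apply: complex_eq; rewrite !ReImE /=; last by ring.
by rewrite mulrN opprK -!expr2 cos2Dsin2.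
Qed.

Definition torus_line U (w1 w2 : R[i]) (a b u : R) : C2 R :=
  (\row_k (if k == 0 then w1 * cis (a * u) else w2 * cis (b * u))) *m U.

Lemma torus_line_entry U w1 w2 a b u k : torus_line U w1 w2 a b u 0 k =
  (w1 * U 0 k) * cis (a * u) + (w2 * U 1 k) * cis (b * u).
Proof. by rewrite mulmx2 !mxE /=; ring. Qed.

Lemma is_derive_affine (c x y : R) (f df : R -> R^o) (t : R) :
  (forall z : R, is_derive z 1 f (df z)) ->
  is_derive t 1 (fun t : R => f (c * (x + y * t)) : R^o) (c * y * df (c * (x + y * t))).
Proof.
move=> Df.
have Da : is_derive t 1 (fun t : R => c * (x + y * t) : R^o) (c * y).
  have D := is_deriveZ c (is_deriveD (is_derive_cst (x : R^o) t 1)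
    (is_deriveZ y (is_derive_id (t : R^o) 1))).
  by apply: (is_derive_eq D); rewrite add0r [y *: 1]mulr1.
have := @is_derive1_comp R f (fun t : R => c * (x + y * t)) t _ _ (Df (c * (x + y * t))) Da.
by rewrite mulrC.
Qed.

Lemma is_derive_Re_cis (v : R[i]) (c x y t : R) :
  is_derive t 1 (fun t : R => Re (v * cis (c * (x + y * t))) : R^o)
    (c * y * Re ('i%C * v * cis (c * (x + y * t)))).
Proof.
have Dc := is_derive_affine c x y t (fun z => is_derive_cos z).
have Ds := is_derive_affine c x y t (fun z => is_derive_sin z).
have := is_deriveB (is_deriveZ (Re v) Dc) (is_deriveZ (Im v) Ds).
rewrite (_ : _ - _ = fun t : R => Re (v * cis (c * (x + y * t)))); last first.
  by apply/funext => z; rewrite !ReImE.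
by move=> D; apply: (is_derive_eq D); rewrite !ReImE /GRing.scale /=; ring.
Qed.

Lemma is_derive_Im_cis (v : R[i]) (c x y t : R) :
  is_derive t 1 (fun t : R => Im (v * cis (c * (x + y * t))) : R^o)
    (c * y * Im ('i%C * v * cis (c * (x + y * t)))).
Proof.
have Dc := is_derive_affine c x y t (fun z => is_derive_cos z).
have Ds := is_derive_affine c x y t (fun z => is_derive_sin z).
have := is_deriveD (is_deriveZ (Re v) Ds) (is_deriveZ (Im v) Dc).
rewrite (_ : _ + _ = fun t : R => Im (v * cis (c * (x + y * t)))); last first.
  by apply/funext => z; rewrite !ReImE.
by move=> D; apply: (is_derive_eq D); rewrite !ReImE /GRing.scale /=; ring.
Qed.

(** The velocity is again a torus line, with coefficients multiplied by i a y and i b y, so the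
    facts about lines also give its norm and its continuity. *)
Lemma is_derive_Re_line U w1 w2 a b (x y t : R) k :
  is_derive t 1 (fun t : R => Re (torus_line U w1 w2 a b (x + y * t) 0 k) : R^o)
    (Re (torus_line U ((a * y)%:C%C * ('i%C * w1)) ((b * y)%:C%C * ('i%C * w2)) a b (x + y * t) 0 k)).
Proof.
under eq_fun do rewrite torus_line_entry ReD.
apply: (is_derive_eq (is_deriveD (is_derive_Re_cis _ _ _ _ _) (is_derive_Re_cis _ _ _ _ _))).
rewrite torus_line_entry -!mulrA.
have cReM (c : R) z : Re (c%:C%C * z) = c * Re z by rewrite !ReImE /=; ring.
by rewrite [RHS]ReD !cReM !mulrA.
Qed.

Lemma is_derive_Im_line U w1 w2 a b (x y t : R) k :
  is_derive t 1 (fun t : R => Im (torus_line U w1 w2 a b (x + y * t) 0 k) : R^o)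
    (Im (torus_line U ((a * y)%:C%C * ('i%C * w1)) ((b * y)%:C%C * ('i%C * w2)) a b (x + y * t) 0 k)).
Proof.
under eq_fun do rewrite torus_line_entry ImD.
apply: (is_derive_eq (is_deriveD (is_derive_Im_cis _ _ _ _ _) (is_derive_Im_cis _ _ _ _ _))).
rewrite torus_line_entry -!mulrA.
have cImM (c : R) z : Im (c%:C%C * z) = c * Im z by rewrite !ReImE /=; ring.
by rewrite [RHS]ImD !cImM !mulrA.
Qed.

Lemma torus_line_continuous U w1 w2 a b k u :
  {for u, continuous (fun u : R => Re (torus_line U w1 w2 a b u 0 k) : R^o)} /\
  {for u, continuous (fun u : R => Im (torus_line U w1 w2 a b u 0 k) : R^o)}.
Proof.
have H (f : R -> R^o) df : (forall t, is_derive t 1 (fun t => f (0 + 1 * t)) (df t)) ->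
    {for u, continuous f}.
  move=> Df; apply: differentiable_continuous; apply/derivable1_diffP.
  by have [] := Df u; rewrite (_ : (fun t : R => _) = f)//; apply/funext => t; rewrite add0r mul1r.
by split; apply: H => t; [exact: is_derive_Re_line|exact: is_derive_Im_line].
Qed.

Lemma inner_unitary U (z w : C2 R) : U \is unitarymx -> inner (z *m U) (w *m U) = inner z w.
Proof.
move=> /unitarymxP UU.
have hE (x y : C2 R) : hprod x y = (x *m (y ^t*)%sesqui) 0 0.
  by rewrite mulmx2 !mxE hprodE.
by rewrite /inner !hE trmx_mul map_mxM mulmxA -(mulmxA z) UU mulmx1.
Qed.

End TorusLines.

(** * Length of a lifted line *)

Section LiftedLines.
Variables (R : realType) (M : topologicalType) (S : immersed_surface R M).
Variables (U : 'M[R[i]]_2) (w1 w2 : R[i]) (a b : R).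
Hypothesis uU : U \is unitarymx.
Hypotheses (hw1 : w1 * w1^*%C = 2^-1) (hw2 : w2 * w2^*%C = 2^-1).
Local Notation line := (torus_line U w1 w2 a b).

Lemma torus_line_velocity_norm (y u : R) :
  norm2 (torus_line U ((a * y)%:C%C * ('i%C * w1)) ((b * y)%:C%C * ('i%C * w2)) a b u) =
  Num.sqrt ((a ^+ 2 + b ^+ 2) / 2) * `|y|.
Proof.
rewrite -sqrtr_sqr -sqrtrM; last by rewrite divr_ge0// addr_ge0// sqr_ge0.
rewrite /norm2 inner_unitary//; congr Num.sqrt.
have H (c : R) (w : R[i]) (x : R) : w * w^*%C = 2^-1 ->
    Re ((c%:C%C * ('i%C * w) * cis x) * (c%:C%C * ('i%C * w) * cis x)^*%C) = c ^+ 2 / 2.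
  move=> hw; rewrite !conjcM.
  have iJ : 'i%C^*%C = - 'i%C :> R[i] by apply: complex_eq; rewrite !ReImE /=; ring.
  have ii : 'i%C * 'i%C = -1 :> R[i] by apply: complex_eq; rewrite !ReImE /=; ring.
  rewrite conjc_real iJ.
  rewrite (_ : _ * _ = (c%:C%C * c%:C%C) * - ('i%C * 'i%C) * (w * w^*%C) * (cis x * (cis x)^*%C));
    last by ring.
  have h2 : 2^-1 = (2^-1)%:C%C :> R[i] by rewrite fmorphV /= rmorph_nat.
  by rewrite cis_normed ii hw opprK !mulr1 h2 -!rmorphM /= expr2.
by rewrite /inner hprodE ReD !mxE /= !H//; ring.
Qed.

Definition lifts (g : R -> M) (u : R) := {for u, continuous g} /\ S (g u) = line u.

(** A lift need only be continuous: its image under the immersion is a line of constant speed, so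
    its length is the speed times the parameter difference. *)
Lemma lift_dist (g : R -> M) (lo hi s s' e : R) :
  (forall u, lo < u < hi -> lifts g u) -> lo < s < hi -> lo < s' < hi ->
  Num.sqrt ((a ^+ 2 + b ^+ 2) / 2) * `|s' - s| < e ->
  dist_lt S (g s) (g s') e.
Proof.
move=> Hg /andP[ls sh] /andP[ls' s'h] lt_e.
pose h (t : R) : M := g (s + (s' - s) * t).
(* The strict bounds leave room on both sides of the end points, where derivability is still
   two-sided; [s'] may lie on either side of [s]. *)
have rng t : t \in `[0, 1] -> lo < s + (s' - s) * t < hi.
  rewrite in_itv /= => /andP[t0 t1].
  have t1' : 0 <= 1 - t by rewrite subr_ge0.
  have [ss'|/ltW ss'] := leP s s'; rewrite -subr_ge0 in ss';
    have := mulr_ge0 t0 ss'; have := mulr_ge0 t1' ss'; move=> h1 h2; apply/andP; split; lra.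
have affc (t : R) : {for t, continuous (fun t : R => s + (s' - s) * t : R^o)}.
  apply: continuousD; first exact: cvg_cst.
  by apply: continuousM; [exact: cvg_cst|exact: cvg_id].
pose In (t : R) := lo < s + (s' - s) * t < hi.
have nIn (t : R) : In t -> \forall t' \near t, In t'.
  move=> tI; have sI : s + (s' - s) * t \in `]lo, hi[ by rewrite in_itv.
  have H : \forall t' \near t, s + (s' - s) * t' \in `]lo, hi[ := affc t _ (near_in_itvoo sI).
  by apply: filterS H => t'; rewrite in_itv.
pose w1' := (a * (s' - s))%:C%C * ('i%C * w1); pose w2' := (b * (s' - s))%:C%C * ('i%C * w2).
pose line' (t : R) := torus_line U w1' w2' a b (s + (s' - s) * t).
have DR (t : R) k : In t -> is_derive t 1 (fun t => Re (S (h t) 0 k) : R^o) (Re (line' t 0 k)).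
  move=> tI; have n : \forall t' \near t, Re (line (s + (s' - s) * t') 0 k) = Re (S (h t') 0 k).
    by apply: filterS (nIn t tI) => t' /Hg[_ <-].
  by apply: near_eq_is_derive n _; exact: is_derive_Re_line.
have DI (t : R) k : In t -> is_derive t 1 (fun t => Im (S (h t) 0 k) : R^o) (Im (line' t 0 k)).
  move=> tI; have n : \forall t' \near t, Im (line (s + (s' - s) * t') 0 k) = Im (S (h t') 0 k).
    by apply: filterS (nIn t tI) => t' /Hg[_ <-].
  by apply: near_eq_is_derive n _; exact: is_derive_Im_line.
have cont (F G : R -> R^o) (t : R) : In t -> (forall t' : R, In t' -> is_derive t' 1 F (G t')) ->
    {for t, continuous G} -> {for t, continuous (derive1 F)}.
  move=> tI DF cG.
  have eqd t' : In t' -> G t' = derive1 F t' by move=> /DF[_]; rewrite derive1E => ->.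
  rewrite /prop_for /continuous_at -eqd//; apply: cvg_trans cG; apply: near_eq_cvg.
  by apply: filterS (nIn t tI) => t' /eqd.
have cline' k (t : R) : {for t, continuous (fun t => Re (line' t 0 k) : R^o)} /\
    {for t, continuous (fun t => Im (line' t 0 k) : R^o)}.
  have [h1 h2] := torus_line_continuous U w1' w2' a b k (s + (s' - s) * t).
  by split; [apply: continuous_comp (affc t) h1|apply: continuous_comp (affc t) h2].
exists h; split.
- split=> [t tI|k].
    have [cg _] := Hg _ (rng t tI).
    by apply: continuous_comp; [exact: affc|exact: cg].
  split=> t /rng tI; have [c1 c2] := cline' k t.
    split; first by have [] := DR t k tI.
    by apply: (cont _ _ t tI _ c1) => t'; exact: DR.
  split; first by have [] := DI t k tI.
  by apply: (cont _ _ t tI _ c2) => t'; exact: DI.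
- by rewrite /h mulr0 addr0.
- by rewrite /h mulr1 addrC subrK.
- rewrite /curve_length (_ : \int[_]_(_ in _) _ = Num.sqrt ((a ^+ 2 + b ^+ 2) / 2) * `|s' - s|)//.
  rewrite (@eq_Rintegral _ _ R lebesgue_measure `[0, 1]%classic
    (fun=> Num.sqrt ((a ^+ 2 + b ^+ 2) / 2) * `|s' - s|)).
    rewrite Rintegral_cst//= lebesgue_measure_itv/= lte_fin ltr01.
    by rewrite sube0 mulr1.
  move=> t /set_mem/rng tI.
  rewrite -(torus_line_velocity_norm (s' - s) (s + (s' - s) * t)) -/w1' -/w2' -/(line' t).
  congr norm2; apply/rowP => k; rewrite mxE !derive1E.
  by have [_ ->] := DR t k tI; have [_ ->] := DI t k tI; apply: complex_eq.
Qed.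

End LiftedLines.

(** * Local inverses of the immersion into the torus *)

Section LocalLift.
Variables (R : realType) (M : topologicalType) (S : immersed_surface R M).
Variables (U : 'M[R[i]]_2).
Hypothesis uU : U \is unitarymx.
Local Notation torus := (unitary_image U (clifford_torus R)).
Hypothesis ST : forall p, torus (S p).

Lemma unitary_rows : unitary_frame (row 0 U) (row 1 U).
Proof.
have /unitarymxP/matrixP UU := uU.
have H i j : hprod (row i U) (row j U) = (i == j)%:R.
  by have := UU i j; rewrite mulmx2 hprodE !mxE.
by split; rewrite H.
Qed.

(** [A] and [B] are the components of [z] along the rows of [U]. On the torus the products with [A]
    and with [B] run over circles of radius 1/2, and together they determine the point. *)
Lemma torus_split z : torus z -> exists A B : C2 R,
  [/\ z = A + B, hprod A A = 2^-1, hprod B B = 2^-1, hprod A B = 0 &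
   (forall w, torus w -> hprod w A * (hprod w A)^*%C = 4^-1 /\ hprod w B * (hprod w B)^*%C = 4^-1)
   /\ (forall w w', hprod w A = hprod w' A -> hprod w B = hprod w' B -> w = w')].
Proof.
have fr := unitary_rows; case: (fr) => uu vv uv.
have vu : hprod (row 1 U) (row 0 U) = 0 by rewrite -hprodJ uv conjc0.
have rowsE (w : C2 R) : w *m U = w 0 0 *: row 0 U + w 0 1 *: row 1 U.
  by apply/rowP => k; rewrite mulmx2 !mxE.
have hZr (w x : C2 R) k : hprod w (k *: x) = k^*%C * hprod w x.
  by have := hprodDr x x w k 0; rewrite scale0r addr0 conjc0 mul0r addr0.
have hZl (w x : C2 R) k : hprod (k *: w) x = k * hprod w x.
  by have := hprodDl w w x k 0; rewrite scale0r addr0 mul0r addr0.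
case=> w0 /clifford_torusE[h0 h1] <-.
exists (w0 0 0 *: row 0 U), (w0 0 1 *: row 1 U).
have n0 : (w0 0 0)^*%C != 0.
  by rewrite conjc_eq0; apply: contra_eq_neq h0 => ->; rewrite mul0r eq_sym invr_eq0 pnatr_eq0.
have n1 : (w0 0 1)^*%C != 0.
  by rewrite conjc_eq0; apply: contra_eq_neq h1 => ->; rewrite mul0r eq_sym invr_eq0 pnatr_eq0.
have h4 : 4^-1 = 2^-1 * 2^-1 :> R[i] by rewrite -invfM -natrM.
split.
- by rewrite rowsE.
- by rewrite hZl hZr uu mulr1.
- by rewrite hZl hZr vv mulr1.
- by rewrite hZl hZr uv !mulr0.
split.
  move=> _ [w /clifford_torusE[k0 k1] <-].
  rewrite rowsE !hZr !hprodDl uu uv vu vv !mulr0 addr0 add0r !mulr1 !conjcM !conjcK h4.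
  split; [rewrite -[X in _ = X * _]h0 -k0|rewrite -[X in _ = X * _]h1 -k1]; ring.
move=> w w'; rewrite !hZr => /(mulfI n0) e0 /(mulfI n1) e1.
by rewrite (frame_expand w fr) (frame_expand w' fr) e0 e1.
Qed.

Lemma torus_line_torus w1 w2 a b u : w1 * w1^*%C = 2^-1 -> w2 * w2^*%C = 2^-1 ->
  torus (torus_line U w1 w2 a b u).
Proof.
move=> h1 h2; eexists; last by rewrite /torus_line.
apply/clifford_torusE; rewrite !mxE /= !conjcM.
by split; rewrite mulrACA cis_normed mulr1.
Qed.

Lemma diffC2_cst (v : C2 R) x : diffC2 (fun=> v) x.
Proof. by move=> k; split; exact: differentiable_cst. Qed.

Lemma pdiff_cst (v : C2 R) j x : pdiff j (fun=> v) x = 0.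
Proof. by apply/rowP => k; rewrite pdiffE !derive_cst mxE. Qed.

Lemma is_derive_inner_cst (F : 'rV[R]_2 -> C2 R) (v : C2 R) x j : diffC2 F x ->
  is_derive x (delta_mx 0 j) (fun y => inner (F y) v : R^o) (inner (pdiff j F x) v).
Proof.
move=> dF; apply: (is_derive_eq (is_derive_inner j dF (diffC2_cst v x))).
by rewrite pdiff_cst [inner (F x) 0]innerE !mxE /= !mulr0 !addr0.
Qed.

Lemma smooth_inner_cst A (F : 'rV[R]_2 -> C2 R) (v : C2 R) : open A -> smoothC2 A F ->
  smooth A (fun y => inner (F y) v : R^o).
Proof.
move=> oA sF; rewrite (_ : (fun y => _) = fun y =>
    1 * (Re (v 0 0) * Re (F y 0 0) + Im (v 0 0) * Im (F y 0 0)) +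
    1 * (Re (v 0 1) * Re (F y 0 1) + Im (v 0 1) * Im (F y 0 1))); last first.
  by apply/funext => y; rewrite innerE; ring.
have [r0 i0] := sF 0; have [r1 i1] := sF 1.
by apply: smooth_comb => //; exact: smooth_comb.
Qed.

(** The imaginary parts of (z, A) and (z, B): half the sines of the two angles measured from A + B.
    They are coordinates on the part of the torus where both real parts are positive. *)
Definition torus_coord (A B z : C2 R) : 'rV[R]_2 :=
  \row_i (if i == 0 then inner z ('i%C *: A) else inner z ('i%C *: B)).

Lemma torus_coord_inj A B z z' : 
  (forall w, torus w -> hprod w A * (hprod w A)^*%C = 4^-1 /\ hprod w B * (hprod w B)^*%C = 4^-1) ->
  (forall w w', hprod w A = hprod w' A -> hprod w B = hprod w' B -> w = w') ->
  torus z -> torus z' -> 0 < inner z A -> 0 < inner z' A -> 0 < inner z B -> 0 < inner z' B ->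
  torus_coord A B z = torus_coord A B z' -> z = z'.
Proof.
move=> hN hI Tz Tz' zA z'A zB z'B /rowP E; have := E 0; have := E 1; rewrite !mxE /= => EB EA.
have key (X Y : C2 R) (C : C2 R) : 0 < inner X C -> 0 < inner Y C ->
    inner X ('i%C *: C) = inner Y ('i%C *: C) ->
    hprod X C * (hprod X C)^*%C = 4^-1 -> hprod Y C * (hprod Y C)^*%C = 4^-1 ->
    hprod X C = hprod Y C.
  move=> X0 Y0 e hX hY; rewrite !hprod_inner e in hX hY *; congr (Complex _ _).
  have := etrans hX (esym hY) => /(congr1 (@complex.Re R)); rewrite !ReM !ReJ !ImJ /= => h.
  apply/eqP; rewrite -(eqrXn2 (n := 2)) ?ltW//; apply/eqP; rewrite !expr2; lra.
have [[a1 b1] [a2 b2]] := (hN _ Tz, hN _ Tz').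
by apply: hI; exact: key.
Qed.

(** A vector killed by both coordinate differentials is killed by the differential of F, because the
    real parts of its products with A and B vanish by tangency to the torus. The immersion property
    then makes it zero. *)
Lemma torus_coord_jacobian A B c x (F := local_param S c) : atlas S c -> codom c x ->
  F x = A + B -> hprod A A = 2^-1 -> hprod B B = 2^-1 -> hprod A B = 0 ->
  (forall w, torus w -> hprod w A * (hprod w A)^*%C = 4^-1 /\ hprod w B * (hprod w B)^*%C = 4^-1) ->
  (forall w w', hprod w A = hprod w' A -> hprod w B = hprod w' B -> w = w') ->
  inner (pdiff 0 F x) ('i%C *: A) * inner (pdiff 1 F x) ('i%C *: B) -
  inner (pdiff 1 F x) ('i%C *: A) * inner (pdiff 0 F x) ('i%C *: B) != 0.
Proof.
move=> Sc cx FAB AA BB AB hN hI.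
have BA : hprod B A = 0 by rewrite -hprodJ AB conjc0.
have dF : diffC2 F x by apply: smoothC2_diff cx; exact: local_param_smooth.
have rA : inner (F x) A = 2^-1 /\ inner (F x) ('i%C *: A) = 0.
  have : hprod (F x) A = 2^-1.
    by have := hprodDl A B A 1 1; rewrite !scale1r FAB AA BA mulr0 addr0 mul1r.
  have -> : 2^-1 = (2^-1)%:C%C :> R[i] by rewrite fmorphV /= rmorph_nat.
  by rewrite hprod_inner => -[-> ->].
have rB : inner (F x) B = 2^-1 /\ inner (F x) ('i%C *: B) = 0.
  have : hprod (F x) B = 2^-1.
    by have := hprodDl A B B 1 1; rewrite !scale1r FAB BB AB mulr0 add0r mul1r.
  have -> : 2^-1 = (2^-1)%:C%C :> R[i] by rewrite fmorphV /= rmorph_nat.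
  by rewrite hprod_inner => -[-> ->].
(* The squared modulus of (F, C) is constantly 1/4; where (F, C) equals the real number 1/2, its
   derivative is the real part alone. *)
have tangential (C : C2 R) j : inner (F x) C = 2^-1 /\ inner (F x) ('i%C *: C) = 0 ->
    (forall w, torus w -> hprod w C * (hprod w C)^*%C = 4^-1) -> inner (pdiff j F x) C = 0.
  move=> [r1 r2] hC.
  have D1 := is_derive_inner_cst C j dF; have D2 := is_derive_inner_cst ('i%C *: C) j dF.
  have D := is_derive_comb 1 1 (is_derive_prod D1 D1) (is_derive_prod D2 D2).
  have ocod : open (codom c) by exact: codom_open.
  have := is_derive_cst_on (a := 4^-1) ocod cx _ D.
  rewrite r1 r2 => H; apply: (mulfI (x := 1)); first exact: oner_neq0.
  rewrite mul1r mulr0 -[RHS]H; last first.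
    move=> y cy; have := hC _ (ST (param c y)); rewrite hprod_inner.
    have -> : 4^-1 = (4^-1)%:C%C :> R[i] by rewrite fmorphV /= rmorph_nat.
    by move/(congr1 (@complex.Re R)); rewrite ReM ReJ ImJ /= => <-; rewrite /F /local_param /=; ring.
  by field.
have tA j := tangential A j rA (fun w Tw => (hN w Tw).1).
have tB j := tangential B j rB (fun w Tw => (hN w Tw).2).
have kernel (v0 v1 : R) :
    v0 * inner (pdiff 0 F x) ('i%C *: A) + v1 * inner (pdiff 1 F x) ('i%C *: A) = 0 ->
    v0 * inner (pdiff 0 F x) ('i%C *: B) + v1 * inner (pdiff 1 F x) ('i%C *: B) = 0 ->
    v0 = 0 /\ v1 = 0.
  move=> kA kB; pose v : 'rV[R]_2 := \row_i (if i == 0 then v0 else v1).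
  have dv C : inner (differentialC2 F x v) C =
      v0 * inner (pdiff 0 F x) C + v1 * inner (pdiff 1 F x) C.
    rewrite differentialE !mxE [(0 == 0)]/= [(1 == 0)]/= innerDl.
    by rewrite inner_scalel [inner (v1%:C%C *: _) _]inner_scalel /= !mul0r !addr0.
  have h0 C : hprod (0 : C2 R) C = 0 by rewrite hprodE !mxE !mul0r addr0.
  have d0 : differentialC2 F x v = 0.
    by apply: hI; rewrite h0 hprod_inner !dv ?kA ?kB ?(tA 0) ?(tA 1) ?(tB 0) ?(tB 1) !mulr0 !addr0.
  have d0' : differentialC2 F x 0 = 0 by rewrite differentialE !mxE !scale0r addr0.
  have /rowP E := immersion_injective_differential Sc cx (etrans d0 (esym d0')).
  by have := E 0; have := E 1; rewrite !mxE.
apply/eqP; move: kernel.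
move: (inner (pdiff 0 F x) ('i%C *: A)) (inner (pdiff 1 F x) ('i%C *: A))
  (inner (pdiff 0 F x) ('i%C *: B)) (inner (pdiff 1 F x) ('i%C *: B)) => p q r s kernel det0.
(* If the determinant vanishes, (q, -p) and (s, -r) lie in the kernel, so all entries are zero and
   (1, 0) would lie in it as well. *)
have [||q0 /eqP] := kernel q (- p); [ring|lra|rewrite oppr_eq0 => /eqP p0].
have [||s0 /eqP] := kernel s (- r); [lra|ring|rewrite oppr_eq0 => /eqP r0].
by have [||/eqP] := kernel 1 0; [lra|lra|rewrite oner_eq0].
Qed.

(** [sigma] inverts the torus coordinates through a chart of the surface. The positivity conditions
    select the half circles on which a point is determined by its coordinates, so that [sigma]
    really lifts points of the torus. *)
Lemma local_section p : exists A B (sigma : 'rV[R]_2 -> M),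
  [/\ inner (S p) A = 2^-1, inner (S p) B = 2^-1,
   \forall y \near torus_coord A B (S p), {for y, continuous sigma} /\
     forall z, torus z -> 0 < inner z A -> 0 < inner z B -> torus_coord A B z = y ->
       S (sigma y) = z &
   \forall q \near p, sigma (torus_coord A B (S q)) = q].
Proof.
have [c Sc cp] := atlas_cover S p; set x := coord c p.
have cx : codom c x by exact: coord_codom.
have [A [B [SAB AA BB AB [hN hI]]]] := torus_split (ST p).
pose F := local_param S c.
have Fx : F x = S p by rewrite /F /local_param /= coordK.
have ocod : open (codom c) by exact: codom_open.
have sF : smoothC2 (codom c) F by exact: local_param_smooth.
have dF : diffC2 F x by exact: smoothC2_diff cx.
have jac := torus_coord_jacobian Sc cx (etrans Fx SAB) AA BB AB hN hI.
have sA := smooth_inner_cst ('i%C *: A) ocod sF.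
have sB := smooth_inner_cst ('i%C *: B) ocod sF.
have [|H [nH1 nH2]] := inverse_function ocod cx sA sB.
  have DA j : 'D_(delta_mx 0 j) (fun y => inner (F y) ('i%C *: A) : R^o) x = _ :=
    derive_val (is_derive := is_derive_inner_cst ('i%C *: A) j dF).
  have DB j : 'D_(delta_mx 0 j) (fun y => inner (F y) ('i%C *: B) : R^o) x = _ :=
    derive_val (is_derive := is_derive_inner_cst ('i%C *: B) j dF).
  by rewrite !DA !DB.
exists A, B, (param c \o H).
have {}nH1 : \forall y \near torus_coord A B (S p), [/\ codom c (H y),
    torus_coord A B (F (H y)) = y & {for y, continuous H}] by rewrite -Fx.
have {}nH2 : \forall y \near x, H (torus_coord A B (F y)) = y by [].
have HGx : H (torus_coord A B (S p)) = x by rewrite -Fx; exact: nbhs_singleton nH2.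
have rp (C : C2 R) : hprod (S p) C = 2^-1 -> inner (S p) C = 2^-1.
  have -> : 2^-1 = (2^-1)%:C%C :> R[i] by rewrite fmorphV /= rmorph_nat.
  by rewrite hprod_inner => -[].
have pA : inner (S p) A = 2^-1.
  by apply: rp; have := hprodDl A B A 1 1; rewrite !scale1r -SAB AA -(hprodJ A B) AB conjc0 mulr0 addr0 mul1r.
have pB : inner (S p) B = 2^-1.
  by apply: rp; have := hprodDl A B B 1 1; rewrite !scale1r -SAB BB AB mulr0 add0r mul1r.
have half0 : 0 < 2^-1 :> R by rewrite invr_gt0.
have posn (C : C2 R) : inner (S p) C = 2^-1 ->
    \forall y \near torus_coord A B (S p), 0 < inner (F (H y)) C.
  move=> pC; have [_ _ cH] := nbhs_singleton nH1.
  have cF : {for H (torus_coord A B (S p)), continuous (fun z => inner (F z) C : R^o)}.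
    by rewrite HGx; apply: smooth_continuous cx; exact: smooth_inner_cst.
  have cHF : {for torus_coord A B (S p), continuous (fun y => inner (F (H y)) C : R^o)} :=
    continuous_comp cH cF.
  move/cvgrPdist_lt : cHF => /(_ _ half0).
  by apply: filterS => y; rewrite HGx Fx pC ltr_norml => /andP[_]; lra.
split=> //.
- apply: filterS3 nH1 (posn A pA) (posn B pB) => y [Hy Gy cHy] yA yB; split.
    by apply: continuous_comp; [exact: cHy|exact: param_continuous].
  move=> z Tz zA zB zy; rewrite /=.
  apply: (torus_coord_inj hN hI (ST (param c (H y))) Tz yA zA yB zB).
  exact: etrans Gy (esym zy).
- have nd : \forall q \near p, dom c q by apply: open_nbhs_nbhs; split=> //; exact: dom_open.
  have nq : \forall q \near p, H (torus_coord A B (F (coord c q))) = coord c q := Defs.coord_continuous cp nH2.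
  apply: filterS2 nd nq => q cq; rewrite /F /local_param /= coordK// => ->.
  by rewrite coordK.
Qed.

End LocalLift.

(** * Lifting a whole line to a complete surface *)

Section CompleteLift.
Variables (R : realType) (M : topologicalType) (S : immersed_surface R M).
Variables (U : 'M[R[i]]_2).
Hypothesis uU : U \is unitarymx.
Local Notation torus := (unitary_image U (clifford_torus R)).
Hypothesis ST : forall p, torus (S p).
Variables (w1 w2 : R[i]) (a b : R).
Hypotheses (hw1 : w1 * w1^*%C = 2^-1) (hw2 : w2 * w2^*%C = 2^-1).
Local Notation line := (torus_line U w1 w2 a b).
Local Notation lifted := (lifts S U w1 w2 a b).

Lemma line_inner_continuous (v : C2 R) (u : R) :
  {for u, continuous (fun u : R => inner (line u) v : R^o)}.
Proof.
rewrite (_ : (fun u : R => _) = fun u => Re (line u 0 0) * Re (v 0 0) + Im (line u 0 0) * Im (v 0 0) +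
   (Re (line u 0 1) * Re (v 0 1) + Im (line u 0 1) * Im (v 0 1))); last first.
  by apply/funext => z; rewrite innerE.
have [r0 i0] := torus_line_continuous U w1 w2 a b 0 u.
have [r1 i1] := torus_line_continuous U w1 w2 a b 1 u.
by apply: continuousD; apply: continuousD; apply: continuousM => //; exact: cvg_cst.
Qed.

(** The second clause is a local uniqueness: a lift through a limit point passes through all nearby
    points that lie over the line. *)
Lemma lift_near p (t : R) : S p = line t -> exists g : R -> M,
  (\forall u \near t, lifted g u) /\
  (\forall q \near p, forall u, S q = line u -> g u = q).
Proof.
move=> pt; have [A [B [sigma [pA pB ns nq]]]] := local_section uU ST p.
have cc (u : R) : {for u, continuous (fun u : R => torus_coord A B (line u))}.
  by apply: continuous_row => i; case: (i == 0); exact: line_inner_continuous.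
exists (sigma \o (fun u => torus_coord A B (line u))); split; last first.
  by apply: filterS nq => q hq u E; rewrite /= -E.
have half0 : 0 < 2^-1 :> R by rewrite invr_gt0.
have posn (C : C2 R) : inner (S p) C = 2^-1 -> \forall u \near t, 0 < inner (line u) C.
  move=> pC.
  have cl : {for t, continuous (fun u : R => inner (line u) C : R^o)} by exact: line_inner_continuous.
  move/cvgrPdist_lt : cl => /(_ _ half0).
  by apply: filterS => u; rewrite -pt pC ltr_norml => /andP[_]; lra.
have nt : \forall u \near t, {for torus_coord A B (line u), continuous sigma} /\
     forall z, torus z -> 0 < inner z A -> 0 < inner z B ->
       torus_coord A B z = torus_coord A B (line u) -> S (sigma (torus_coord A B (line u))) = z.
  by rewrite pt in ns; exact: (cc t _ ns).
apply: filterS3 nt (posn A pA) (posn B pB) => u [cs hz] uA uB; split.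
  by apply: continuous_comp; [exact: cc|exact: cs].
by apply: hz => //; exact: torus_line_torus.
Qed.

Lemma immersion_continuous p k :
  {for p, continuous (fun q => Re (S q 0 k) : R^o)} /\
  {for p, continuous (fun q => Im (S q 0 k) : R^o)}.
Proof.
have [c Sc cp] := atlas_cover S p.
have cx : codom c (coord c p) by exact: coord_codom.
have [sR sI] := local_param_smooth Sc k.
have nd : \forall q \near p, dom c q by apply: open_nbhs_nbhs; split=> //; exact: dom_open.
have H (f : C2 R -> R) : {for coord c p, continuous (fun x => f (local_param S c x) : R^o)} ->
    {for p, continuous (fun q => f (S q) : R^o)}.
  move=> cf; have := continuous_comp (Defs.coord_continuous cp) cf.
  rewrite /prop_for /continuous_at /= /local_param /= coordK// => h.
  apply: cvg_trans h; apply: near_eq_cvg; apply: filterS nd => q cq /=.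
  by rewrite /local_param /= coordK.
split; [apply: (H (fun z => Re (z 0 k)))|apply: (H (fun z => Im (z 0 k)))].
  exact: smooth_continuous sR cx.
exact: smooth_continuous sI cx.
Qed.

Lemma immersion_limit (u : nat -> M) (tau : nat -> R) p (t : R) :
  u @ \oo --> p -> tau @ \oo --> t -> (forall n, S (u n) = line (tau n)) -> S p = line t.
Proof.
move=> up tt E; apply/rowP => k.
have [cR cI] := immersion_continuous p k.
have [lR lI] := torus_line_continuous U w1 w2 a b k t.
have key (f : C2 R -> R) : {for p, continuous (fun q => f (S q) : R^o)} ->
    {for t, continuous (fun u : R => f (line u) : R^o)} -> f (S p) = f (line t).
  move=> cf cl.
  have h1 : (fun n => f (S (u n)) : R^o) @ \oo --> (f (S p) : R^o) := cvg_comp _ _ up cf.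
  have h2 : (fun n => f (line (tau n)) : R^o) @ \oo --> (f (line t) : R^o) := cvg_comp _ _ tt cl.
  have EE : (fun n => f (S (u n)) : R^o) = (fun n => f (line (tau n)) : R^o).
    by apply/funext => n; rewrite E.
  by rewrite EE in h1; apply: cvg_unique h1 h2.
apply: complex_eq.
  exact: (key (fun z => Re (z 0 k))).
exact: (key (fun z => Im (z 0 k))).
Qed.

(** The margin [e] beyond both ends allows concatenation with other lifts and makes the end points
    interior, as [lift_dist] requires. *)
Definition reach (x y : R * M) : Prop := x.1 <= y.1 /\ exists (g : R -> M) (e : R),
  [/\ 0 < e, forall u, x.1 - e < u < y.1 + e -> lifted g u, g x.1 = x.2 & g y.1 = y.2].

Lemma lift_on p (t : R) : S p = line t -> exists (g : R -> M) (e : R),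
  [/\ 0 < e, forall u, t - e < u < t + e -> lifted g u, g t = p &
      \forall q \near p, forall u, S q = line u -> g u = q].
Proof.
move=> pt; have [g [ng nq]] := lift_near pt.
have [e /= e0 he] := ng; exists g, e; split=> //; last exact: nbhs_singleton nq _ pt.
move=> u /andP[u1 u2]; apply: he; rewrite /= ltr_norml; apply/andP; split; lra.
Qed.

Lemma reach_on (g : R -> M) (lo hi u v : R) : (forall s, lo < s < hi -> lifted g s) ->
  lo < u -> u <= v -> v < hi -> reach (u, g u) (v, g v).
Proof.
move=> hg lu uv vh; split=> //=.
exists g, (Num.min (u - lo) (hi - v)); split=> //.
  by rewrite lt_min !subr_gt0 lu.
move=> s /andP[s1 s2]; apply: hg.
have h1 : Num.min (u - lo) (hi - v) <= u - lo by rewrite ge_min lexx.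
have h2 : Num.min (u - lo) (hi - v) <= hi - v by rewrite ge_min lexx orbT.
by apply/andP; split; lra.
Qed.

Lemma reach_trans x y z : reach x y -> reach y z -> reach x z.
Proof.
move=> [xy [g [e [e0 hg gx gy]]]] [yz [h [f [f0 hh hy hz]]]]; split; first exact: le_trans xy yz.
pose k u := if u <= y.1 then g u else h u.
exists k, (Num.min e f); split.
- by rewrite lt_min e0.
- move=> u /andP[u1 u2].
  have h1 : Num.min e f <= e by rewrite ge_min lexx.
  have h2 : Num.min e f <= f by rewrite ge_min lexx orbT.
  have [uy|uy|uy] := ltgtP u y.1.
  + have [cg Sg] : lifted g u by apply: hg; apply/andP; split; lra.
    split; last by rewrite /k (ltW uy).
    rewrite /prop_for /continuous_at /k (ltW uy); apply: cvg_trans cg; apply: near_eq_cvg.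
    by apply: filterS (lt_nbhsl uy) => v vy; rewrite /k (ltW vy).
  + have [cg Sg] : lifted h u by apply: hh; apply/andP; split; lra.
    split; last by rewrite /k leNgt uy.
    rewrite /prop_for /continuous_at /k leNgt uy; apply: cvg_trans cg; apply: near_eq_cvg.
    by apply: filterS (lt_nbhsr uy) => v vy; rewrite /k leNgt vy.
  + have [cg Sg] : lifted g u by apply: hg; apply/andP; split; lra.
    have [ch Sh] : lifted h u by apply: hh; apply/andP; split; lra.
    split; last by rewrite /k; case: ifP.
    have ku : k u = y.2 by rewrite /k uy lexx gy.
    (* At the junction the two lifts need not agree nearby; continuity of both at the common value
       suffices. *)
    rewrite /prop_for /continuous_at ku => V nV.
    have n1 : \forall v \near u, V (g v) by apply: cg; rewrite uy gy.
    have n2 : \forall v \near u, V (h v) by apply: ch; rewrite uy hy.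
    by apply: filterS2 n1 n2 => v v1 v2; rewrite /k /=; case: ifP.
- by rewrite /k xy.
- rewrite /k; case: ifP => // zy; have E : z.1 = y.1 by apply/le_anti; rewrite zy yz.
  by rewrite -hz E gy hy.
Qed.

Lemma reach_lift x y : reach x y -> S x.2 = line x.1 /\ S y.2 = line y.1.
Proof.
move=> [xy [g [e [e0 hg <- <-]]]].
have [|_ ->] := hg x.1; first by apply/andP; split; lra.
by have [|_ ->] := hg y.1; first by apply/andP; split; lra.
Qed.

Lemma reach_dist x y (e : R) : reach x y ->
  Num.sqrt ((a ^+ 2 + b ^+ 2) / 2) * (y.1 - x.1) < e ->
  dist_lt S x.2 y.2 e /\ dist_lt S y.2 x.2 e.
Proof.
move=> [xy [g [d [d0 hg <- <-]]]] lt_e.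
have rx : x.1 - d < x.1 < y.1 + d by apply/andP; split; lra.
have ry : x.1 - d < y.1 < y.1 + d by apply/andP; split; lra.
have n : `|y.1 - x.1| = y.1 - x.1 by rewrite ger0_norm// subr_ge0.
split; apply: (lift_dist uU hw1 hw2 hg) => //; last rewrite distrC.
  by rewrite n.
by rewrite n.
Qed.

(* A step at least half as long as possible replaces a maximal lift, whose
   existence would require the uniqueness of lifts. *)
Lemma greedy_reach x : S x.2 = line x.1 -> x.1 <= 1 ->
  exists y, [/\ reach x y, y.1 <= 1 &
    forall z, reach x z -> z.1 <= 1 -> z.1 - x.1 <= 2 * (y.1 - x.1)].
Proof.
case: x => t p /= pt t1; pose x := (t, p).
have rx : reach x x.
  rewrite /x; have [g [e [e0 hg <- _]]] := lift_on pt.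
  by apply: (@reach_on g (t - e) (t + e)) => //; lra.
pose E : set R := [set s | exists2 z, reach x z & s = z.1 /\ s <= 1].
have Et : E t by exists x.
have hsE : has_sup E by split; [exists t|exists 1 => s [z _ []]].
have tE : t <= sup E by exact: (ub_le_sup hsE.2).
have zE z : reach x z -> z.1 <= 1 -> z.1 <= sup E.
  by move=> xz z1; apply: (ub_le_sup hsE.2); exists z.
(* If no lift goes beyond [t], staying at [x] satisfies the bound; otherwise an end time within half
   the gap of the supremum does. *)
have [stE|] := leP (sup E) t.
  by exists x; split=> // z xz z1; have := zE _ xz z1; rewrite /x /=; lra.
move=> ltE; have [s [y xy [-> y1]]] := @sup_adherent _ E ((sup E - t) / 2) ltac:(lra) hsE.
by move=> hy; exists y; split=> // z xz z1; have := zE _ xz z1; rewrite /= in hy *; lra.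
Qed.

Lemma complete_lift p0 : complete_surface S -> S p0 = line 0 -> exists p1, S p1 = line 1.
Proof.
move=> cS S0; pose good (x : R * M) := S x.2 = line x.1 /\ x.1 <= 1.
have [next nextP] : {next : R * M -> R * M & forall x, good x -> [/\ reach x (next x), (next x).1 <= 1 &
    forall z, reach x z -> z.1 <= 1 -> z.1 - x.1 <= 2 * ((next x).1 - x.1)]}.
  apply: (@choice _ _ (fun x y => good x -> [/\ reach x y, y.1 <= 1 &
    forall z, reach x z -> z.1 <= 1 -> z.1 - x.1 <= 2 * (y.1 - x.1)])) => x.
  have [gx|ngx] := pselect (good x); last by exists x.
  by have [y hy] := greedy_reach gx.1 gx.2; exists y.
pose x n := iter n next (0, p0).
have gx n : good (x n).
  elim: n => [|n gn]; first by split=> /=; [|lra].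
  by have [r le1 _] := nextP _ gn; split=> //; have [] := reach_lift r.
have rS n : reach (x n) (x n.+1) by have [] := nextP _ (gx n).
have rx m n : (m <= n)%N -> reach (x m) (x n).
  elim: n => [|n IH].
    rewrite leqn0 => /eqP ->; have [g [e [e0 hg g0 _]]] := lift_on S0.
    by have := reach_on (u := 0) (v := 0) hg; rewrite g0; apply; lra.
  rewrite leq_eqVlt => /orP[/eqP ->|mn]; last by apply: reach_trans (rS n); exact: IH.
  have [Sx _] := gx n.+1; have [g [e [e0 hg g0 _]]] := lift_on Sx.
  have := reach_on (u := (x n.+1).1) (v := (x n.+1).1) hg; rewrite g0.
  by case: (x n.+1) => ? ? /=; apply; lra.
pose tau n := (x n).1; pose u n := (x n).2.
have tau_nd : nondecreasing_seq tau by move=> m n /rx[].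
have tau_ub : has_ubound (range tau) by exists 1 => _ [n _ <-]; exact: (gx n).2.
have ctau : cvgn tau by exact: nondecreasing_is_cvgn.
have tau_le n : tau n <= limn tau by exact: nondecreasing_cvgn_le.
set K := Num.sqrt ((a ^+ 2 + b ^+ 2) / 2).
have K0 : 0 <= K by exact: sqrtr_ge0.
have tau_near (e : R) : 0 < e -> \forall n \near \oo, limn tau - e < tau n.
  move=> e0; have : tau @ \oo --> limn tau by [].
  move/cvgrPdist_lt => /(_ _ e0); apply: filterS => n; rewrite ltr_norml => /andP[_]; lra.
have [p up] : exists p : M, u @ \oo --> p.
  apply: cS => e e0.
  (* The speed [K] is zero for a constant line, hence the denominator [K + 1]. *)
  have d0 : 0 < e / (K + 1) by apply: divr_gt0 => //; lra.
  have [N _ hN] := tau_near _ d0; exists N.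
  have key m n : (N <= m)%N -> (m <= n)%N -> dist_lt S (u m) (u n) e /\ dist_lt S (u n) (u m) e.
    move=> Nm mn; apply: reach_dist (rx _ _ mn) _.
    have hm : limn tau - e / (K + 1) < tau m := hN m Nm.
    have := tau_le n; have := tau_nd _ _ mn; rewrite -/K -/(tau n) -/(tau m) => h1 h2.
    have h3 : tau n - tau m < e / (K + 1) by lra.
    have h4 : 0 <= tau n - tau m by lra.
    move: h3; rewrite ltr_pdivlMr; last by lra.
    by have [->|] := eqVneq (tau n - tau m) 0; [rewrite mulr0|]; nra.
  move=> m n Nm Nn; have [mn|/ltnW nm] := leqP m n; first by have [] := key m n Nm mn.
  by have [] := key n m Nn nm.
have Sp : S p = line (limn tau) by apply: immersion_limit up ctau _ => n; exact: (gx n).1.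
have [g [e [e0 hg gp nq]]] := lift_on Sp.
have e40 : 0 < e / 4 by lra.
have nun : \forall n \near \oo, forall s, S (u n) = line s -> g s = u n := up _ nq.
have [n [gu hn]] : exists n, g (tau n) = u n /\ limn tau - e / 4 < tau n.
  have [N _ hN] : \forall n \near \oo, g (tau n) = u n /\ limn tau - e / 4 < tau n.
    by apply: filterS2 nun (tau_near _ e40) => n h1 h2; split=> //; apply: h1; exact: (gx n).1.
  by exists N; apply: hN => /=.
have tn1 : tau n <= 1 := (gx n).2.
(* The lift through the limit point passes through [u n] at time [tau n], so it carries the sequence
   beyond its limit time, unless time 1 comes first. *)
pose s := Num.min (limn tau + e / 2) 1.
have s1 : s <= 1 by rewrite ge_min lexx orbT.
have se : s <= limn tau + e / 2 by rewrite ge_min lexx.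
have ts : tau n <= s by rewrite le_min tn1 andbT; have := tau_le n; lra.
have rs : reach (x n) (s, g s).
  have := reach_on (u := tau n) (v := s) hg; rewrite gu (_ : (tau n, u n) = x n); last first.
    by rewrite /tau /u; case: (x n).
  by apply; lra.
have [_ _ /(_ _ rs s1)] := nextP _ (gx n).
rewrite -/(x n.+1) -/(tau n) -/(tau n.+1) /= => h.
(* By the greedy bound s is at most 2 tau (n+1) - tau n, which is less than the limit plus e/4. So
   the minimum defining [s] is 1. *)
have st : s < limn tau + e / 2 by have := tau_le n.+1; lra.
have E1 : s = 1 by move: st; rewrite /s minElt; case: ifP => //; rewrite ltxx.
by exists (g s); rewrite -E1; have [_ ->] := reach_lift rs.
Qed.

End CompleteLift.

(** * Joining two points of the torus by a line *)

Section Surjectivity.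
Variables (R : realType).

Lemma cis_angle (w : R[i]) : w * w^*%C = 1 -> exists2 t, - pi <= t <= pi & w = cis t.
Proof.
move=> /(congr1 (@complex.Re R)); rewrite ReM ReJ ImJ /= mulrN opprK -!expr2 => h.
have rng : -1 <= Re w <= 1.
  by have := sqr_ge0 (Im w); move: h; rewrite !expr2 => h1 h2; apply/andP; split; nra.
have E : 1 - Re w ^+ 2 = Im w ^+ 2 by rewrite -h addrAC subrr add0r.
have [i0|i0] := leP 0 (Im w).
  exists (acos (Re w)).
    by rewrite acos_lepi// andbT (le_trans _ (acos_ge0 rng))// oppr_le0 pi_ge0.
  apply: complex_eq => /=; first by rewrite acosK.
  by rewrite sin_acos// E sqrtr_sqr ger0_norm.
exists (- acos (Re w)).
  by rewrite lerN2 acos_lepi//= (le_trans _ (pi_ge0 R))// oppr_le0 acos_ge0.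
apply: complex_eq => /=; first by rewrite cosN acosK.
by rewrite sinN sin_acos// E sqrtr_sqr ltr0_norm// opprK.
Qed.

Lemma rotate_to (z w : R[i]) : z * z^*%C = 2^-1 -> w * w^*%C = 2^-1 ->
  exists2 t, - pi <= t <= pi & w = z * cis t.
Proof.
move=> hz hw; have n2 : 2 != 0 :> R[i] by rewrite pnatr_eq0.
have [|t ht E] := @cis_angle (2 * (w * z^*%C)).
  rewrite !conjcM conjcK (_ : 2^*%C = 2 :> R[i]); last exact: (rmorph_nat (@conjc R) 2).
  rewrite (_ : _ * _ = 4 * ((w * w^*%C) * (z * z^*%C))); last by ring.
  by rewrite hw hz; field.
exists t; rewrite // -E (_ : z * _ = 2 * ((z * z^*%C) * w)); last by ring.
by rewrite hz mulrA divff// mul1r.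
Qed.

Lemma complete_onto_torus (M : topologicalType) (S : immersed_surface R M) (U : 'M[R[i]]_2) :
  U \is unitarymx -> S @` [set: M] `<=` unitary_image U (clifford_torus R) ->
  complete_surface S -> unitary_image U (clifford_torus R) `<=` S @` [set: M].
Proof.
move=> uU SU cS _ [z /clifford_torusE[z0 z1] <-].
have ST p : unitary_image U (clifford_torus R) (S p) by apply: SU; exists p.
have [p0 _] := surface_nonempty S.
have [w /clifford_torusE[w0 w1] Sp0] := ST p0.
have [a _ ea] := rotate_to w0 z0; have [b _ eb] := rotate_to w1 z1.
have rowE (v : C2 R) : (\row_k (if k == 0 then v 0 0 else v 0 1)) = v.
  by apply/rowP; apply: ord2P; rewrite mxE.
have l0 : S p0 = torus_line U (w 0 0) (w 0 1) a b 0.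
  rewrite -Sp0 /torus_line !mulr0 /cis cos0 sin0 (_ : (1 +i* 0)%C = 1)// !mulr1.
  by rewrite (rowE w).
have [p1 Sp1] := complete_lift uU ST w0 w1 cS l0.
by exists p1 => //; rewrite Sp1 /torus_line !mulr1 -ea -eb (rowE z).
Qed.

End Surjectivity.

(** * The Clifford torus as a surface *)

Section Translations.
Variable R : realType.

Lemma Ck_cst (V : normedModType R) k (A : set 'rV[R]_2) (v : V) : Ck k A (fun=> v).
Proof.
elim: k v => [|k IH] v /=; first by move=> x _; exact: cst_continuous.
split=> [x _|j]; first exact: differentiable_cst.
have -> : 'D_(delta_mx 0 j) (fun=> v) = (fun=> 0) :> ('rV[R]_2 -> V); last exact: IH.
by apply/funext => x; rewrite derive_cst.
Qed.

Variables (A : set 'rV[R]_2) (f : 'rV[R]_2 -> 'rV[R]_2).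
Hypothesis oA : open A.
Hypothesis local_translation : forall x, A x -> \forall y \near x, f y = f x + (y - x).

Lemma is_diff_translation (x : 'rV[R]_2) (c : 'rV[R]_2) : is_diff x (fun y => c + (y - x)) id.
Proof.
have H : is_diff x (cst c + (id - cst x)) (0 + (id - 0)).
  by apply: is_diffD; apply: is_diffB.
by apply: (is_diff_eq H); rewrite subr0 add0r.
Qed.

Lemma local_translation_differentiable x : A x -> differentiable f x.
Proof.
move=> Ax; have [d _] := is_diff_translation x (f x).
apply: near_eq_differentiable d; apply: filterS (local_translation Ax) => y ->.
by [].
Qed.

Lemma local_translation_derive x v : A x -> 'D_v f x = v.
Proof.
move=> Ax; rewrite (near_eq_derive _ (local_translation Ax)).
have [d e] := is_diff_translation x (f x).
by rewrite deriveE// e.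
Qed.

Lemma local_translation_smooth : smooth A f.
Proof.
case=> [x Ax|k]; first exact: differentiable_continuous (local_translation_differentiable Ax).
split=> [x Ax|j]; first exact: local_translation_differentiable.
apply: (@Ck_eq_on _ _ k A (fun=> delta_mx 0 j)) => //; last exact: Ck_cst.
by move=> x Ax; rewrite local_translation_derive.
Qed.

Lemma local_translation_jacobian x : A x -> 'J f x = 1%:M.
Proof.
move=> Ax; apply/matrixP => i j; rewrite !mxE -deriveE; last exact: local_translation_differentiable.
by rewrite local_translation_derive// mxE eqxx eq_sym.
Qed.

End Translations.

Section Phases.
Variable R : realType.
Implicit Types (v w : C2 R) (a x y : 'rV[R]_2).

Definition phase v x : C2 R := \row_k (v 0 k * cis (x 0 k)).

(** The coefficient vector of the derivative of [phase v] in the j-th angle. *)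
Definition angular (j : 'I_2) v : C2 R := \row_k (if k == j then 'i%C * v 0 k else 0).

Lemma cisD (s t : R) : cis (s + t) = cis s * cis t.
Proof. by apply: complex_eq; rewrite ReImE /= ?cosD ?sinD; ring. Qed.

Lemma phaseD v a x : phase v (a + x) = phase (phase v a) x.
Proof. by apply/rowP => k; rewrite !mxE cisD mulrA. Qed.

Lemma inner_phase v w x : inner (phase v x) (phase w x) = inner v w.
Proof.
have H (r s : R[i]) t : (r * cis t) * (s * cis t)^*%C = r * s^*%C.
  by rewrite conjcM mulrACA cis_normed mulr1.
by rewrite /inner !hprodE !mxE !H.
Qed.

Lemma derive_entry (g : R -> R^o) x u k (t := x 0 k) : derivable g t 1 ->
  is_derive x u (fun y => g (y 0 k) : R^o) (u 0 k * 'D_1 g t).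
Proof.
move=> dg; have dg' : differentiable g t by exact/derivable1_diffP.
have E : (fun h : R => h^-1 *: (((fun y => g (y 0 k)) \o shift x) (h *: u) - g (x 0 k))) =
    (fun h : R => h^-1 *: ((g \o shift t) (h *: (u 0 k)) - g t)).
  by apply/funext => h; rewrite /= !mxE.
have D : 'D_(u 0 k) g t = u 0 k * 'D_1 g t.
  rewrite !deriveE//; have : 'd g t (u 0 k *: (1 : R^o)) = u 0 k *: 'd g t 1 by exact: linearZ.
  by rewrite [u 0 k *: 1]mulr1.
have : derivable g t (u 0 k) by exact: diff_derivable.
rewrite /derivable -E => h.
by apply: DeriveDef => //; rewrite -D /derive -E.
Qed.

Lemma is_derive_Re_phase (z : R[i]) x u k :
  is_derive x u (fun y => Re (z * cis (y 0 k)) : R^o) (u 0 k * Re ('i%C * z * cis (x 0 k))).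
Proof.
have D := is_derive_Re_cis z 1 0 1 (x 0 k).
have {}D : is_derive (x 0 k) 1 (fun t : R => Re (z * cis t) : R^o) (Re ('i%C * z * cis (x 0 k))).
  move: D; under eq_fun do rewrite mul1r add0r mul1r.
  by rewrite !mul1r add0r.
by case: D => d <-; exact: derive_entry.
Qed.

Lemma ImRe (z w : R[i]) : Im (z * w) = Re ((- 'i%C * z) * w).
Proof. by rewrite !ReImE /=; ring. Qed.

Lemma is_derive_Im_phase (z : R[i]) x u k :
  is_derive x u (fun y => Im (z * cis (y 0 k)) : R^o) (u 0 k * Im ('i%C * z * cis (x 0 k))).
Proof.
under eq_fun do rewrite ImRe; apply: (is_derive_eq (is_derive_Re_phase _ _ _ _)).
by rewrite ImRe mulrCA.
Qed.

Lemma differentiable_Re_phase (z : R[i]) x k :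
  differentiable (fun y => Re (z * cis (y 0 k)) : R^o) x.
Proof.
have [d _] := is_derive_Re_cis z 1 0 1 (x 0 k).
move: d; under eq_fun do rewrite mul1r add0r mul1r.
move/derivable1_diffP => d.
exact: differentiable_comp (differentiable_coord x 0 k) d.
Qed.

(** The induction generalises over [z], since a partial derivative only multiplies [z] by i or by
    0. *)
Lemma Ck_Re_phase n A (z : R[i]) k : Ck n A (fun y => Re (z * cis (y 0 k)) : R^o).
Proof.
elim: n z => [|n IH] z /=.
  by move=> x _; apply: differentiable_continuous; exact: differentiable_Re_phase.
split=> [x _|j]; first exact: differentiable_Re_phase.
rewrite (_ : (fun y => _) = fun y => Re (((j == k)%:R * 'i%C * z) * cis (y 0 k))); first exact: IH.
apply/funext => y; have [_ ->] := is_derive_Re_phase z y (delta_mx 0 j) k.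
by rewrite mxE eqxx /= eq_sym; case: (_ == _); rewrite ?mul1r ?mul0r //= ?mul0r.
Qed.

Lemma smooth_phase A v a : smoothC2 A (fun y => phase v (a + y)).
Proof.
move=> k; split=> n.
  under eq_fun do rewrite phaseD mxE; exact: Ck_Re_phase.
under eq_fun do rewrite phaseD mxE ImRe; exact: Ck_Re_phase.
Qed.

Lemma pdiff_phase j v a : pdiff j (fun y => phase v (a + y)) = fun y => phase (angular j v) (a + y).
Proof.
apply/funext => y; apply/rowP => k.
have E : phase (angular j v) (a + y) 0 k = (k == j)%:R * ('i%C * phase v a 0 k * cis (y 0 k)).
  by rewrite phaseD !mxE; case: (k == j); rewrite ?mul1r ?mul0r ?mulrA.
apply: pdiff_val.
  under eq_fun do rewrite phaseD mxE.
  apply: (is_derive_eq (is_derive_Re_phase _ _ _ _)); rewrite E mxE eqxx /=.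
  by case: (k == j); rewrite ?mul1r ?mul0r.
under eq_fun do rewrite phaseD mxE.
apply: (is_derive_eq (is_derive_Im_phase _ _ _ _)); rewrite E mxE eqxx /=.
by case: (k == j); rewrite ?mul1r ?mul0r.
Qed.

End Phases.

(** * Topology of the torus *)

Section RealTorus.
Variable R : realType.

(* Row k of the matrix holds the real and imaginary parts of z_k. *)
Definition real_torus : set 'M[R]_2 := [set m | forall k, m k 0 ^+ 2 + m k 1 ^+ 2 = 2^-1].

Definition torus_radius : R := Num.sqrt 2^-1.

Lemma torus_radius_sqr : torus_radius ^+ 2 = 2^-1.
Proof. by rewrite sqr_sqrtr// invr_ge0. Qed.

Lemma torus_radius_gt0 : 0 < torus_radius.
Proof. by rewrite sqrtr_gt0 invr_gt0. Qed.

Definition angle_matrix (x : 'rV[R]_2) : 'M[R]_2 :=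
  \matrix_(k, j) (torus_radius * if j == 0 then cos (x 0 k) else sin (x 0 k)).

Lemma angle_matrix_torus x : real_torus (angle_matrix x).
Proof. by move=> k; rewrite !mxE /= !exprMn -mulrDr cos2Dsin2 mulr1 torus_radius_sqr. Qed.

Definition angle_point (x : 'rV[R]_2) : real_torus :=
  exist _ (angle_matrix x) (mem_set (angle_matrix_torus x)).

Definition torus_embedding (p : real_torus) : C2 R := \row_k (\val p k 0 +i* \val p k 1)%C.

Definition radius_vector : C2 R := \row_k torus_radius%:C%C.

Lemma torus_embedding_angle x : torus_embedding (angle_point x) = phase radius_vector x.
Proof. by apply/rowP => k; rewrite !mxE; apply: complex_eq; rewrite !ReImE /=; ring. Qed.

Lemma torus_embedding_inj : injective torus_embedding.
Proof.
move=> p q /rowP E; apply: val_inj; apply/matrixP => k j.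
have := E k; rewrite !mxE => -[e0 e1].
by move: j; apply: ord2P.
Qed.

Lemma torus_entries (p : real_torus) k : \val p k 0 ^+ 2 + \val p k 1 ^+ 2 = 2^-1.
Proof. by have /set_mem := valP p; apply. Qed.

Lemma torus_embedding_clifford p : clifford_torus R (torus_embedding p).
Proof.
have h k : torus_embedding p 0 k * (torus_embedding p 0 k)^*%C = 2^-1.
  rewrite (_ : 2^-1 = (2^-1)%:C%C); last by rewrite fmorphV /= rmorph_nat.
  rewrite -(torus_entries p k) !mxE.
  by apply: complex_eq; rewrite !ReImE /=; ring.
by apply/clifford_torusE.
Qed.

Lemma real_torus_clifford z : clifford_torus R z -> exists p, torus_embedding p = z.
Proof.
move=> /clifford_torusE[z0 z1].
pose m : 'M[R]_2 := \matrix_(k, j) if j == 0 then Re (z 0 k) else Im (z 0 k).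
have mT : real_torus m.
  have h (w : R[i]) : w * w^*%C = 2^-1 -> Re w ^+ 2 + Im w ^+ 2 = 2^-1.
    rewrite (_ : 2^-1 = (2^-1)%:C%C); last by rewrite fmorphV /= rmorph_nat.
    by move/(congr1 (@complex.Re R)); rewrite ReM ReJ ImJ /= => <-; ring.
  by apply: ord2P; rewrite !mxE /=; exact: h.
exists (exist _ m (mem_set mT)); apply/rowP => k; rewrite !mxE /=.
by apply: complex_eq.
Qed.

Lemma angle_point_onto p : exists2 x : 'rV[R]_2,
  forall k, - pi <= x 0 k <= pi & angle_point x = p.
Proof.
have /clifford_torusE := torus_embedding_clifford p.
have hr : torus_radius%:C%C * (torus_radius%:C%C)^*%C = 2^-1 :> R[i].
  by rewrite conjc_real -rmorphM /= -expr2 torus_radius_sqr fmorphV /= rmorph_nat.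
case=> /(rotate_to hr)[s hs Es] /(rotate_to hr)[t ht Et].
exists (\row_k (if k == 0 then s else t)); first by apply: ord2P; rewrite mxE.
by apply: torus_embedding_inj; rewrite torus_embedding_angle; apply: C2_eq;
  rewrite ?Es ?Et !mxE.
Qed.

Lemma angle_matrix_continuous : continuous angle_matrix.
Proof.
move=> x; apply/(@cvgrPdist_le _ 'M[R]_2 _ (nbhs x) (nbhs_filter x)) => e e0.
have ck (k j : 'I_2) : {for x, continuous (fun y : 'rV[R]_2 =>
    torus_radius * (if j == 0 then cos (y 0 k) else sin (y 0 k)) : R^o)}.
  apply: continuousM; first exact: cst_continuous.
  case: (j == 0); apply: continuous_comp; first [exact: coord_continuous | exact: continuous_cos | exact: continuous_sin].
have : \forall y \near x, forall i : 'I_2 * 'I_2, `|angle_matrix x i.1 i.2 - angle_matrix y i.1 i.2| <= e.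
  apply: (@filter_forall _ _ (fun i y => `|angle_matrix x i.1 i.2 - angle_matrix y i.1 i.2| <= e) (nbhs x) _) => i.
  have /cvgrPdist_le/(_ _ e0) := ck i.1 i.2.
  by apply: filterS => y; rewrite !mxE.
apply: filterS => y Hy; rewrite /Num.Def.normr/= mx_normrE (bigmax_le _ (ltW e0))//= => i _.
by have := Hy i; rewrite !mxE.
Qed.

Lemma angle_point_continuous : continuous angle_point.
Proof. by apply: continuous_comp_initial; exact: angle_matrix_continuous. Qed.

Lemma val_torus_continuous : continuous (fun p : real_torus => \val p : 'M[R]_2).
Proof. exact: initial_continuous. Qed.

Lemma real_torus_compact : compact [set: real_torus].
Proof.
have box : compact [set x : 'rV[R]_2 | forall k, [set` `[- pi, pi : R]] (x 0 k)].
  by apply: (@rV_compact _ _ (fun=> [set` `[- pi, pi : R]])) => k; exact: segment_compact.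
rewrite (_ : [set: _] =
    angle_point @` [set x : 'rV[R]_2 | forall k, [set` `[- pi, pi : R]] (x 0 k)]).
  apply: continuous_compact box; apply: continuous_subspaceT; exact: angle_point_continuous.
apply/seteqP; split=> // p _; have [x hx <-] := angle_point_onto p.
by exists x => // k; rewrite /= in_itv /=; exact: hx.
Qed.

(** The torus is the union of the images of the lines through the origin of the angle plane, all of
    which contain the point of angle 0. *)
Lemma real_torus_connected : connected [set: real_torus].
Proof.
pose ray (x : 'rV[R]_2) (t : R) := angle_point (t *: x).
rewrite (_ : [set: _] = \bigcup_(x in setT) (ray x @` [set: R])).
  apply: bigcup_connected.
    by exists (angle_point 0) => x _; exists 0 => //; rewrite /ray scale0r.
  move=> x _; apply: connected_continuous_connected.
    by apply/connected_intervalP => ? ? _ _ ? _.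
  apply: continuous_subspaceT => t; apply: continuous_comp.
    by apply: cvgZr_tmp; exact: cvg_id.
  exact: angle_point_continuous.
apply/seteqP; split=> // p _; have [x _ <-] := angle_point_onto p.
by exists x => //; exists 1 => //; rewrite /ray scale1r.
Qed.

Lemma real_torus_hausdorff : hausdorff_space real_torus.
Proof.
move=> p q pq; apply: val_inj; apply: (@norm_hausdorff _ 'M[R]_2) => A B nA nB.
have [r [Ar Br]] := pq _ _ (@val_torus_continuous p _ nA) (@val_torus_continuous q _ nB).
by exists (\val r).
Qed.

HB.instance Definition _ := isPointed.Build real_torus (angle_point 0).

Lemma real_torus_second_countable : @second_countable real_torus.
Proof. exact: (compact_second_countable real_torus_compact). Qed.

End RealTorus.

(** * Charts by pairs of angles *)

Section AngleCharts.
Variable R : realType.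
Local Notation torus := (@real_torus R).
Implicit Types (x y : 'rV[R]_2) (p : torus).

Variable base : 'rV[R]_2.

(** Together with [rotated_im], the k-th coordinate of [p] turned by minus the k-th angle of [base].
    On the right half plane the arctangent of the quotient recovers the angle. *)
Definition rotated_re (k : 'I_2) p : R :=
  \val p k 0 * cos (base 0 k) + \val p k 1 * sin (base 0 k).

Definition rotated_im (k : 'I_2) p : R :=
  \val p k 1 * cos (base 0 k) - \val p k 0 * sin (base 0 k).

Definition angle_square : set 'rV[R]_2 := [set x | forall k, - (pi / 2) < x 0 k < pi / 2].

Definition angle_dom : set torus := [set p | forall k, 0 < rotated_re k p].

Definition angle_coord p : 'rV[R]_2 := \row_k atan (rotated_im k p / rotated_re k p).

Definition angle_param x : torus := angle_point (base + x).

Lemma rotated_re_param k x : rotated_re k (angle_param x) = torus_radius R * cos (x 0 k).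
Proof.
rewrite /rotated_re !mxE /= cosD sinD.
rewrite -[X in _ = _ * X]mul1r -[X in _ = _ * (X * _)](cos2Dsin2 (base 0 k)); ring.
Qed.

Lemma rotated_im_param k x : rotated_im k (angle_param x) = torus_radius R * sin (x 0 k).
Proof.
rewrite /rotated_im !mxE /= cosD sinD.
rewrite -[X in _ = _ * X]mul1r -[X in _ = _ * (X * _)](cos2Dsin2 (base 0 k)); ring.
Qed.

Lemma rotated_sqr k p : rotated_re k p ^+ 2 + rotated_im k p ^+ 2 = 2^-1.
Proof.
rewrite -(torus_entries p k) -[RHS]mulr1 -[X in _ = _ * X](cos2Dsin2 (base 0 k)).
by rewrite /rotated_re /rotated_im; ring.
Qed.

Lemma angle_coord_codom p : angle_dom p -> angle_square (angle_coord p).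
Proof. by move=> _ k; rewrite mxE atan_gtNpi2 atan_ltpi2. Qed.

Lemma angle_param_dom x : angle_square x -> angle_dom (angle_param x).
Proof. by move=> sx k; rewrite rotated_re_param mulr_gt0 ?torus_radius_gt0 ?cos_gt0_pihalf. Qed.

Lemma angle_paramK x : angle_square x -> angle_coord (angle_param x) = x.
Proof.
move=> sx; apply/rowP => k; rewrite mxE rotated_re_param rotated_im_param.
rewrite -mulf_div divff ?gt_eqF ?torus_radius_gt0// mul1r.
by rewrite tanK// in_itv /= sx.
Qed.

Lemma angle_coordK p : angle_dom p -> angle_param (angle_coord p) = p.
Proof.
move=> dp.
have re_eq k : rotated_re k (angle_param (angle_coord p)) = rotated_re k p.
  have u0 := dp k; have r0 := torus_radius_gt0 R.
  rewrite rotated_re_param mxE cos_atan.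
  have -> : 1 + (rotated_im k p / rotated_re k p) ^+ 2 = (torus_radius R / rotated_re k p) ^+ 2.
    rewrite [in RHS]expr_div_n torus_radius_sqr -(rotated_sqr k p); field.
    by rewrite gt_eqF.
  rewrite sqrtr_sqr gtr0_norm ?divr_gt0// invf_div mulrC mulfVK// gt_eqF//.
have im_eq k : rotated_im k (angle_param (angle_coord p)) = rotated_im k p.
  have c0 : cos (angle_coord p 0 k) != 0.
    by rewrite gt_eqF// cos_gt0_pihalf// mxE atan_gtNpi2 atan_ltpi2.
  have u0 := dp k.
  have -> : rotated_im k (angle_param (angle_coord p)) =
      rotated_re k (angle_param (angle_coord p)) * tan (angle_coord p 0 k).
    by rewrite rotated_im_param rotated_re_param -mulrA [cos _ * _]mulrC divfK.
  by rewrite re_eq mxE atanK mulrC divfK// gt_eqF.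
apply: val_inj; apply/matrixP => k j.
have rot (a b a' b' c s : R) : c ^+ 2 + s ^+ 2 = 1 ->
    a * c + b * s = a' * c + b' * s -> b * c - a * s = b' * c - a' * s -> a = a' /\ b = b'.
  move=> cs e1 e2; split.
    have -> : a = (a * c + b * s) * c - (b * c - a * s) * s + a * (1 - (c ^+ 2 + s ^+ 2)) by ring.
    by rewrite e1 e2 cs; rewrite -[in RHS](mulr1 a') -[X in _ = _ * X]cs; ring.
  have -> : b = (a * c + b * s) * s + (b * c - a * s) * c + b * (1 - (c ^+ 2 + s ^+ 2)) by ring.
  by rewrite e1 e2 cs; rewrite -[in RHS](mulr1 b') -[X in _ = _ * X]cs; ring.
have [e0 e1] := rot _ _ _ _ _ _ (cos2Dsin2 (base 0 k)) (re_eq k) (im_eq k).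
by move: j; apply: ord2P.
Qed.

Lemma torus_entry_continuous (k j : 'I_2) :
  continuous (fun q : torus => (\val q : 'M[R]_2) k j : R^o).
Proof.
move=> p; apply: (@continuous_comp _ _ _ (fun q : torus => \val q : 'M[R]_2) (fun m => m k j : R^o)).
  exact: val_torus_continuous.
exact: coord_continuous.
Qed.

Lemma rotated_continuous (k : 'I_2) p :
  {for p, continuous (fun q : torus => rotated_re k q : R^o)} /\
  {for p, continuous (fun q : torus => rotated_im k q : R^o)}.
Proof.
have c0 := @torus_entry_continuous k 0 p; have c1 := @torus_entry_continuous k 1 p.
split.
  by apply: continuousD; apply: continuousM => //; exact: cst_continuous.
by apply: continuousB; apply: continuousM => //; exact: cst_continuous.
Qed.

Lemma angle_dom_open : open angle_dom.
Proof.
rewrite openE => p dp.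
apply: (@filter_forall torus 'I_2 (fun k q => 0 < rotated_re k q) (nbhs p) _) => k.
have [/cvgrPdist_lt/(_ _ (dp k)) c _] := rotated_continuous k p.
by apply: filterS c => q; rewrite ltr_norml => /andP[_]; lra.
Qed.

Lemma angle_square_open : open angle_square.
Proof.
rewrite openE => x sx.
apply: (@filter_forall 'rV[R]_2 'I_2 (fun k (y : 'rV[R]_2) => - (pi / 2) < y 0 k < pi / 2) (nbhs x) _) => k.
have sxk : x 0 k \in `](- (pi / 2)), (pi / 2)[ by rewrite in_itv; exact: sx.
have H := @coord_continuous R 1 2 0 k x _ (near_in_itvoo sxk).
have {}H : \forall y \near x, (y : 'rV[R]_2) 0 k \in `](- (pi / 2)), (pi / 2)[ by [].
by apply: filterS H => y; rewrite in_itv.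
Qed.

Lemma angle_coord_continuous p : angle_dom p -> {for p, continuous angle_coord}.
Proof.
move=> dp; apply: continuous_row => k; have [cr ci] := rotated_continuous k p.
apply: continuous_comp; last exact: continuous_atan.
apply: continuousM => //; apply: continuousV => //.
by rewrite gt_eqF//; exact: dp.
Qed.

Lemma angle_param_continuous x : {for x, continuous angle_param}.
Proof.
apply: continuous_comp; last exact: angle_point_continuous.
by apply: continuousD; [exact: cst_continuous|exact: cvg_id].
Qed.

Definition angle_chart : chart R torus :=
  Chart angle_dom_open angle_square_open angle_coord_codom angle_param_dom angle_coordK
    angle_paramK angle_coord_continuous (fun x _ => @angle_param_continuous x).

End AngleCharts.

(** * Geometry of the Clifford torus *)

Section CliffordSurface.
Variable R : realType.
Local Notation torus := (@real_torus R).
Implicit Types (x y a b : 'rV[R]_2) (p : torus).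

Lemma angle_pointD x y u : angle_point x = angle_point y -> angle_point (x + u) = angle_point (y + u).
Proof.
move=> /(congr1 val)/matrixP E; apply: val_inj; apply/matrixP => k j.
have r0 : torus_radius R != 0 by rewrite gt_eqF// torus_radius_gt0.
have [e0 e1] : cos (x 0 k) = cos (y 0 k) /\ sin (x 0 k) = sin (y 0 k).
  by split; [have := E k 0|have := E k 1]; rewrite !mxE /= => /(mulfI r0).
by rewrite !mxE cosD sinD e0 e1 -cosD -sinD.
Qed.

(** Two angle vectors of one point still give one point after a common shift. For [y] near [x] the
    shifted vector remains in the open square, so it is the coordinate vector of that point. *)
Lemma angle_transition a b x (c := angle_chart a) (d := angle_chart b) : overlap c d x ->
  \forall y \near x, transition c d y = transition c d x + (y - x).
Proof.
move=> [cx dx]; set z := transition c d x.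
have sz : angle_square z by exact: (@coord_codom _ _ d).
have Ez : angle_point (b + z) = angle_point (a + x) by exact: (@coordK _ _ d).
have ct : {for x, continuous (fun y => z + (y - x) : 'rV[R]_2)}.
  by apply: continuousD; [exact: cst_continuous|apply: continuousB; [exact: cvg_id|exact: cst_continuous]].
have nz : nbhs (z + (x - x)) (@angle_square R).
  by rewrite subrr addr0; apply: open_nbhs_nbhs; split=> //; exact: angle_square_open.
have ny : \forall y \near x, angle_square (z + (y - x)) by exact: ct nz.
apply: filterS ny => y sy.
rewrite -[RHS](@paramK _ _ d)//; rewrite /transition /=; congr (angle_coord _ _).
rewrite /angle_param addrA (angle_pointD _ Ez); congr angle_point.
by rewrite -addrA [x + _]addrC subrK.
Qed.

Lemma overlap_is_open (M : topologicalType) (c d : chart R M) : open (overlap c d).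
Proof. by rewrite openE => x; exact: overlap_open. Qed.

Definition angle_atlas : set (chart R torus) := range (@angle_chart R).

Lemma angle_atlas_is_atlas : is_atlas angle_atlas.
Proof.
split=> [p|_ _ [a _ <-] [b _ <-]].
  have [x _ <-] := angle_point_onto p; exists (angle_chart x); first by exists x.
  move=> k; rewrite -[in angle_point x](addr0 x) -/(angle_param x 0) rotated_re_param mxE cos0 mulr1.
  exact: torus_radius_gt0.
by split; apply: local_translation_smooth; do ?exact: overlap_is_open; move=> x; exact: angle_transition.
Qed.

Lemma angle_jacobian a b x : overlap (angle_chart a) (angle_chart b) x ->
  'J (transition (angle_chart a) (angle_chart b)) x = 1%:M.
Proof. by apply: local_translation_jacobian => y; exact: angle_transition. Qed.

Lemma torus_embedding_param a :
  @torus_embedding R \o param (angle_chart a) = fun y => phase (radius_vector R) (a + y).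
Proof. by apply/funext => y; rewrite /= torus_embedding_angle. Qed.

Lemma torus_embedding_sphere3 p : sphere3 (torus_embedding p).
Proof.
have /clifford_torusE[h0 h1] := torus_embedding_clifford p.
rewrite /sphere3 /= hprodE h0 h1 -[2^-1]mul1r -mulrDl -[1 + 1]/(2%:R).
by rewrite divff// pnatr_eq0.
Qed.

Lemma torus_embedding_smooth c : angle_atlas c -> smoothC2 (codom c) (@torus_embedding R \o param c).
Proof. by case=> a _ <-; rewrite torus_embedding_param; exact: smooth_phase. Qed.

Lemma differential_phase v a x (u : 'rV[R]_2) :
  differentialC2 (fun y => phase v (a + y)) x u =
  phase (\row_k ((u 0 k)%:C%C * 'i%C * v 0 k)) (a + x).
Proof.
rewrite differentialE !pdiff_phase; apply/rowP; apply: ord2P; rewrite !mxE /=; ring.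
Qed.

Lemma torus_embedding_injective_differential c x : angle_atlas c -> codom c x ->
  injective (differentialC2 (@torus_embedding R \o param c) x).
Proof.
move=> [a _ <-] _ u w; rewrite torus_embedding_param !differential_phase => /rowP E.
apply/rowP => k; have := E k; rewrite !mxE.
have c0 t : cis t != 0 :> R[i].
  by apply: contra_eq_neq (cis_normed t) => ->; rewrite mul0r eq_sym oner_neq0.
have r0 : (torus_radius R)%:C%C != 0 :> R[i] by rewrite fmorph_eq0 gt_eqF// torus_radius_gt0.
have i0 : 'i%C != 0 :> R[i].
  by apply/eqP => /(congr1 (@complex.Im R))/eqP; rewrite /= oner_eq0.
by move=> /(mulIf (c0 _))/(mulIf r0)/(mulIf i0)[].
Qed.

Definition clifford_surface : immersed_surface R torus :=
  ImmersedSurface (@real_torus_hausdorff R) (@real_torus_second_countable R)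
    (@real_torus_connected R) (ex_intro _ (angle_point 0) I) angle_atlas_is_atlas
    torus_embedding_sphere3 torus_embedding_smooth torus_embedding_injective_differential.
Local Notation S := clifford_surface.

Lemma clifford_surface_orientable : orientable S.
Proof.
exists angle_atlas; split; first exact: angle_atlas_is_atlas.
  by move=> c d Ac Ad; apply: angle_atlas_is_atlas.2.
by move=> _ _ x [a _ <-] [b _ <-] oab; rewrite angle_jacobian// det1.
Qed.

Lemma inner_angular (i j : 'I_2) :
  inner (angular i (radius_vector R)) (angular j (radius_vector R)) = (i == j)%:R / 2.
Proof.
have r2 := torus_radius_sqr R.
by rewrite innerE; move: i j; apply: ord2P; apply: ord2P; rewrite !mxE !ReImE /= -r2; ring.
Qed.

Lemma angular_laplacian y (v : C2 R) :
  phase (angular 0 (angular 0 v)) y + phase (angular 1 (angular 1 v)) y = - 1 *: phase v y.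
Proof.
by apply/rowP; apply: ord2P; rewrite !mxE /=; apply: complex_eq; rewrite !ReImE /=; ring.
Qed.

(** The first fundamental form is half the identity, so the mean curvature is a multiple of the
    Laplacian of the position vector paired with the normal. This Laplacian is minus the position
    vector, which is orthogonal to the normal. *)
Lemma clifford_surface_minimal : minimal S.
Proof.
move=> _ x n [a _ <-] _ [_ Fn _].
have EF : local_param S (angle_chart a) = fun y => phase (radius_vector R) (a + y).
  exact: torus_embedding_param.
rewrite /tangent_sphere3 EF in Fn.
rewrite /mean_curvature mxtrace_invmx2 !mxE !partial_pdiff EF !pdiff_phase !inner_phase !inner_angular /=.
  rewrite !mul0r !subr0.
  have := innerDl (phase (angular 0 (angular 0 (radius_vector R))) (a + x))
    (phase (angular 1 (angular 1 (radius_vector R))) (a + x)) n.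
  rewrite angular_laplacian inner_scalel Fn /= oppr0 mul0r mulr0 addr0 => h.
  by rewrite -mulrDr -h !mulr0.
by rewrite !mul0r subr0 mul1r mulf_neq0// invr_neq0// pnatr_eq0.
Qed.

Lemma clifford_surface_contact_angle : constant_contact_angle S.
Proof.
exists 0 => _ x [a _ <-] sx; set c := angle_chart a.
have EF : local_param S c = fun y => phase (radius_vector R) (a + y).
  exact: torus_embedding_param.
(* Moving both angles at equal speed is multiplication by a phase, so the direction (1, 1) gives the
   Reeb field and serves as e2. The orthogonal direction (1, -1) is then characteristic; the squared
   radius 1/2 makes both vectors unit. *)
pose u1 : 'rV[R]_2 := \row_k (if k == 0 then 1 else -1).
pose e (u : 'rV[R]_2) : C2 R := \row_k ((u 0 k)%:C%C * 'i%C * radius_vector R 0 k).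
have ee (u w : 'rV[R]_2) : inner (e u) (e w) = (u 0 0 * w 0 0 + u 0 1 * w 0 1) / 2.
  by rewrite innerE !mxE !ReImE /= -torus_radius_sqr; ring.
exists (codom c); split=> //; first exact: codom_open.
exists (fun y => phase (e u1) (a + y)), (fun y => phase (e (const_mx 1)) (a + y)).
split; [exact: smooth_phase|exact: smooth_phase|move=> y _].
have iF : 'i%C *: phase (radius_vector R) (a + y) = phase (e (const_mx 1)) (a + y).
  by apply/rowP => k; rewrite !mxE; apply: complex_eq; rewrite !ReImE /=; ring.
split.
- by split; rewrite /tangent_plane EF; [exists u1|exists (const_mx 1)] => //; rewrite differential_phase.
- by rewrite !inner_phase !ee !mxE /=; split; [field|field|ring].
- rewrite /contact_distribution /tangent_sphere3 /reeb EF iF !inner_phase ee !mxE /=; split; last by ring.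
  by rewrite innerE !mxE !ReImE /=; ring.
- by rewrite sin0 cos0 /reeb EF iF rmorph0 rmorph1 scale0r add0r scale1r.
Qed.

End CliffordSurface.

Unset Implicit Arguments.
Set Strict Implicit.

Theorem theorem1 (R : realType) :
  (exists (M : topologicalType) (S : immersed_surface R M),
     [/\ compact [set: M], injective S, S @` [set: M] = clifford_torus R,
         orientable S & minimal S /\ constant_contact_angle S]) /\
  (forall (M : topologicalType) (S : immersed_surface R M),
     orientable S -> minimal S -> constant_contact_angle S ->
     exists2 U : 'M[complex R]_2, U \is unitarymx &
       S @` [set: M] `<=` unitary_image U (clifford_torus R) /\
       (complete_surface S ->
        S @` [set: M] = unitary_image U (clifford_torus R))).
Proof.
split=> [|M S _ mS cS].
  exists (@real_torus R : topologicalType), (clifford_surface R); split.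
  - exact: real_torus_compact.
  - exact: torus_embedding_inj.
  - apply/seteqP; split=> [_ [p _ <-]|z /real_torus_clifford[p <-]].
      exact: torus_embedding_clifford.
    by exists p.
  - exact: clifford_surface_orientable.
  - by split; [exact: clifford_surface_minimal|exact: clifford_surface_contact_angle].
have [U uU SU] := image_in_torus mS cS; exists U => //; split=> // coS.
by apply/seteqP; split=> //; exact: complete_onto_torus.
Qed.
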